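(* Let $r\ge 2$ be an integer. For $s_1,\dots,s_{r-1}\in\mathbb{C}$ and $k\in\mathbb{N}_0$, we have $$\zeta_r^{\rm des}(s_1,\dots,s_{r-1},-k)=\sum_{i+j=k}\binom{k}{i}\,\zeta_{r-1}^{\rm des}(s_1,\dots,s_{r-2},s_{r-1}-i)\,\zeta_1^{\rm des}(-j),$$ where the sum runs over all $i,j\in\mathbb{N}_0$ with $i+j=k$.
   Context: $\mathbb{N}=\{1,2,\dots\}$ and $\mathbb{N}_0=\{0,1,2,\dots\}$. Desingularized multiple zeta-function: for $r\in\mathbb{N}$ and $c\in\mathbb{R}$ put $$\tilde{\mathfrak{H}}_r(t_1,\dots,t_r;c):=\prod_{j=1}^r\left(\frac{1}{\exp\left(\sum_{k=j}^r t_k\right)-1}-\frac{c}{\exp\left(c\sum_{k=j}^r t_k\right)-1}\right).$$ For non-integral complex numbers $s_1,\dots,s_r$, define $$\zeta_r^{\rm des}(s_1,\dots,s_r):=\lim_{\substack{c\to1\\ c\in\mathbb{R}\setminus\{1\}}}\frac{1}{(1-c)^r}\prod_{k=1}^r\frac{1}{(e^{2\pi i s_k}-1)\Gamma(s_k)}\int_{\mathcal{C}^r}\tilde{\mathfrak{H}}_r(t_1,\dots,t_r;c)\prod_{k=1}^r t_k^{s_k-1}\,dt_k,$$ where $\mathcal{C}$ is the path consisting of the positive real axis (top side), a circle around the origin of sufficiently small radius $\varepsilon$, and the positive real axis (bottom side). It is known (Furusho–Komori–Matsumoto–Tsumura) that $\zeta_r^{\rm des}$ continues analytically to an entire function on $\mathbb{C}^r$,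 also denoted $\zeta_r^{\rm des}$; values at arbitrary points of $\mathbb{C}^r$ refer to this entire function. *)

(* Defs.v *)
From HB Require Import structures.
From mathcomp Require Import all_boot all_order all_algebra.
From mathcomp Require Import all_classical all_reals all_analysis.
From mathcomp Require Import complex.

Set Implicit Arguments.
Unset Strict Implicit.
Unset Printing Implicit Defensive.

Import Order.TTheory GRing.Theory Num.Theory.
Import numFieldNormedType.Exports.
Local Open Scope classical_set_scope.
Local Open Scope ring_scope.
Local Open Scope complex_scope.

Section DesingularizedZeta.
Variable R : realType.
Local Notation C := R[i].

Definition cexp (z : C) : C :=
  (expR (complex.Re z))%:C * (cos (complex.Im z) +i* sin (complex.Im z)).

(* Gauss's formula: n! n^s / (s (s+1) ... (s+n)) tends to Gamma(s) for every
   complex s other than 0, -1, -2, ... *)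
Definition cGamma (s : C) : C :=
  lim ((fun n : nat =>
    n`!%:R * cexp (s * (ln n%:R)%:C) / \prod_(k < n.+1) (s + k%:R) : C^o)
      @ \oo).

Definition cintegral (D : set R) (f : R -> C) : C :=
  (\int[@lebesgue_measure R]_(x in D) complex.Re (f x))%R +i*
  (\int[@lebesgue_measure R]_(x in D) complex.Im (f x))%R.

(* The integral over the path coming in from +oo above the real axis, turning
   once counterclockwise around the circle of radius e, and going back to +oo
   below the axis.  The integrand is given as a function g of w = log t, where
   the argument of t is 0 on the top side and 2 pi on the bottom side, so that
   multivalued integrands such as t^(s-1) = exp ((s-1) w) make sense; the
   integral is with respect to dt. *)
Definition hankel (e : R) (g : C -> C) : C :=
  - cintegral `[e, +oo[ (fun x => g (ln x)%:C)
  + cintegral `[0, 2 * pi]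
      (fun a => g (ln e +i* a) * (0 +i* 1) * cexp (ln e +i* a))
  + cintegral `[e, +oo[ (fun x => g (ln x +i* (2 * pi))).

(* The integral over the n-th power of that path, as an iterated integral in
   which the first coordinate is the outermost variable. *)
Fixpoint hankel_iter (e : R) (n : nat) : ('rV[C]_n -> C) -> C :=
  match n with
  | 0 => fun g => g 0
  | n'.+1 => fun g =>
      hankel e (fun w => hankel_iter e (fun v : 'rV[C]_n' =>
        g (row_mx (w%:M : 'M[C]_1) v)))
  end.

(* The singularity at y = 0 is removable, with value (c - 1) / 2; the sums of
   variables occurring in Hdes do vanish at some points of the paths. *)
Definition hdes (c : R) (y : C) : C :=
  if y == 0 then ((c - 1) / 2)%:C
  else (cexp y - 1)^-1 - c%:C / (cexp (c%:C * y) - 1).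

Definition Hdes (r : nat) (t : 'rV[C]_r) (c : R) : C :=
  \prod_(j < r) hdes c (\sum_(k < r | (j <= k)%N) t 0 k).

Definition zeta_des_approx (r : nat) (e c : R) (s : 'rV[C]_r) : C^o :=
  (((1 - c) ^+ r)^-1)%:C
  * (\prod_(k < r) ((cexp ((0 +i* (2 * pi)) * s 0 k) - 1) * cGamma (s 0 k))^-1)
  * hankel_iter e (fun w : 'rV[C]_r =>
      Hdes (map_mx cexp w) c * \prod_(k < r) cexp ((s 0 k - 1) * w 0 k)).

Definition non_integral (r : nat) (s : 'rV[C]_r) : Prop :=
  forall (k : 'I_r) (m : int), s 0 k != m%:~R.

(* Z is the desingularized multiple zeta-function of depth r: the entire
   function on C^r (unique, the non-integral points being dense) given at
   non-integral points by the limit for c -> 1 of the contour integrals, for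
   all sufficiently small radii e of the circle. *)
Definition is_zeta_des (r : nat) (Z : 'rV[C]_r -> C^o) : Prop :=
  (forall s, differentiable Z s) /\
  \forall e \near (0 : R)^'+, forall s : 'rV[C]_r, non_integral s ->
    zeta_des_approx e c s @[c --> (1 : R)^'] --> Z s.

End DesingularizedZeta.

(* Main.v *)
Require Import Defs.
From HB Require Import structures.
From mathcomp Require Import all_boot all_order all_algebra.
From mathcomp Require Import all_classical all_reals all_analysis.
From mathcomp Require Import measurable_realfun complex.
From mathcomp Require Import ring lra.

(** For fixed c the integrand of depth n is a product over j of h_c(y_j), with
    h_c(y) = 1 / (exp y - 1) - c / (exp (c y) - 1) and y_j = t_j + ... + t_n.
    Put B(y) = y / (exp y - 1). Since y h_c(y) = B(y) - B(c y), the quotient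
    h_c(y) / (1 - c) is the mean of B'
    over the segment from c y to y ([hdes_quotE]); it tends to B'(y) as c
    tends to 1 and is dominated by a decaying exponential uniformly in c.
    Dominated convergence on the iterated contour therefore gives, at
    non-integral points, zeta_n(s) = p(s_1) ... p(s_n) I_n(s) ([zeta_val]), where
    p(z) = 1 / ((exp(2 pi i z) - 1) Gamma(z)) and I_n(s) is the iterated Hankel
    integral of prod_j B'(y_j) prod_k t_k^(s_k - 1), which is continuous in s at
    all points, integral ones included ([zeta_int_cvg]).

    At s_n = - k the integrand is single-valued in t_n. The two sides of the real
    axis cancel and the circle yields the k-th Taylor coefficient at t_n = 0
    ([hankel_residue]). The product rule ([taylor_coefM]) writes it as the sum over
    i + j = k of the i-th coefficient of prod_(l < n) B'(t_l + ... + t_n) times the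
    j-th coefficient of B'. Since t_(n-1) and t_n enter the first factor only through
    their sum, its i-th coefficient is 1/i! times the i-th derivative in t_(n-1) of
    the integrand of depth n - 1; i integrations by parts ([parts_iter]) turn it
    into (-1)^i (s_(n-1) - 1) ... (s_(n-1) - i) / i! times I_(n-1) at s_(n-1) - i.
    The polynomial is exactly p(s_(n-1) - i) / p(s_(n-1)), by the functional
    equation of Gamma ([hankel_pref_sub]).

    What remains is the behaviour of p at - k. By the same functional equation
    p(z - k) = p(z) (z - 1) ... (z - k), so it suffices that p have a limit L at 0,
    and then its limit at - k is L (-1)^k k!. The limit exists because
    zeta_1 = p I_1 is continuous at 0 while I_1(0) = - pi i does not vanish
    ([hankel_pref_lim]). Both sides of the formula contain L as a factor once, and
    the factorials combine into the binomial coefficients ([nonint_case]).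
    Integral s_1, ..., s_(n-1) are reached by continuity along a real translation
    that avoids the integers ([general_case]). *)

Set Implicit Arguments.
Unset Strict Implicit.
Unset Printing Implicit Defensive.

Import Order.TTheory GRing.Theory Num.Theory.
Import numFieldNormedType.Exports.
Import ComplexField.Normc.
Local Open Scope ring_scope.
Local Open Scope complex_scope.

Arguments normc : simpl never.

Local Open Scope classical_set_scope.

(** * Modulus and exponential of complex numbers *)

Section Basics.
Variable R : realType.
Local Notation C := R[i].
Local Notation Re := (@complex.Re R).
Local Notation Im := (@complex.Im R).
Local Notation mu := (@lebesgue_measure R).
Implicit Types (z w : C) (x : R).

Lemma ReD z w : Re (z + w) = Re z + Re w. Proof. by case: z; case: w. Qed.

Lemma ImD z w : Im (z + w) = Im z + Im w. Proof. by case: z; case: w. Qed.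

Lemma ReN z : Re (- z) = - Re z. Proof. by case: z. Qed.

Lemma ImN z : Im (- z) = - Im z. Proof. by case: z. Qed.

Lemma ReM z w : Re (z * w) = Re z * Re w - Im z * Im w. Proof. by case: z; case: w. Qed.

Lemma ImM z w : Im (z * w) = Re z * Im w + Im z * Re w. Proof. by case: z; case: w. Qed.

Lemma ReV z : Re (z^-1) = Re z / (Re z ^+ 2 + Im z ^+ 2).
Proof. by case: z. Qed.

Lemma ImV z : Im (z^-1) = - (Im z / (Re z ^+ 2 + Im z ^+ 2)).
Proof. by case: z => a b. Qed.

Lemma complexP z w : Re z = Re w -> Im z = Im w -> z = w.
Proof. by case: z; case: w => a b c d /= -> ->. Qed.

Lemma abs_Re z : `|Re z| <= normc z.
Proof. by case: z => a b /=; rewrite -sqrtr_sqr ler_wsqrtr// lerDl sqr_ge0. Qed.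

Lemma abs_Im z : `|Im z| <= normc z.
Proof. by case: z => a b /=; rewrite -sqrtr_sqr ler_wsqrtr// lerDr sqr_ge0. Qed.

Lemma normc_ge0 z : 0 <= normc z. Proof. by case: z => a b; exact: sqrtr_ge0. Qed.

Lemma normcR x : normc x%:C = `|x|.
Proof. by rewrite /normc /= expr0n addr0 sqrtr_sqr. Qed.

Lemma normci x : normc (0 +i* x) = `|x|.
Proof. by rewrite /normc /= expr0n add0r sqrtr_sqr. Qed.

Lemma ler_normcD z w : normc (z + w) <= normc z + normc w.
Proof. exact: le_normcD. Qed.

Lemma normc_le z : normc z <= `|Re z| + `|Im z|.
Proof.
have -> : z = (Re z)%:C + (0 +i* Im z) by apply: complexP; rewrite ?ReD ?ImD/= ?addr0 ?add0r.
by rewrite (le_trans (ler_normcD _ _))// normcR normci ReD ImD /= !addr0 add0r.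
Qed.

Lemma cexpD z w : cexp (z + w) = cexp z * cexp w.
Proof.
apply: complexP; rewrite /cexp !(ReM, ImM, ReD, ImD) /= expRD ?cosD ?sinD; ring.
Qed.

Lemma cexp0 : cexp 0 = 1 :> C.
Proof. by apply: complexP; rewrite /cexp !(ReM, ImM) /= expR0 cos0 sin0; ring. Qed.

Lemma normc_cexp z : normc (cexp z) = expR (Re z).
Proof.
rewrite /cexp normcM normcR ger0_norm ?expR_ge0// /normc.
by rewrite cos2Dsin2 sqrtr1 mulr1.
Qed.

Lemma cexp_neq0 z : cexp z != 0.
Proof.
apply/eqP => h; have := normc_cexp z; rewrite h (@normc0 R) => /eqP.
by rewrite lt_eqF// expR_gt0.
Qed.

Lemma cexpN z : cexp (- z) = (cexp z)^-1.
Proof.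
apply: (mulfI (cexp_neq0 z)); rewrite -cexpD subrr cexp0 divff//; exact: cexp_neq0.
Qed.

Lemma cexp_ln x : 0 < x -> cexp (ln x)%:C = x%:C.
Proof.
by move=> x0; rewrite /cexp /= lnK// cos0 sin0; apply: complexP; rewrite ?ReM ?ImM/=; ring.
Qed.

Lemma cexp_nat (n : nat) z : cexp (n%:R * z) = cexp z ^+ n.
Proof.
elim: n => [|n IH]; first by rewrite mul0r cexp0.
by rewrite -natr1 mulrDl mul1r cexpD IH exprSr.
Qed.

Lemma cexp_2pii : cexp (0 +i* (2 * pi)) = 1 :> C.
Proof. by rewrite /cexp /= expR0 mulr_natl cos2pi sin2pi; apply: complexP; rewrite ?ReM ?ImM/=;
  ring. Qed.

Lemma normc_1 : normc (1 : C) = 1.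
Proof. by rewrite -[1]/((1 : R)%:C) normcR normr1. Qed.

Lemma normc_0 : normc (0 : C) = 0.
Proof. exact: normc0. Qed.
End Basics.

(** * Limits of complex sequences and derivatives along real paths *)

Section Calc.
Variable R : realType.
Local Notation C := R[i].
Local Notation Re := (@complex.Re R).
Local Notation Im := (@complex.Im R).
Implicit Types (z w d : C) (x : R) (u v : nat -> C).

(** Convergence is taken on real and imaginary parts, because the contour
    integrals are defined through them. *)
Definition ccvg u z :=
  (Re (u n) @[n --> \oo] --> Re z) /\ (Im (u n) @[n --> \oo] --> Im z).

Lemma ccvg_cst z : ccvg (fun _ => z) z.
Proof. by split; exact: cvg_cst. Qed.

Lemma ccvg_ext u v z : u =1 v -> ccvg u z -> ccvg v z.
Proof. by move=> /funext ->. Qed.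

Lemma ccvgR (f : nat -> R) x : f n @[n --> \oo] --> x -> ccvg (fun n => (f n)%:C) x%:C.
Proof. by move=> h; split => //=; exact: cvg_cst. Qed.

Lemma ccvgD u v z w : ccvg u z -> ccvg v w -> ccvg (fun n => u n + v n) (z + w).
Proof.
move=> [a b] [c d]; split; rewrite ?ReD ?ImD.
- by under eq_fun do rewrite ReD; exact: cvgD.
- by under eq_fun do rewrite ImD; exact: cvgD.
Qed.

Lemma ccvgN u z : ccvg u z -> ccvg (fun n => - u n) (- z).
Proof.
move=> [a b]; split; rewrite ?ReN ?ImN.
- by under eq_fun do rewrite ReN; exact: cvgN.
- by under eq_fun do rewrite ImN; exact: cvgN.
Qed.

Lemma ccvgM u v z w : ccvg u z -> ccvg v w -> ccvg (fun n => u n * v n) (z * w).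
Proof.
move=> [a b] [c d]; split; rewrite ?ReM ?ImM.
- by under eq_fun do rewrite ReM; apply: cvgB; exact: cvgM.
- by under eq_fun do rewrite ImM; apply: cvgD; exact: cvgM.
Qed.

Lemma sqReIm_neq0 z : z != 0 -> Re z ^+ 2 + Im z ^+ 2 != 0.
Proof.
case: z => a b /=; rewrite eq_complex /=; apply: contra.
by rewrite paddr_eq0 ?sqr_ge0// !sqrf_eq0.
Qed.

Lemma ccvgV u z : z != 0 -> ccvg u z -> ccvg (fun n => (u n)^-1) z^-1.
Proof.
move=> /sqReIm_neq0 z0 [a b].
have h : (Re (u n) ^+ 2 + Im (u n) ^+ 2)^-1 @[n --> \oo] --> (Re z ^+ 2 + Im z ^+ 2)^-1.
  by apply: cvgV => //; rewrite !expr2; apply: cvgD; under eq_fun do rewrite expr2; exact: cvgM.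
split; rewrite ?ReV ?ImV.
- by under eq_fun do rewrite ReV; apply: cvgM.
- by under eq_fun do rewrite ImV; apply: cvgN; apply: cvgM.
Qed.

Lemma ccvg_cexp u z : ccvg u z -> ccvg (fun n => cexp (u n)) (cexp z).
Proof.
move=> [a b]; apply: ccvgM.
  apply: ccvgR; apply: continuous_cvg => //; exact: continuous_expR.
split => /=; apply: continuous_cvg => //.
- exact: continuous_cos.
- exact: continuous_sin.
Qed.

Lemma ccvg_normc u z : ccvg u z -> normc (u n) @[n --> \oo] --> normc z.
Proof.
move=> [a b].
have E w : normc w = Num.sqrt (Re w ^+ 2 + Im w ^+ 2) by case: w.
under eq_fun do rewrite E; rewrite E.
apply: continuous_cvg; first exact: sqrt_continuous.
by rewrite !expr2; apply: cvgD; under eq_fun do rewrite expr2; exact: cvgM.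
Qed.

Lemma ccvg0 u (b : nat -> R) : (forall n, normc (u n) <= b n) ->
  b n @[n --> \oo] --> 0 -> ccvg u 0.
Proof.
move=> h b0; have sq (f : nat -> R) : (forall n, `|f n| <= b n) -> f n @[n --> \oo] --> 0.
  move=> hf; apply: (@squeeze_cvgr _ _ _ _ (fun n => - b n) b) => //.
    by apply: nearW => n; rewrite -ler_norml.
  by rewrite -oppr0; exact: cvgN.
split; apply: sq => n; rewrite (le_trans _ (h n))//; [exact: abs_Re|exact: abs_Im].
Qed.

Lemma ccvg_unique u z w : ccvg u z -> ccvg u w -> z = w.
Proof.
move=> [a b] [c d]; apply: complexP.
- by apply: cvg_unique a c => //; exact: norm_hausdorff.
- by apply: cvg_unique b d => //; exact: norm_hausdorff.
Qed.

Lemma ccvg_shift u z k : ccvg u z -> ccvg (fun n => u (n + k)%N) z.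
Proof. by move=> [a b]; split; [rewrite (@cvg_shiftn k _ (fun n => Re (u n)))|rewrite
  (@cvg_shiftn k _ (fun n => Im (u n)))]. Qed.

Lemma ccvg_sum (I : Type) (r : seq I) (P : pred I) (u_ : I -> nat -> C) (z_ : I -> C) :
  (forall i, P i -> ccvg (u_ i) (z_ i)) ->
  ccvg (fun n => \sum_(i <- r | P i) u_ i n) (\sum_(i <- r | P i) z_ i).
Proof.
move=> h; elim: r => [|i r IH].
  by apply: ccvg_ext (ccvg_cst _) => n; rewrite !big_nil.
rewrite big_cons; case: (boolP (P i)) => Pi.
  by apply: ccvg_ext (ccvgD (h i Pi) IH) => n; rewrite big_cons Pi.
by apply: ccvg_ext IH => n; rewrite big_cons (negbTE Pi).
Qed.

Lemma ccvg_prod (I : Type) (r : seq I) (P : pred I) (u_ : I -> nat -> C) (z_ : I -> C) :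
  (forall i, P i -> ccvg (u_ i) (z_ i)) ->
  ccvg (fun n => \prod_(i <- r | P i) u_ i n) (\prod_(i <- r | P i) z_ i).
Proof.
move=> h; elim: r => [|i r IH].
  by apply: ccvg_ext (ccvg_cst _) => n; rewrite !big_nil.
rewrite big_cons; case: (boolP (P i)) => Pi.
  by apply: ccvg_ext (ccvgM (h i Pi) IH) => n; rewrite big_cons Pi.
by apply: ccvg_ext IH => n; rewrite big_cons (negbTE Pi).
Qed.

(** Pointwise forms of the rules of differentiation, which unify with explicit
    functions. *)
Lemma is_deriveD_fun (f g : R -> R) x (a b : R) : is_derive x 1 f a -> is_derive x 1 g b ->
  is_derive x 1 (fun y => f y + g y) (a + b).
Proof. by move=> ? ?; exact: (@is_deriveD _ _ _ f g). Qed.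

Lemma is_deriveB_fun (f g : R -> R) x (a b : R) : is_derive x 1 f a -> is_derive x 1 g b ->
  is_derive x 1 (fun y => f y - g y) (a - b).
Proof. by move=> ? ?; exact: (@is_deriveB _ _ _ f g). Qed.

Lemma is_deriveN_fun (f : R -> R) x (a : R) : is_derive x 1 f a ->
  is_derive x 1 (fun y => - f y) (- a).
Proof. by move=> ?; exact: (@is_deriveN _ _ _ f). Qed.

Lemma is_deriveM_fun (f g : R -> R) x (a b : R) : is_derive x 1 f a -> is_derive x 1 g b ->
  is_derive x 1 (fun y => f y * g y) (f x * b + g x * a).
Proof. by move=> ? ?; exact: (@is_deriveM _ _ f g). Qed.

Lemma is_deriveV_fun (f : R -> R) x (a : R) : f x != 0 -> is_derive x 1 f a ->
  is_derive x 1 (fun y => (f y)^-1) (- a / f x ^+ 2).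
Proof.
move=> ? ?; apply: is_derive_eq.
by rewrite /GRing.scale /= mulrC; ring.
Qed.

(** Derivative of a path in the complex plane, again on real and imaginary
    parts; all differentiations below are along such paths. *)
Definition cder (phi : R -> C) x d :=
  is_derive x 1 (fun y => Re (phi y)) (Re d) /\
  is_derive x 1 (fun y => Im (phi y)) (Im d).

Lemma cder_ccvg phi x d (y : nat -> R) : cder phi x d ->
  y n @[n --> \oo] --> x -> ccvg (fun n => phi (y n)) (phi x).
Proof.
move=> [a b] yx; split.
- apply: (@continuous_cvg _ _ _ _ _ y (fun t => Re (phi t)) x) => //.
  by apply/differentiable_continuous/derivable1_diffP; exact: ex_derive.
- apply: (@continuous_cvg _ _ _ _ _ y (fun t => Im (phi t)) x) => //.
  by apply/differentiable_continuous/derivable1_diffP; exact: ex_derive.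
Qed.

Lemma cder_eq phi x d d' : cder phi x d -> d = d' -> cder phi x d'.
Proof. by move=> ? <-. Qed.

Lemma cder_ext phi psi x d : phi =1 psi -> cder phi x d -> cder psi x d.
Proof. by move=> /funext ->. Qed.

Lemma cder_cst z x : cder (fun _ => z) x 0.
Proof. by split; exact: is_derive_cst. Qed.

Lemma cderR (f : R -> R) x (d : R) : is_derive x 1 f d -> cder (fun y => (f y)%:C) x d%:C.
Proof. by move=> h; split => //=; exact: is_derive_cst. Qed.

Lemma cderD phi psi x d d' : cder phi x d -> cder psi x d' ->
  cder (fun y => phi y + psi y) x (d + d').
Proof.
move=> [a b] [a' b']; split.
- by under eq_fun do rewrite ReD; rewrite ReD; exact: is_deriveD.
- by under eq_fun do rewrite ImD; rewrite ImD; exact: is_deriveD.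
Qed.

Lemma cderM phi psi x d d' : cder phi x d -> cder psi x d' ->
  cder (fun y => phi y * psi y) x (d * psi x + phi x * d').
Proof.
move=> [a b] [a' b']; split.
- under eq_fun do rewrite ReM; apply: (is_derive_eq (is_deriveB_fun (is_deriveM_fun a a')
  (is_deriveM_fun b b'))).
  by rewrite !(ReD, ReM) /GRing.scale /=; ring.
- under eq_fun do rewrite ImM; apply: (is_derive_eq (is_deriveD_fun (is_deriveM_fun a b')
  (is_deriveM_fun b a'))).
  by rewrite !(ImD, ImM) /GRing.scale /=; ring.
Qed.

Lemma cderV phi x d : phi x != 0 -> cder phi x d ->
  cder (fun y => (phi y)^-1) x (- d / phi x ^+ 2).
Proof.
move=> /[dup] p0 /sqReIm_neq0 n0 [a b].
have h : is_derive x 1 (fun y => (Re (phi y) ^+ 2 + Im (phi y) ^+ 2)^-1)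
  (- (2 * (Re (phi x) * Re d + Im (phi x) * Im d)) * (Re (phi x) ^+ 2 + Im (phi x) ^+ 2) ^- 2).
  under eq_fun do rewrite !expr2.
  apply: (is_derive_eq (is_deriveV_fun (f := fun y => Re (phi y) * Re (phi y) + Im
    (phi y) * Im (phi y)) _ (is_deriveD_fun (is_deriveM_fun a a) (is_deriveM_fun b b)))) => //.
  by congr (_ * _); ring.
have E : - d / phi x ^+ 2 = - (d * ((phi x)^-1 ^+ 2)) by rewrite exprVn mulNr.
rewrite E; split.
- under eq_fun do rewrite ReV; apply: (is_derive_eq (is_deriveM_fun a h)).
  by rewrite !(ReN, ReM, expr2, ReV, ImV, ImM) /GRing.scale /=; field; rewrite -?expr2.
- under eq_fun do rewrite ImV; apply: (is_derive_eq (is_deriveN_fun (is_deriveM_fun b h))).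
  by rewrite !(ImN, ReM, expr2, ReV, ImV, ImM) /GRing.scale /=; field; rewrite -?expr2.
Qed.

Lemma cder_cexp phi x d : cder phi x d ->
  cder (fun y => cexp (phi y)) x (cexp (phi x) * d).
Proof.
move=> [a b].
have e : is_derive x 1 (fun y => expR (Re (phi y))) (expR (Re (phi x)) * Re d).
  exact: (@is_derive1_comp _ expR (fun y => Re (phi y))).
have c : is_derive x 1 (fun y => cos (Im (phi y))) (- sin (Im (phi x)) * Im d).
  exact: (@is_derive1_comp _ (@cos R) (fun y => Im (phi y))).
have s : is_derive x 1 (fun y => sin (Im (phi y))) (cos (Im (phi x)) * Im d).
  exact: (@is_derive1_comp _ (@sin R) (fun y => Im (phi y))).
rewrite /cexp; split.
- under eq_fun do rewrite ReM /= mul0r subr0; apply: (is_derive_eq (is_deriveM_fun e c)).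
  by rewrite !(ReM, ImM) /GRing.scale /=; ring.
- under eq_fun do rewrite ImM /= mul0r addr0; apply: (is_derive_eq (is_deriveM_fun e s)).
  by rewrite !(ReM, ImM) /GRing.scale /=; ring.
Qed.
End Calc.

(** * Complex-valued integrals over real sets *)

Section Integ.
Variable R : realType.
Local Notation C := R[i].
Local Notation Re := (@complex.Re R).
Local Notation Im := (@complex.Im R).
Local Notation mu := (@lebesgue_measure R).
Local Notation mR := (measurableTypeR R).
Implicit Types (z w d : C) (x : R) (D : set mR) (f g : R -> C).

Definition cmeas D f :=
  measurable_fun D (fun x : mR => Re (f x)) /\ measurable_fun D (fun x : mR => Im (f x)).
Definition cintble D f :=
  mu.-integrable D (EFin \o (fun x => Re (f x))) /\
  mu.-integrable D (EFin \o (fun x => Im (f x))).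
Definition rintble D (h : R -> R) := mu.-integrable D (EFin \o h).

Lemma cint_ext D f g : (forall x, D x -> f x = g x) -> cintegral D f = cintegral D g.
Proof.
move=> h; rewrite /cintegral; congr (_ +i* _);
  by apply: eq_Rintegral => x; rewrite inE => /h ->.
Qed.

Lemma cmeas_ext D f g : (forall x, D x -> f x = g x) -> cmeas D f -> cmeas D g.
Proof.
move=> h [a b]; split; [move: a|move: b]; apply: eq_measurable_fun => x;
  by rewrite inE => /h ->.
Qed.

Lemma cintble_dom D f h : measurable D -> cmeas D f -> rintble D h ->
  (forall x, D x -> normc (f x) <= h x) -> cintble D f.
Proof.
move=> mD [a b] ih H; split; apply: le_integrable ih => //.
- exact/measurable_EFinP.
- move=> x Dx /=; rewrite lee_fin (le_trans (abs_Re _))// (le_trans (H x Dx))//; exact: ler_norm.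
- exact/measurable_EFinP.
- move=> x Dx /=; rewrite lee_fin (le_trans (abs_Im _))// (le_trans (H x Dx))//; exact: ler_norm.
Qed.

Lemma cintM D f z : measurable D -> cintble D f ->
  cintegral D (fun x => z * f x) = z * cintegral D f.
Proof.
move=> mD [a b]; have iz (h : R -> R) k : mu.-integrable D (EFin \o h) ->
    mu.-integrable D (EFin \o (fun x => k * h x)).
  by move=> ih; exact: (integrableZl mD k ih).
apply: complexP; rewrite ?ReM ?ImM /=.
- under eq_Rintegral do rewrite ReM.
  by rewrite RintegralB ?RintegralZl//; exact: iz.
- under eq_Rintegral do rewrite ImM.
  by rewrite RintegralD ?RintegralZl//; exact: iz.
Qed.

Lemma cintD D f g : measurable D -> cintble D f -> cintble D g ->
  cintegral D (fun x => f x + g x) = cintegral D f + cintegral D g.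
Proof.
move=> mD [a b] [a' b']; apply: complexP; rewrite ?ReD ?ImD /=.
- by under eq_Rintegral do rewrite ReD; rewrite RintegralD.
- by under eq_Rintegral do rewrite ImD; rewrite RintegralD.
Qed.

(** The factor 2 comes from estimating real and imaginary parts separately. *)
Lemma cint_norm D f h : measurable D -> cintble D f -> rintble D h ->
  (forall x, D x -> normc (f x) <= h x) ->
  normc (cintegral D f) <= 2 * \int[mu]_(x in D) h x.
Proof.
move=> mD [a b] ih H; rewrite (le_trans (normc_le _))//= mulr_natl mulr2n lerD//.
- apply: le_trans (le_normr_Rintegral mD a) _; apply: le_Rintegral => //.
    exact: integrable_norm a.
  by move=> x Dx; exact: le_trans (abs_Re _) (H x Dx).
- apply: le_trans (le_normr_Rintegral mD b) _; apply: le_Rintegral => //.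
    exact: integrable_norm b.
  by move=> x Dx; exact: le_trans (abs_Im _) (H x Dx).
Qed.

Lemma rint_dct D (u_ : nat -> R -> R) (u h : R -> R) : measurable D ->
  (forall n, measurable_fun D (u_ n : mR -> R)) -> measurable_fun D (u : mR -> R) ->
  rintble D h -> (forall n x, D x -> `|u_ n x| <= h x) ->
  (forall x, D x -> u_ n x @[n --> \oo] --> u x) ->
  \int[mu]_(x in D) u_ n x @[n --> \oo] --> \int[mu]_(x in D) u x.
Proof.
move=> mD mu_ mu0 ih H c.
have [] := @dominated_convergence _ _ _ mu D mD (fun n x => (u_ n x)%:E)
  (fun x => (u x)%:E) (fun x => (h x)%:E).
- by move=> n; exact/measurable_EFinP.
- exact/measurable_EFinP.
- by apply: aeW => x Dx; apply: cvg_EFin; [exact: nearW|exact: c].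
- exact: ih.
- by apply: aeW => x n Dx; rewrite lee_fin; exact: H.
move=> iu _ cu; apply: fine_cvg; rewrite /Rintegral fineK//.
exact: integrable_fin_num.
Qed.

Lemma cint_dct D (f_ : nat -> R -> C) f h : measurable D ->
  (forall n, cmeas D (f_ n)) -> cmeas D f ->
  rintble D h -> (forall n x, D x -> normc (f_ n x) <= h x) ->
  (forall x, D x -> ccvg (fun n => f_ n x) (f x)) ->
  ccvg (fun n => cintegral D (f_ n)) (cintegral D f).
Proof.
move=> mD mf_ [mf mf'] ih H c; split => /=.
- apply: (rint_dct mD _ mf ih); first by move=> n; have [] := mf_ n.
  + by move=> n x Dx; rewrite (le_trans (abs_Re _))// H.
  + by move=> x /c[].
- apply: (rint_dct mD _ mf' ih); first by move=> n; have [] := mf_ n.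
  + by move=> n x Dx; rewrite (le_trans (abs_Im _))// H.
  + by move=> x /c[].
Qed.

(** Continuity relative to a set, through sequences staying in the set: this is
    the form that dominated convergence delivers for parametric integrals. *)
Definition seq_cont (A : set R) f := forall (u : nat -> R) x, (forall n, A (u n)) -> A x ->
  u n @[n --> \oo] --> x -> ccvg (fun n => f (u n)) (f x).

(** Precomposing with a retraction onto an interval turns a function that is
    continuous relative to the interval into a continuous function on the line,
    whence measurability. *)
Definition retract (A : set R) (rho : R -> R) :=
  [/\ continuous rho, forall x, A (rho x) & forall x, A x -> rho x = x].

Lemma retract_itvcc (a b : R) : a <= b ->
  retract `[a, b] (fun x => Num.max a (Num.min b x)).
Proof.
move=> ab; split.
- move=> x; apply: (continuous_max (f := cst a)); first exact: cst_continuous.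
  by apply: continuous_min; [exact: cst_continuous|exact: cvg_id].
- by move=> x; rewrite /= in_itv /= le_max lexx /= ge_max ab ge_min lexx.
- by move=> x; rewrite /= in_itv /= => /andP[ax xb]; rewrite min_r// max_r.
Qed.

Lemma retract_itvcy (a : R) : retract `[a, +oo[ (Num.max a).
Proof.
split.
- move=> x; apply: continuous_max; [exact: cst_continuous|exact: cvg_id].
- by move=> x; rewrite /= in_itv /= le_max lexx.
- by move=> x; rewrite /= in_itv /= andbT => ax; rewrite max_r.
Qed.

Lemma seq_cont_retract A rho f : retract A rho -> seq_cont A f ->
  continuous (fun x => Re (f (rho x))) /\ continuous (fun x => Im (f (rho x))).
Proof.
move=> [cr Ar _] cf.
have K (u : nat -> R) x : u n @[n --> \oo] --> x -> ccvg (fun n => f (rho (u n))) (f (rho x)).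
  move=> ux; apply: (cf (rho \o u)) => //; first by move=> n; exact: Ar.
  by apply: continuous_cvg => //; exact: cr.
by split=> x; apply/(@cvg_nbhsP _ R^o) => u /K[].
Qed.

Lemma seq_cont_meas (A : set mR) rho f : measurable A -> retract A rho -> seq_cont A f -> cmeas
  A f.
Proof.
move=> mA rA cf; have [a b] := seq_cont_retract rA cf.
have [_ _ e] := rA.
apply: (@cmeas_ext _ (f \o rho)) => [x Ax|]; first by rewrite /= e.
by split; apply: (measurable_funS measurableT) => //; exact: continuous_measurable_fun.
Qed.

Lemma seq_cont_within (a b : R) f : a <= b -> seq_cont `[a, b] f ->
  {within `[a, b], continuous (fun x => Re (f x))} /\
  {within `[a, b], continuous (fun x => Im (f x))}.
Proof.
move=> ab cf; have r := retract_itvcc ab; have [_ _ e] := r.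
have [h1 h2] := seq_cont_retract r cf.
have {}h1 := continuous_subspaceT (A := `[a, b]) h1.
have {}h2 := continuous_subspaceT (A := `[a, b]) h2.
split; [apply: subspace_eq_continuous h1|apply: subspace_eq_continuous h2] => x;
  rewrite inE => xA.
  by rewrite /from_subspace e.
by rewrite /from_subspace e.
Qed.

Lemma scontW (A B : set R) f : B `<=` A -> seq_cont A f -> seq_cont B f.
Proof. by move=> BA h u x uB xB; apply: h => //; [move=> n; exact: BA|exact: BA]. Qed.

Lemma seq_cont_intble (a b : R) f : a <= b -> seq_cont `[a, b] f -> cintble `[a, b] f.
Proof.
move=> ab cf; have [h1 h2] := seq_cont_within ab cf.
by split; apply: continuous_compact_integrable => //; exact: segment_compact.
Qed.

Lemma cst_rintble (a b k : R) : rintble `[a, b] (cst k).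
Proof.
apply: continuous_compact_integrable; first exact: segment_compact.
by apply: continuous_subspaceT => x; exact: cvg_cst.
Qed.

Lemma cder_seq_cont A f f' : (forall x, A x -> cder f x (f' x)) -> seq_cont A f.
Proof. by move=> h u x uA xA ux; apply: cder_ccvg (h x xA) ux. Qed.

Lemma cint_bound (a b k : R) f : a <= b -> seq_cont `[a, b] f ->
  (forall x, a <= x <= b -> normc (f x) <= k) ->
  normc (cintegral `[a, b] f) <= 2 * (k * (b - a)).
Proof.
move=> ab cf h.
have := @cint_norm `[a, b] f (cst k) (measurable_itv _) (seq_cont_intble ab cf)
  (cst_rintble a b k).
have H x : `[a, b] x -> normc (f x) <= cst k x by rewrite /= in_itv; exact: h.
move=> /(_ H); rewrite Rintegral_cst//= lebesgue_measure_itv /= lte_fin.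
by move: ab; rewrite le_eqVlt => /predU1P[->|ab]; rewrite ?ltxx ?ab /= ?subrr.
Qed.

Lemma cint_dct_itv (a b k : R) (f_ : nat -> R -> C) f : a <= b ->
  (forall n, seq_cont `[a, b] (f_ n)) -> seq_cont `[a, b] f ->
  (forall n x, a <= x <= b -> normc (f_ n x) <= k) ->
  (forall x, a <= x <= b -> ccvg (fun n => f_ n x) (f x)) ->
  ccvg (fun n => cintegral `[a, b] (f_ n)) (cintegral `[a, b] f).
Proof.
move=> ab cf_ cf h c; apply: (@cint_dct _ _ _ (cst k)) => //.
- by move=> n; apply: seq_cont_meas => //; exact: retract_itvcc.
- by apply: seq_cont_meas => //; exact: retract_itvcc.
- exact: cst_rintble.
Qed.

Lemma rint_FTC (a b : R) (F f : R -> R) : a < b ->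
  (forall x, a <= x <= b -> is_derive x 1 F (f x)) ->
  {within `[a, b], continuous f} ->
  \int[mu]_(x in `[a, b]) f x = F b - F a.
Proof.
move=> ab dF cf; rewrite /Rintegral (@continuous_FTC2 _ _ F)//.
- have K x : a <= x <= b -> {for x, continuous F}.
    move=> /dF h; apply/differentiable_continuous/derivable1_diffP; exact: ex_derive.
  split.
  + by move=> x; rewrite in_itv /= => /andP[/ltW ax /ltW xb]; apply: ex_derive; apply: dF;
    rewrite ax.
  + by apply: cvg_at_right_filter; apply: K; rewrite lexx ltW.
  + by apply: cvg_at_left_filter; apply: K; rewrite lexx ltW.
- move=> x; rewrite in_itv /= => /andP[/ltW ax /ltW xb]; rewrite derive1E.
  have h : is_derive x 1 F (f x) by apply: dF; rewrite ax.
  exact: derive_val.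
Qed.

Lemma cint_FTC (a b : R) f f' : a < b ->
  (forall x, a <= x <= b -> cder f x (f' x)) -> seq_cont `[a, b] f' ->
  cintegral `[a, b] f' = f b - f a.
Proof.
move=> ab df cf; have [h1 h2] := seq_cont_within (ltW ab) cf.
apply: complexP; rewrite ?ReD ?ImD ?ReN ?ImN /=.
- by apply: (@rint_FTC _ _ (fun x => Re (f x))) => // x /df[].
- by apply: (@rint_FTC _ _ (fun x => Im (f x))) => // x /df[].
Qed.

(** The integrals over the segments from a to a + n + 1 converge to the improper
    one by dominated convergence, and to - f a by the fundamental theorem. *)
Lemma cint_FTCy (a : R) f f' h :
  (forall x, a <= x -> cder f x (f' x)) -> seq_cont `[a, +oo[ f' ->
  rintble `[a, +oo[ h -> (forall x, a <= x -> normc (f' x) <= h x) ->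
  ccvg (fun n => f (a + n.+1%:R)) 0 ->
  cintegral `[a, +oo[ f' = - f a.
Proof.
move=> df cf ih H f0.
have cfn n : cintegral `[a, a + n.+1%:R] f' = f (a + n.+1%:R) - f a.
  apply: cint_FTC; first by rewrite ltrDl.
    by move=> x /andP[ax _]; exact: df.
  by apply: scontW cf => x /=; rewrite !in_itv /= => /andP[-> _].
have cl : ccvg (fun n => cintegral `[a, a + n.+1%:R] f') (- f a).
  rewrite -[X in ccvg _ X]add0r.
  by apply: ccvg_ext (ccvgD f0 (ccvg_cst _)) => n; rewrite cfn.
apply: ccvg_unique cl.
(* Integrals over segments are rewritten over the half-line with an indicator. *)
pose P n := [set x : R | x <= a + n.+1%:R].
have mP n : measurable (P n : set mR).
  have -> : P n = `]-oo, a + n.+1%:R] by apply/seteqP; split => x /=; rewrite in_itv.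
  exact: measurable_itv.
have DP n : `[a, a + n.+1%:R] = `[a, +oo[ `&` P n :> set R.
  by apply/seteqP; split => x /=; rewrite !in_itv /= andbT; [move=> /andP[]|case=> -> ->].
have [m1 m2] := seq_cont_meas (measurable_itv _) (retract_itvcy a) cf.
pose g n := fun x => (Re (f' x) * \1_(P n) x) +i* (Im (f' x) * \1_(P n) x).
have gE n : cintegral `[a, a + n.+1%:R] f' = cintegral `[a, +oo[ (g n).
  rewrite /cintegral DP !Rintegral_mkcondr /=; congr (_ +i* _); apply: eq_Rintegral => x _ /=;
  by rewrite patchE indicE; case: ifP; rewrite ?mulr1 ?mulr0.
have gn n x : normc (g n x) <= normc (f' x).
  have -> : g n x = f' x * (\1_(P n) x)%:C by apply: complexP; rewrite ?ReM ?ImM /=; ring.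
  rewrite normcM normcR ler_piMr ?normc_ge0//.
  by rewrite indicE; case: (_ \in _); rewrite ?normr1 ?normr0.
apply: (@ccvg_ext _ (fun n => cintegral `[a, +oo[ (g n))); first by move=> n; rewrite gE.
apply: (@cint_dct _ _ _ h) => //.
- by move=> n; split; apply: measurable_funM => //; exact: measurable_indic.
- by move=> n x; rewrite /= in_itv /= andbT => ax; exact: le_trans (gn n x) (H x ax).
- move=> x; rewrite /= in_itv /= andbT => ax.
  have [N xN] : exists N, forall n, (N <= n)%N -> x <= a + n.+1%:R.
    exists (Num.truncn `|x - a|) => n Nn; rewrite -lerBlDl.
    rewrite (le_trans (ler_norm _))// (le_trans (ltW (truncnS_gt _)))// ler_nat.
    by rewrite ltnS.
  have E n : (N <= n)%N -> g n x = f' x.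
    move=> Nn; rewrite /g; have -> : \1_(P n) x = 1 :> R.
      by rewrite indicE mem_set//; exact: xN.
    by rewrite !mulr1; case: (f' x).
  split; apply: cvg_near_cst; exists N => // n Nn.
    exact: (congr1 Re (E n Nn)).
  exact: (congr1 Im (E n Nn)).
Qed.

Lemma cder_under_int (al be u v M x0 : R) (k k' : R -> R -> C) : al <= be ->
  u < x0 < v ->
  (forall x, u < x < v -> seq_cont `[al, be] (k x)) ->
  (forall x a, u < x < v -> al <= a <= be -> cder (k^~ a) x (k' x a)) ->
  (forall x a, u < x < v -> al <= a <= be -> normc (k' x a) <= M) ->
  cder (fun x => cintegral `[al, be] (k x)) x0 (cintegral `[al, be] (k' x0)).
Proof.
move=> ab x0uv ck dk bk.
have M0 : 0 <= M.
  by apply: le_trans (bk x0 al x0uv _); rewrite ?normc_ge0 ?lexx ?ab.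
have mD : measurable (`[al, be] : set mR) by exact: measurable_itv.
have K (q q' : R -> R -> R) :
  (forall x, u < x < v -> mu.-integrable `[al, be] (EFin \o q x)) ->
  (forall x a, u < x < v -> al <= a <= be -> is_derive x 1 (q^~ a) (q' x a)) ->
  (forall x a, u < x < v -> al <= a <= be -> `|q' x a| <= M) ->
  is_derive x0 1 (fun x => \int[mu]_(a in `[al, be]) q x a) (\int[mu]_(a in `[al, be]) q' x0 a).
  move=> iq dq bq.
  have I0 : `]u, v[ x0 by rewrite /= in_itv.
  have H1 x : `]u, v[ x -> mu.-integrable `[al, be] (EFin \o q x).
    by rewrite /= in_itv; exact: iq.
  have H2 x y : `]u, v[ x -> `[al, be] y -> derivable (q^~ y) x 1.
    by rewrite /= !in_itv /= => xx yy; have h := dq x y xx yy; exact: ex_derive.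
  have E x y : `]u, v[ x -> `[al, be] y -> partial1of2 q x y = q' x y.
    rewrite /= !in_itv /= => xx yy; have h := dq x y xx yy.
    by rewrite partial1of2E; exact: derive_val.
  have H3 x y : `]u, v[ x -> `[al, be] y -> `|partial1of2 q x y| <= cst M y.
    by move=> xx yy; rewrite E// bq//; move: xx yy; rewrite /= !in_itv.
  have d1 := @derivable_under_integral R _ _ mu q `[al, be] mD x0 u v I0 H1 H2 (cst M)
    (fun _ => M0) (cst_rintble al be M) H3.
  have d2 := @differentiation_under_integral R _ _ mu q `[al, be] mD x0 u v I0 H1 H2 (cst M)
    (fun _ => M0) (cst_rintble al be M) H3.
  split => //; rewrite -derive1E d2; apply: eq_Rintegral => y.
  by rewrite inE => yy; rewrite -E.
split => /=.
- apply: (K (fun x a => Re (k x a)) (fun x a => Re (k' x a))).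
  + by move=> x xx; have [] := seq_cont_intble ab (ck x xx).
  + by move=> x a xx aa; have [] := dk x a xx aa.
  + by move=> x a xx aa; apply: le_trans (bk x a xx aa); exact: abs_Re.
- apply: (K (fun x a => Im (k x a)) (fun x a => Im (k' x a))).
  + by move=> x xx; have [] := seq_cont_intble ab (ck x xx).
  + by move=> x a xx aa; have [] := dk x a xx aa.
  + by move=> x a xx aa; apply: le_trans (bk x a xx aa); exact: abs_Im.
Qed.
End Integ.

(** * The Hankel integral as a continuous linear functional *)

Section Hankel.
Variable R : realType.
Local Notation C := R[i].
Local Notation Re := (@complex.Re R).
Local Notation Im := (@complex.Im R).
Local Notation mu := (@lebesgue_measure R).
Local Notation mR := (measurableTypeR R).
Variable e : R.
Hypothesis e0 : 0 < e.
Implicit Types (z w : C) (x : R) (f g : C -> C).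

(** Conditions satisfied by w = log t on the Hankel contour of radius e: t stays
    within e of the real axis, its real part exceeds its modulus minus 2 e, and
    the argument is between 0 and 2 pi. The estimates start
    from these inequalities. *)
Definition contour w := [/\ `|Im (cexp w)| <= e, expR (Re w) - 2 * e <= Re (cexp w),
  0 <= Im w <= 2 * pi & ln e <= Re w].

(** exp (- |t| / 8) for t = exp w. *)
Definition weight w := expR (- (expR (Re w) / 8)).

Lemma weight_ge0 w : 0 <= weight w. Proof. exact: expR_ge0. Qed.

Lemma weight_le1 w : weight w <= 1.
Proof. by rewrite /weight -expR0 ler_expR oppr_le0 divr_ge0// expR_ge0. Qed.

(** Continuous functions on the contour dominated by the weight. The bound M is
    part of the predicate because limits are taken with uniform bounds. *)
Definition adm1 (M : R) f :=
  (forall w, contour w -> normc (f w) <= M * weight w) /\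
  (forall (u : nat -> C) w, (forall n, contour (u n)) -> contour w -> ccvg u w ->
    ccvg (fun n => f (u n)) (f w)).

Lemma adm1_lin M M' f g a : adm1 M f -> adm1 M' g ->
  adm1 (normc a * M + M') (fun w => a * f w + g w).
Proof.
move=> [bf cf] [bg cg]; split.
- move=> w cw; apply: le_trans (ler_normcD _ _) _; rewrite normcM mulrDl lerD ?bg//.
  by rewrite -mulrA ler_wpM2l ?normc_ge0 ?bf.
- move=> u w hu hw uw; apply: ccvgD; last exact: cg.
  by apply: ccvgM; [exact: ccvg_cst|exact: cf].
Qed.

(** A piece of the contour is a parametrisation W of log t by a real set D,
    together with the factor m relating dt to dx; theta is an integrable majorant
    of the weight on it. *)
Section Piece.
Variables (D : set mR) (rho : R -> R) (W m : R -> C) (theta : R -> R).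
Hypotheses (mD : measurable D) (rD : retract D rho) (cW : seq_cont D W) (cm : seq_cont D m)
  (WD : forall x, D x -> contour (W x)) (it : rintble D theta)
  (bt : forall x, D x -> normc (m x) * weight (W x) <= theta x).
Let J f := cintegral D (fun x => f (W x) * m x).

Lemma piece_seq_cont M f : adm1 M f -> seq_cont D (fun x => f (W x) * m x).
Proof.
move=> [_ cf] u x uD xD ux; apply: ccvgM; last exact: cm.
by apply: cf; [move=> n; exact: WD|exact: WD|exact: cW].
Qed.

Lemma piece_norm M f x : 0 <= M -> adm1 M f -> D x -> normc (f (W x) * m x) <= M * theta x.
Proof.
move=> M0 [bf _] Dx; rewrite normcM; apply: (@le_trans _ _ (M * weight (W x) * normc (m x))).
  by rewrite ler_wpM2r ?normc_ge0// bf//; exact: WD.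
by rewrite -mulrA ler_wpM2l// mulrC bt.
Qed.

Lemma piece_it M : rintble D (fun x => M * theta x).
Proof. exact: (integrableZl mD M it). Qed.

Lemma piece_intble M f : 0 <= M -> adm1 M f -> cintble D (fun x => f (W x) * m x).
Proof.
move=> M0 af; apply: (cintble_dom mD _ (piece_it M)).
  exact: (seq_cont_meas mD rD (piece_seq_cont af)).
by move=> x; exact: piece_norm.
Qed.

Lemma piece_bound M f : 0 <= M -> adm1 M f ->
  normc (J f) <= M * (2 * \int[mu]_(x in D) theta x).
Proof.
move=> M0 af; have := cint_norm mD (piece_intble M0 af) (piece_it M).
rewrite RintegralZl// mulrCA; apply => x; exact: piece_norm.
Qed.

Lemma piece_cvg M (f_ : nat -> C -> C) f : 0 <= M -> (forall n, adm1 M (f_ n)) -> adm1 M f ->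
  (forall w, contour w -> ccvg (fun n => f_ n w) (f w)) ->
  ccvg (fun n => J (f_ n)) (J f).
Proof.
move=> M0 af_ af c; apply: (cint_dct mD _ _ (piece_it M)).
- by move=> n; exact: (seq_cont_meas mD rD (piece_seq_cont (af_ n))).
- exact: (seq_cont_meas mD rD (piece_seq_cont af)).
- by move=> n x Dx; exact: piece_norm.
- by move=> x Dx; apply: ccvgM; [apply: c; exact: WD|exact: ccvg_cst].
Qed.

Lemma piece_lin M M' f g a : 0 <= M -> 0 <= M' -> adm1 M f -> adm1 M' g ->
  J (fun w => a * f w + g w) = a * J f + J g.
Proof.
move=> M0 M0' af ag; rewrite /J -cintM//; last exact: piece_intble af.
rewrite -cintD//; last 2 first.
- have : cintble D (fun x => a * (fun w => f w) (W x) * m x).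
    apply: (@piece_intble (normc a * M + 0) (fun w => a * f w)).
      by rewrite addr0 mulr_ge0 ?normc_ge0.
    have z : adm1 0 (fun=> 0).
      by split; [move=> w _; rewrite (@normc0 R) mul0r|move=> *; exact: ccvg_cst].
    have := adm1_lin a af z; congr adm1; apply/funext => w; by rewrite addr0.
  by congr (cintble D _); apply/funext => x; rewrite mulrA.
- exact: piece_intble ag.
by apply: cint_ext => x _; ring.
Qed.
End Piece.

Lemma exp_rintble : rintble `[e, +oo[ (fun x => expR (- (x / 8))).
Proof.
have dE (x : R) : is_derive x 1 (fun x => - 8 * expR (- (x / 8))) (expR (- (x / 8))).
  have d0 : is_derive x 1 (fun x : R => x / 8) (1 / 8).
    have := is_deriveM_fun (f := fun y : R => y) (g := fun=> 8^-1) (is_derive_id x 1)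
      (is_derive_cst (8^-1 : R) x 1).
    by move=> h; apply: (is_derive_eq h); ring.
  have d1 := is_deriveN_fun d0.
  have d2 : is_derive x 1 (fun x => expR (- (x / 8))) (expR (- (x / 8)) * - (1 / 8)).
    exact: (@is_derive1_comp _ expR (fun x => - (x / 8))).
  by apply: (is_derive_eq (is_deriveM_fun (f := fun=> - 8) (is_derive_cst (- 8 : R) x 1) d2));
    rewrite /=; field.
have cE : continuous (fun x : R => expR (- (x / 8))).
  move=> x; apply: continuous_comp; last exact: continuous_expR.
  by apply: cvgN; apply: cvgM; [exact: cvg_id|exact: cvg_cst].
apply/integrableP; split.
  apply/measurable_EFinP; apply: (measurable_funS measurableT) => //.
  exact: continuous_measurable_fun.
under eq_integral do rewrite /= ger0_norm ?expR_ge0//.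
rewrite (@ge0_continuous_FTC2y _ _ (fun x => - 8 * expR (- (x / 8))) e 0).
- by rewrite -EFinB ltry.
- by move=> x _; exact: expR_ge0.
- exact: continuous_subspaceT.
- rewrite -(mulr0 (- 8)); apply: cvgM; first exact: cvg_cst.
  have : expR (- y) @[y --> +oo] --> (0 : R) by exact: cvgr_expR.
  move=> h; apply: (cvg_comp _ _ _ h).
  apply/cvgryPge => A; have := @nbhs_pinfty_ge R (A * 8) (num_real _).
  by apply: filterS => x; rewrite ler_pdivlMr.
- by move=> x _; have := dE x => d; exact: ex_derive.
- have K : {for e, continuous (fun x : R => - 8 * expR (- (x / 8)))}.
    apply/differentiable_continuous/derivable1_diffP.
    by have := dE e => d; exact: ex_derive.
  by apply: cvg_at_right_filter; apply: K.
- by move=> x _; rewrite derive1E; have := dE x => d; exact: derive_val.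
Qed.
End Hankel.

Section HankelPath.
Variable R : realType.
Local Notation C := R[i].
Local Notation Re := (@complex.Re R).
Local Notation Im := (@complex.Im R).
Local Notation mu := (@lebesgue_measure R).
Local Notation mR := (measurableTypeR R).
Variable e : R.
Hypothesis e0 : 0 < e.
Implicit Types (z w : C) (x : R) (f g : C -> C).
Local Notation contour := (contour e).
Local Notation adm1 := (adm1 e).

Lemma cexp_ln2pi x : 0 < x -> cexp (ln x +i* (2 * pi)) = x%:C.
Proof.
move=> x0; have -> : ln x +i* (2 * pi) = (ln x)%:C + (0 +i* (2 * pi)).
  by apply: complexP; rewrite ?ReD ?ImD /= ?addr0 ?add0r.
by rewrite cexpD cexp_2pii mulr1 cexp_ln.
Qed.

Lemma pi2_ge0 : 0 <= 2 * pi :> R. Proof. by rewrite mulr_ge0// pi_ge0. Qed.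

Lemma pi2_gt0 : 0 < 2 * pi :> R. Proof. by rewrite mulr_gt0// pi_gt0. Qed.

Lemma contour_top x : e <= x -> contour (ln x)%:C.
Proof.
move=> ex; have x0 : 0 < x by exact: lt_le_trans ex.
split; rewrite ?cexp_ln//= ?lnK ?posrE ?lexx ?pi2_ge0 ?ler_ln ?posrE//;
  first by rewrite normr0 ltW.
by rewrite gerBl mulr_ge0// ltW.
Qed.

Lemma contour_bot x : e <= x -> contour (ln x +i* (2 * pi)).
Proof.
move=> ex; have x0 : 0 < x by exact: lt_le_trans ex.
split; rewrite ?cexp_ln2pi//= ?lnK ?posrE ?lexx ?pi2_ge0 ?ler_ln ?posrE//;
  first by rewrite normr0 ltW.
by rewrite gerBl mulr_ge0// ltW.
Qed.

Lemma contour_circ x : 0 <= x <= 2 * pi -> contour (ln e +i* x).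
Proof.
move=> hx; split => //=; rewrite /cexp ?ReM ?ImM /= lnK ?posrE//.
- by rewrite mul0r addr0 normrM gtr0_norm// ler_piMr ?sin_max// ltW.
- rewrite mul0r subr0; have : 0 <= e * (1 + cos x).
    by rewrite mulr_ge0 ?(ltW e0)// -lerBlDl sub0r cos_geN1.
  lra.
Qed.

Definition Jtop f := cintegral `[e, +oo[ (fun x => f (ln x)%:C * 1).
Definition Jcirc f := cintegral `[0, 2 * pi]
   (fun x => f (ln e +i* x) * ((0 +i* 1) * cexp (ln e +i* x))).
Definition Jbot f := cintegral `[e, +oo[ (fun x => f (ln x +i* (2 * pi)) * 1).

Lemma hankelE f : hankel e f = - Jtop f + Jcirc f + Jbot f.
Proof.
rewrite /hankel; congr (- _ + _ + _); apply: cint_ext => x _; by rewrite ?mulr1 ?mulrA.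
Qed.

Lemma seq_cont_ln (y : R) : seq_cont `[e, +oo[ (fun x => ln x +i* y).
Proof.
move=> u x _; rewrite /= in_itv /= andbT => ex ux; split => /=; last exact: cvg_cst.
by apply: continuous_cvg => //; apply: continuous_ln; exact: lt_le_trans ex.
Qed.

Lemma seq_cont_circ (D : set R) : seq_cont D (fun x => ln e +i* x).
Proof. by move=> u x _ _ ux; split => //=; exact: cvg_cst. Qed.

Lemma seq_cont_cst (D : set R) z : seq_cont D (fun=> z).
Proof. by move=> *; exact: ccvg_cst. Qed.

Lemma seq_cont_mcirc (D : set R) : seq_cont D (fun x => (0 +i* 1) * cexp (ln e +i* x)).
Proof.
move=> u x uD xD ux; apply: ccvgM; first exact: ccvg_cst.
by apply: ccvg_cexp; exact: (seq_cont_circ uD xD ux).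
Qed.

Lemma contour_topP x : `[e, +oo[ x -> contour (ln x)%:C.
Proof. by rewrite /= in_itv /= andbT; exact: contour_top. Qed.

Lemma contour_circP x : `[0, 2 * pi] x -> contour (ln e +i* x).
Proof. by rewrite /= in_itv /=; exact: contour_circ. Qed.

Lemma contour_botP x : `[e, +oo[ x -> contour (ln x +i* (2 * pi)).
Proof. by rewrite /= in_itv /= andbT; exact: contour_bot. Qed.

Lemma weight_axis_le y x : `[e, +oo[ x -> normc (1 : C) * weight (ln x +i* y) <= expR (- (x / 8)).
Proof.
rewrite normc_1 /= in_itv /= andbT => ex; rewrite mul1r /weight /= lnK//.
by rewrite posrE; exact: lt_le_trans ex.
Qed.

Lemma normc_mcirc x : normc ((0 +i* 1) * cexp (ln e +i* x)) = e.
Proof. by rewrite normcM normc_cexp normci /= normr1 mul1r lnK ?posrE. Qed.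

Lemma weight_circ_le x : `[0, 2 * pi] x ->
  normc ((0 +i* 1) * cexp (ln e +i* x)) * weight (ln e +i* x) <= cst e x.
Proof. by move=> _; rewrite normc_mcirc ler_piMr ?weight_le1// ltW. Qed.

Let mD1 : measurable (`[e, +oo[ : set mR). Proof. exact: measurable_itv. Qed.
Let mD2 : measurable (`[0, 2 * pi] : set mR). Proof. exact: measurable_itv. Qed.
Let i1 := exp_rintble e.
Let i2 := cst_rintble 0 (2 * pi) e.
Let r1 := retract_itvcy e.
Let r2 := retract_itvcc pi2_ge0.

Definition hankel_mass : R := 2 * (2 * \int[mu]_(x in `[e, +oo[) expR (- (x / 8)))
  + 2 * \int[mu]_(x in `[0, 2 * pi]) cst e x.
Lemma hankel_mass_ge0 : 0 <= hankel_mass.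
Proof.
by rewrite addr_ge0 ?mulr_ge0//; apply: Rintegral_ge0 => x _; rewrite ?expR_ge0//= ltW.
Qed.

Lemma hankel_bound M f : 0 <= M -> adm1 M f -> normc (hankel e f) <= M * hankel_mass.
Proof.
move=> M0 af; rewrite hankelE; apply: le_trans (ler_normcD _ _) _.
apply: le_trans (lerD (ler_normcD _ _) (lexx _)) _; rewrite normcN.
have b1 := piece_bound mD1 r1 (seq_cont_ln 0) (seq_cont_cst 1) contour_topP i1
  (@weight_axis_le 0) M0 af.
have b2 := piece_bound mD2 r2 (@seq_cont_circ _)
  (@seq_cont_mcirc _) contour_circP i2 weight_circ_le M0 af.
have b3 := piece_bound mD1 r1 (seq_cont_ln (2 * pi)) (seq_cont_cst 1) contour_botP i1
  (@weight_axis_le (2 * pi)) M0 af.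
apply: le_trans (lerD (lerD b1 b2) b3) _.
by rewrite /hankel_mass le_eqVlt; apply/orP; left; apply/eqP; ring.
Qed.

Lemma hankel_cvg M (f_ : nat -> C -> C) f : 0 <= M -> (forall n, adm1 M (f_ n)) -> adm1 M f ->
  (forall w, contour w -> ccvg (fun n => f_ n w) (f w)) ->
  ccvg (fun n => hankel e (f_ n)) (hankel e f).
Proof.
move=> M0 af_ af c; rewrite hankelE.
apply: (@ccvg_ext _ (fun n => - Jtop (f_ n) + Jcirc (f_ n) + Jbot (f_ n))).
  by move=> n; rewrite hankelE.
apply: ccvgD; [apply: ccvgD; [apply: ccvgN|]|].
- exact: (piece_cvg mD1 r1 (seq_cont_ln 0) (seq_cont_cst 1) contour_topP i1
  (@weight_axis_le 0) M0 af_ af c).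
- exact: (piece_cvg mD2 r2 (@seq_cont_circ _)
  (@seq_cont_mcirc _) contour_circP i2 weight_circ_le M0 af_ af c).
- exact: (piece_cvg mD1 r1 (seq_cont_ln (2 * pi)) (seq_cont_cst 1) contour_botP i1
  (@weight_axis_le (2 * pi)) M0 af_ af c).
Qed.

Lemma hankel_lin M M' f g a : 0 <= M -> 0 <= M' -> adm1 M f -> adm1 M' g ->
  hankel e (fun w => a * f w + g w) = a * hankel e f + hankel e g.
Proof.
move=> M0 M0' af ag; rewrite !hankelE.
rewrite /Jtop (piece_lin mD1 r1 (seq_cont_ln 0) (seq_cont_cst 1) contour_topP i1
  (@weight_axis_le 0) a M0 M0' af ag).
rewrite /Jcirc (piece_lin mD2 r2 (@seq_cont_circ _)
  (@seq_cont_mcirc _) contour_circP i2 weight_circ_le a M0 M0' af ag).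
rewrite /Jbot (piece_lin mD1 r1 (seq_cont_ln (2 * pi)) (seq_cont_cst 1) contour_botP i1
  (@weight_axis_le (2 * pi)) a M0 M0' af ag).
ring.
Qed.

Lemma hankel_ext f g : (forall w, contour w -> f w = g w) -> hankel e f = hankel e g.
Proof.
move=> fg; rewrite !hankelE; congr (- _ + _ + _); apply: cint_ext => x Dx; rewrite fg//.
- exact: contour_topP.
- exact: contour_circP.
- exact: contour_botP.
Qed.

(** The integral of a derivative with respect to t vanishes: the primitive A
    tends to 0 at both ends, and the boundary terms at the two junctions of the
    axis with the circle cancel. *)
Lemma hankel_exact M (A A' : C -> C) : 0 <= M -> adm1 M A' ->
  (forall w, contour w -> normc (A w) <= M * weight w) ->
  (forall x y, e <= x -> (y = 0 \/ y = 2 * pi) ->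
     cder (fun x => A (ln x +i* y)) x (A' (ln x +i* y))) ->
  (forall x, 0 <= x <= 2 * pi -> cder (fun x => A (ln e +i* x)) x
     (A' (ln e +i* x) * ((0 +i* 1) * cexp (ln e +i* x)))) ->
  hankel e A' = 0.
Proof.
move=> M0 aA bA d1 d2; rewrite hankelE.
have lim0 (y : R) : (y = 0 \/ y = 2 * pi) -> ccvg (fun n => A (ln (e + n.+1%:R) +i* y)) 0.
  move=> hy; apply: (@ccvg0 _ _ (fun n => M * expR (- ((e + n.+1%:R) / 8)))).
    move=> n; have en : e <= e + n.+1%:R by rewrite lerDl.
    have cy : contour (ln (e + n.+1%:R) +i* y) by case: hy => ->;
      [exact: contour_top|exact: contour_bot].
    apply: le_trans (bA _ cy) _; rewrite /weight /= lnK// posrE; exact: lt_le_trans en.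
  rewrite -(mulr0 M); apply: cvgM; first exact: cvg_cst.
  apply: (@cvg_comp _ _ _ (fun n : nat => (e + n.+1%:R) / 8 : R) (fun y => expR
    (- y)) _ +oo _ _ (@cvgr_expR R)).
  apply/cvgryPge => a; exists (Num.truncn `|a * 8|) => // n /= hn.
  rewrite ler_pdivlMr// (le_trans (ler_norm _))// (le_trans (ltW (truncnS_gt _)))//.
  by rewrite (@le_trans _ _ n.+1%:R) ?ler_nat ?ltnS// lerDr ltW.
have J1 y : (y = 0 \/ y = 2 * pi) ->
   cintegral `[e, +oo[ (fun x => A' (ln x +i* y) * 1) = - A (ln e +i* y).
  move=> hy; have WD x : `[e, +oo[ x -> contour (ln x +i* y) by case: hy => ->;
    [exact: contour_topP|exact: contour_botP].
  apply: (@cint_FTCy _ _ (fun x => A (ln x +i* y)) _ (fun x => M * expR (- (x / 8)))).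
  - by move=> x ex; rewrite mulr1; exact: d1.
  - exact: (piece_seq_cont (seq_cont_ln y) (seq_cont_cst 1) WD aA).
  - exact: (piece_it mD1 i1 M).
  - move=> x ex; apply: (piece_norm (theta := fun x => expR (- (x / 8))) WD
    (@weight_axis_le y) M0 aA).
    by rewrite /= in_itv /= andbT.
  - exact: lim0.
have J2 : Jcirc A' = A (ln e +i* (2 * pi)) - A (ln e +i* 0).
  apply: (@cint_FTC _ _ _ (fun x => A (ln e +i* x))); first exact: pi2_gt0.
    exact: d2.
  exact: (piece_seq_cont (@seq_cont_circ _) (@seq_cont_mcirc _) contour_circP aA).
rewrite J2 /Jtop (J1 0 (or_introl erefl)) /Jbot (J1 _ (or_intror erefl)); ring.
Qed.
End HankelPath.

(** * Iterated Hankel integrals *)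

Section Iterated.
Variable R : realType.
Local Notation C := R[i].
Variable e : R.
Hypothesis e0 : 0 < e.
Implicit Types (z w : C) (x : R) (f g : seq C -> C) (l : seq C).
Local Notation contour := (contour e).
Local Notation L := (hankel_mass e).

(** The iterated integral on lists, for which adding a last variable is as easy
    as adding a first one. *)
Fixpoint hankel_seq (n : nat) (g : seq C -> C) : C :=
  if n is n'.+1 then hankel e (fun w => hankel_seq n' (fun l => g (w :: l))) else g [::].

Lemma hankel_iterE n (g : 'rV[C]_n -> C) :
  hankel_iter e g = hankel_seq n (fun l => g (\row_k nth 0 l k)).
Proof.
elim: n g => [|n IH] g /=; first by congr g; apply/rowP => -[].
congr hankel; apply/funext => w; rewrite IH; congr hankel_seq; apply/funext => l.
congr g; apply/rowP => k; rewrite [RHS]mxE.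
case: (@split_ordP 1 n k) => j ->.
  transitivity ((w%:M : 'M[C]_1) 0 j); first exact: row_mxEl.
  by rewrite mxE (ord1 j) eqxx mulr1n.
transitivity ((\row_k nth 0 l k) 0 j : C); first exact: row_mxEr.
by rewrite mxE.
Qed.

Definition pts n l := size l = n /\ (forall k, (k < n)%N -> contour (nth 0 l k)).
Definition weights l : R := \prod_(w <- l) weight w.

(** Analogue of [adm1] for functions of n contour variables. *)
Definition adm n (M : R) f :=
  (forall l, pts n l -> normc (f l) <= M * weights l) /\
  (forall (u : nat -> seq C) l, (forall m, pts n (u m)) -> pts n l ->
     (forall k, (k < n)%N -> ccvg (fun m => nth 0 (u m) k) (nth 0 l k)) ->
     ccvg (fun m => f (u m)) (f l)).

Lemma pts_cons n w l : contour w -> pts n l -> pts n.+1 (w :: l).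
Proof. by move=> cw [sl cl]; split => /= [|[|k]//]; rewrite ?sl//; exact: cl. Qed.

Lemma pts_rcons n w l : contour w -> pts n l -> pts n.+1 (rcons l w).
Proof.
move=> cw [sl cl]; split => [|k]; first by rewrite size_rcons sl.
rewrite ltnS leq_eqVlt => /predU1P[->|kn]; first by rewrite nth_rcons sl ltnn eqxx.
by rewrite nth_rcons sl kn; exact: cl.
Qed.

Lemma pts0 : pts 0 [::]. Proof. by []. Qed.

Lemma weights_cons w l : weights (w :: l) = weight w * weights l.
Proof. by rewrite /weights big_cons. Qed.

Lemma weights_rcons w l : weights (rcons l w) = weights l * weight w.
Proof. by rewrite /weights -cats1 big_cat /= big_seq1. Qed.

Lemma weights_ge0 l : 0 <= weights l.
Proof. by rewrite /weights; apply: prodr_ge0 => w _; exact: weight_ge0. Qed.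

Lemma admW n M M' f : M <= M' -> adm n M f -> adm n M' f.
Proof.
move=> MM [b c]; split => // l hl; apply: le_trans (b l hl) _.
by rewrite ler_wpM2r ?weights_ge0.
Qed.

Lemma adm_lin n M M' f g a : adm n M f -> adm n M' g ->
  adm n (normc a * M + M') (fun l => a * f l + g l).
Proof.
move=> [bf cf] [bg cg]; split.
- move=> l hl; apply: le_trans (ler_normcD _ _) _; rewrite normcM mulrDl lerD ?bg//.
  by rewrite -mulrA ler_wpM2l ?normc_ge0 ?bf.
- move=> u l hu hl ul; apply: ccvgD; last exact: cg.
  by apply: ccvgM; [exact: ccvg_cst|exact: cf].
Qed.

Lemma adm0 n : adm n 0 (fun=> 0).
Proof. by split=> *; [rewrite normc_0 mul0r|exact: ccvg_cst]. Qed.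

Lemma adm_cons n M f w : contour w -> adm n.+1 M f -> adm n (M * weight w) (fun l => f (w :: l)).
Proof.
move=> cw [bf cf]; split.
- by move=> l hl; rewrite -mulrA -weights_cons bf//; exact: pts_cons.
- move=> u l hu hl ul; apply: cf.
  + by move=> m; exact: pts_cons.
  + exact: pts_cons.
  + by case=> [|k] kn /=; [exact: ccvg_cst|exact: ul].
Qed.

(** Bound and limit theorem have to be proved together: integrating over all
    variables but the first gives a function of one variable whose bound comes
    from the first statement and whose continuity comes from the second. *)
Lemma hankel_seq_props n : forall M : R, 0 <= M ->
  (forall f, adm n M f -> normc (hankel_seq n f) <= M * L ^+ n) /\
  (forall (f_ : nat -> seq C -> C) f, (forall m, adm n M (f_ m)) -> adm n M f ->
    (forall l, pts n l -> ccvg (fun m => f_ m l) (f l)) ->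
    ccvg (fun m => hankel_seq n (f_ m)) (hankel_seq n f)).
Proof.
elim: n => [|n IH] M M0.
  split=> [f [bf _]|f_ f _ _ c]; last exact: (c _ pts0).
  by have := bf [::] pts0; rewrite /weights big_nil expr0.
have A1 f : adm n.+1 M f -> adm1 e (M * L ^+ n) (fun w => hankel_seq n (fun l => f (w :: l))).
  move=> af; split.
  - move=> w cw; have [b _] := IH (M * weight w) (mulr_ge0 M0 (weight_ge0 w)).
    by rewrite mulrAC; exact: b (adm_cons cw af).
  - move=> u w cu cw uw; have [_ c] := IH M M0.
    have aw (v : C) : contour v -> adm n M (fun l => f (v :: l)).
      by move=> cv; apply: admW (adm_cons cv af); rewrite ler_piMr ?weight_le1.
    apply: c; [by move=> m; exact: aw|exact: aw|].
    move=> l hl; case: af => _; apply.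
    + by move=> m; exact: pts_cons.
    + exact: pts_cons.
    + by case=> [|k] kn //=; exact: ccvg_cst.
have ML0 : 0 <= M * L ^+ n by rewrite mulr_ge0 ?exprn_ge0 ?hankel_mass_ge0.
split.
- move=> f af /=; apply: le_trans (hankel_bound e0 ML0 (A1 f af)) _.
  by rewrite exprSr mulrA.
- move=> f_ f af_ af c /=; apply: (hankel_cvg e0 ML0) => [m||w cw].
  + exact: A1.
  + exact: A1.
  + have [_ c'] := IH M M0.
    have aw g : adm n.+1 M g -> adm n M (fun l => g (w :: l)).
      by move=> ag; apply: admW (adm_cons cw ag); rewrite ler_piMr ?weight_le1.
    apply: c'; [by move=> m; exact: aw|exact: aw|].
    by move=> l hl; apply: c; exact: pts_cons.
Qed.

Lemma hankel_seq_cvg n M (f_ : nat -> seq C -> C) f : 0 <= M -> (forall m, adm n M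
  (f_ m)) -> adm n M f ->
    (forall l, pts n l -> ccvg (fun m => f_ m l) (f l)) ->
    ccvg (fun m => hankel_seq n (f_ m)) (hankel_seq n f).
Proof. by move=> /(hankel_seq_props n)[_ h]; exact: h. Qed.

Lemma hankel_seq_adm1 n M f : 0 <= M -> adm n.+1 M f ->
  adm1 e (M * L ^+ n) (fun w => hankel_seq n (fun l => f (w :: l))).
Proof.
move=> M0 af; split.
- move=> w cw; have [b _] := hankel_seq_props n (mulr_ge0 M0 (weight_ge0 w)).
  by rewrite mulrAC; exact: b (adm_cons cw af).
- move=> u w cu cw uw.
  have aw (v : C) : contour v -> adm n M (fun l => f (v :: l)).
    by move=> cv; apply: admW (adm_cons cv af); rewrite ler_piMr ?weight_le1.
  apply: (hankel_seq_cvg M0); [by move=> m; exact: aw|exact: aw|].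
  move=> l hl; case: af => _; apply.
  + by move=> m; exact: pts_cons.
  + exact: pts_cons.
  + by case=> [|k] kn //=; exact: ccvg_cst.
Qed.

Lemma hankel_seq_ext n f g : (forall l, pts n l -> f l = g l) -> hankel_seq n f = hankel_seq n g.
Proof.
elim: n f g => [|n IH] f g fg /=; first exact: fg pts0.
by apply: (hankel_ext e0) => w cw; apply: IH => l hl; apply: fg; exact: pts_cons.
Qed.

Lemma hankel_seq_lin n M M' f g a : 0 <= M -> 0 <= M' -> adm n M f -> adm n M' g ->
  hankel_seq n (fun l => a * f l + g l) = a * hankel_seq n f + hankel_seq n g.
Proof.
elim: n M M' f g => [|n IH] M M' f g M0 M0' af ag //=.
rewrite -(hankel_lin e0 a (mulr_ge0 M0 (exprn_ge0 n (hankel_mass_ge0 e0))) (mulr_ge0 M0'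
  (exprn_ge0 n (hankel_mass_ge0 e0)))
  (hankel_seq_adm1 M0 af) (hankel_seq_adm1 M0' ag)).
apply: (hankel_ext e0) => w cw.
by apply: (IH (M * weight w) (M' * weight w)); rewrite ?mulr_ge0 ?weight_ge0//; exact: adm_cons.
Qed.

Lemma hankel_seq_scale n M f a : 0 <= M -> adm n M f -> hankel_seq n
  (fun l => a * f l) = a * hankel_seq n f.
Proof.
move=> M0 af.
have hz : hankel_seq n (fun=> 0) = 0.
  have := hankel_seq_lin (- 1) (lexx 0) (lexx 0) (adm0 n) (adm0 n).
  have E0 (z : C) : -1 * z + z = 0 by rewrite mulN1r addNr.
  rewrite [RHS]E0 => hE; rewrite -[RHS]hE; congr hankel_seq; apply/funext => l;
    by rewrite mulr0 addr0.
have := hankel_seq_lin a M0 (lexx 0) af (adm0 n); rewrite hz addr0 => <-.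
by congr hankel_seq; apply/funext => l; rewrite addr0.
Qed.

Lemma hankel_seq_sum n (I : Type) (r : seq I) (a : I -> C) (F : I -> seq C -> C) (M : I -> R) :
  (forall i, 0 <= M i) -> (forall i, adm n (M i) (F i)) ->
  hankel_seq n (fun l => \sum_(i <- r) a i * F i l) = \sum_(i <- r) a i * hankel_seq n (F i) /\
  exists2 M', 0 <= M' & adm n M' (fun l => \sum_(i <- r) a i * F i l).
Proof.
move=> M0 aF; elim: r => [|i r [IH [M' M'0 aM']]].
  split; last by exists 0 => //; have := adm0 n; congr adm; apply/funext => l; rewrite big_nil.
  have h0 := hankel_seq_scale 0 (lexx 0) (adm0 n).
  rewrite big_nil -[RHS](mul0r (hankel_seq n (fun=> 0))) -h0.
  by congr hankel_seq; apply/funext => l; rewrite big_nil mul0r.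
have E : (fun l => \sum_(j <- i :: r) a j * F j l) =
  (fun l => a i * F i l + \sum_(j <- r) a j * F j l).
  by apply/funext => l; rewrite big_cons.
rewrite E big_cons -IH (hankel_seq_lin (a i) (M0 i) M'0 (aF i) aM'); split => //.
exists (normc (a i) * M i + M'); first by rewrite addr_ge0 ?mulr_ge0 ?normc_ge0.
exact: adm_lin.
Qed.

Lemma hankel_seq_rcons n f : hankel_seq n.+1 f = hankel_seq n (fun l => hankel e (fun w => f
  (rcons l w))).
Proof.
elim: n f => [//|n IH] f; rewrite -[LHS]/(hankel e (fun w => hankel_seq n.+1 (fun l => f
  (w :: l)))).
by rewrite /=; congr hankel; apply/funext => w; exact: (IH (fun l => f (w :: l))).
Qed.
End Iterated.

(** * Holomorphic functions on a horizontal strip *)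

Section Hol.
Variable R : realType.
Local Notation C := R[i].
Local Notation Re := (@complex.Re R).
Local Notation Im := (@complex.Im R).
Implicit Types (z w y : C) (a b : R) (F G : C -> C).

Definition strip a z := `|Im z| < a.

(** A differentiable path inside the strip which is bounded together with its
    velocity, so that derivatives along it are locally dominated. *)
Definition bpath a (u v M : R) (gam gam' : R -> C) := forall x, u < x < v ->
  [/\ cder gam x (gam' x), strip a (gam x), normc (gam x) <= M & normc (gam' x) <= M].

(** Complex differentiability in the form of the chain rule along bounded paths.
    This form passes through integrals depending on a parameter, and is stable
    under products and inverses. *)
Definition path_hol a F F' := forall u v M gam gam', bpath a u v M gam gam' ->
  forall x, u < x < v -> cder (fun x => F (gam x)) x (F' (gam x) * gam' x).
Definition loc_bd a F := forall M, exists K, forall z, strip a z -> normc z <= M -> normc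
  (F z) <= K.
Definition strip_cont a F := forall (u : nat -> C) z, (forall n, strip a (u n)) -> strip a z ->
  ccvg u z -> ccvg (fun n => F (u n)) (F z).
Record hol a F F' : Prop := Hol { hol_phol : path_hol a F F'; hol_lbd : loc_bd a F;
  hol_lbd' : loc_bd a F'; hol_cont : strip_cont a F; hol_cont' : strip_cont a F' }.

Lemma loc_bd_cst a z : loc_bd a (fun=> z).
Proof. by move=> M; exists (normc z). Qed.

Lemma loc_bdD a F G : loc_bd a F -> loc_bd a G -> loc_bd a (fun z => F z + G z).
Proof.
move=> hF hG M; have [K h] := hF M; have [K' h'] := hG M; exists (K + K') => z sz nz.
by apply: le_trans (ler_normcD _ _) _; rewrite lerD ?h ?h'.
Qed.

Lemma loc_bdM a F G : loc_bd a F -> loc_bd a G -> loc_bd a (fun z => F z * G z).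
Proof.
move=> hF hG M; have [K h] := hF M; have [K' h'] := hG M; exists (K * K') => z sz nz.
by rewrite normcM ler_pM ?normc_ge0 ?h ?h'.
Qed.

Lemma strip_contD a F G : strip_cont a F -> strip_cont a G -> strip_cont a (fun z => F z + G z).
Proof. by move=> hF hG u z su sz uz; apply: ccvgD; [exact: hF|exact: hG]. Qed.

Lemma strip_contM a F G : strip_cont a F -> strip_cont a G -> strip_cont a (fun z => F z * G z).
Proof. by move=> hF hG u z su sz uz; apply: ccvgM; [exact: hF|exact: hG]. Qed.

Lemma strip_contV a F : (forall z, strip a z -> F z != 0) -> strip_cont a F -> strip_cont a
  (fun z => (F z)^-1).
Proof. by move=> n0 hF u z su sz uz; apply: ccvgV; [exact: n0|exact: hF]. Qed.

Lemma hol_eq a F G F' G' : (forall z, F z = G z) -> (forall z, F' z = G' z) ->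
  hol a F F' -> hol a G G'.
Proof. by move=> /funext -> /funext ->. Qed.

Lemma hol_cst a z : hol a (fun=> z) (fun=> 0).
Proof.
split; try exact: loc_bd_cst; try by move=> *; exact: ccvg_cst.
by move=> u v M g g' _ x _; rewrite mul0r; exact: cder_cst.
Qed.

Lemma hol_mul a F F' G G' : hol a F F' -> hol a G G' ->
  hol a (fun z => F z * G z) (fun z => F' z * G z + F z * G' z).
Proof.
move=> [p b b' c c'] [q d d' g g']; split.
- move=> u v M gam gam' hp x xuv.
  apply: cder_eq; first exact: (cderM (p _ _ _ _ _ hp x xuv) (q _ _ _ _ _ hp x xuv)).
  by rewrite mulrDl; congr (_ + _); [rewrite mulrAC|rewrite mulrA].
- exact: loc_bdM.
- by apply: loc_bdD; exact: loc_bdM.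
- exact: strip_contM.
- by apply: strip_contD; exact: strip_contM.
Qed.

Lemma hol_inv a F F' : (forall z, strip a z -> F z != 0) -> loc_bd a (fun z => (F z)^-1) ->
  hol a F F' -> hol a (fun z => (F z)^-1) (fun z => - F' z * ((F z)^-1 * (F z)^-1)).
Proof.
move=> n0 bi [p b b' c c']; split => //.
- move=> u v M gam gam' hp x xuv.
  have [_ s _ _] := hp x xuv.
  apply: cder_eq; first exact: (cderV (n0 _ s) (p _ _ _ _ _ hp x xuv)).
  by rewrite expr2 invfM mulNr mulNr mulrAC mulNr.
- apply: loc_bdM; last exact: loc_bdM.
  by move=> M; have [K h] := b' M; exists K => z sz nz; rewrite normcN h.
- exact: strip_contV.
- apply: strip_contM; last by apply: strip_contM; exact: strip_contV.
  by move=> u z su sz uz; apply: ccvgN; exact: c'.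
Qed.

Lemma hol_shift a b F F' y : `|Im y| <= b -> hol (a + b) F F' ->
  hol a (fun z => F (y + z)) (fun z => F' (y + z)).
Proof.
move=> yb; have sh z : strip a z -> strip (a + b) (y + z).
  by rewrite /strip ImD addrC => sz; rewrite (le_lt_trans (ler_normD _ _))// ltr_leD.
have bb H : loc_bd (a + b) H -> loc_bd a (fun z => H (y + z)).
  move=> h M; have [K hK] := h (normc y + M); exists K => z sz nz.
  by apply: hK; [exact: sh|rewrite (le_trans (ler_normcD _ _))// lerD2l].
have cc H : strip_cont (a + b) H -> strip_cont a (fun z => H (y + z)).
  move=> h u z su sz uz; apply: (h (fun n => y + u n)); [by move=> n; exact: sh|exact: sh|].
  by apply: ccvgD => //; exact: ccvg_cst.
move=> [p b1 b1' c c']; split; [|exact: bb|exact: bb|exact: cc|exact: cc].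
move=> u v M gam gam' hp x xuv.
apply: (p u v (normc y + M) (fun x => y + gam x)) => // t tuv.
have [d s n n'] := hp t tuv; split; [|exact: sh| |].
- apply: cder_eq; [exact: cderD (cder_cst _ _) d|by rewrite add0r].
- by rewrite (le_trans (ler_normcD _ _))// lerD2l.
- by rewrite (le_trans n')// lerDr normc_ge0.
Qed.

Lemma ccvg_bounded (u : nat -> C) z : ccvg u z -> exists K, forall n, normc (u n) <= K.
Proof.
move=> /ccvg_normc h.
have : cvgn (fun n => normc (u n)) by apply/cvg_ex; exists (normc z).
move=> /cvg_seq_bounded [M [_ hM]]; exists (M + 1) => n.
by apply: le_trans (hM (M + 1) _ n I); rewrite ?ltrDl ?ltr01// ler_norm.
Qed.
End Hol.

(** * The entire function (exp z - 1) / z and its derivatives *)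

Section Efun.
Variable R : realType.
Local Notation C := R[i].
Local Notation Re := (@complex.Re R).
Local Notation Im := (@complex.Im R).
Local Notation mu := (@lebesgue_measure R).
Local Notation mR := (measurableTypeR R).
Implicit Types (z w y : C) (a b : R).

(** The n-th derivative of (exp z - 1) / z, written as an integral over [0, 1]; in
    this form the singularity at 0 is absent. *)
Definition exp_moment (n : nat) z := cintegral `[0, 1] (fun u => (u ^+ n)%:C * cexp (u%:C * z)).

Lemma ccvg_pow (n : nat) (u : nat -> R) (x : R) :
  u n @[n --> \oo] --> x -> ccvg (fun k => (u k ^+ n)%:C) (x ^+ n)%:C.
Proof. move=> ux; apply: ccvgR; elim: n => [|n IH].
  by under eq_fun do rewrite expr0; rewrite expr0; exact: cvg_cst.
by under eq_fun do rewrite exprS; rewrite exprS; exact: cvgM. Qed.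

Lemma exp_moment_seq_cont n z (D : set R) : seq_cont D (fun u => (u ^+ n)%:C * cexp (u%:C * z)).
Proof.
move=> u x _ _ ux; apply: ccvgM; first exact: ccvg_pow.
by apply: ccvg_cexp; apply: ccvgM; [exact: ccvgR|exact: ccvg_cst].
Qed.

Lemma normc_moment_le n z (u : R) : 0 <= u <= 1 ->
  normc ((u ^+ n)%:C * cexp (u%:C * z)) <= expR (u * Re z).
Proof.
move=> /andP[u0 u1]; rewrite normcM normcR normc_cexp ReM /= mul0r subr0.
by rewrite ler_piMl ?expR_ge0// ger0_norm ?exprn_ge0// exprn_ile1.
Qed.

Lemma expR_01 z (u : R) : 0 <= u <= 1 -> expR (u * Re z) <= expR (normc z).
Proof.
move=> /andP[u0 u1]; rewrite ler_expR (le_trans (ler_norm _))// normrM ger0_norm//.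
by rewrite (le_trans _ (abs_Re z))// ler_piMl.
Qed.

Lemma exp_moment_hol a n : hol a (exp_moment n) (exp_moment n.+1).
Proof.
have L k : loc_bd a (exp_moment k).
  move=> M; exists (2 * (expR M * (1 - 0))) => z _ zM.
  apply: cint_bound => //; first exact: exp_moment_seq_cont.
  move=> x x01; apply: le_trans (normc_moment_le k z x01) _.
  by apply: le_trans (expR_01 z x01) _; rewrite ler_expR.
have Z k : strip_cont a (exp_moment k).
  move=> u z _ _ uz; have [K hK] := ccvg_bounded uz.
  apply: (@cint_dct_itv _ 0 1 (expR K)) => //.
  - by move=> m; exact: exp_moment_seq_cont.
  - exact: exp_moment_seq_cont.
  - move=> m x x01; apply: le_trans (normc_moment_le k (u m) x01) _.
    by apply: le_trans (expR_01 _ x01) _; rewrite ler_expR.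
  - move=> x _; apply: ccvgM; first exact: ccvg_cst.
    by apply: ccvg_cexp; apply: ccvgM => //; exact: ccvg_cst.
split => // u v M gam gam' hp x xuv.
have -> : exp_moment n.+1 (gam x) * gam' x =
    cintegral `[0, 1] (fun t => gam' x * ((t ^+ n.+1)%:C * cexp (t%:C * gam x))).
  rewrite (@cintM _ _ (fun t => (t ^+ n.+1)%:C * cexp (t%:C * gam x)) (gam' x)
    (measurable_itv _)) 1?mulrC//.
  by apply: seq_cont_intble => //; exact: exp_moment_seq_cont.
apply: (@cder_under_int _ 0 1 u v (M * expR M) x (fun x t => (t ^+ n)%:C * cexp (t%:C * gam x))
  (fun x t => gam' x * ((t ^+ n.+1)%:C * cexp (t%:C * gam x)))) => //.
- by move=> t tuv; exact: exp_moment_seq_cont.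
- move=> t c tuv c01; have [d _ _ _] := hp t tuv.
  apply: cder_eq; first exact: (cderM (cder_cst _ _) (cder_cexp (cderM (cder_cst (c%:C) t) d))).
  by rewrite exprSr rmorphM /=; ring.
- move=> t c tuv c01; have [_ _ n1 n2] := hp t tuv.
  rewrite normcM ler_pM ?normc_ge0//; apply: le_trans (normc_moment_le _ _ c01) _.
  by apply: le_trans (expR_01 _ c01) _; rewrite ler_expR.
Qed.

Lemma exp_moment0E z : z * exp_moment 0 z = cexp z - 1.
Proof.
rewrite /exp_moment -cintM//; last by apply: seq_cont_intble => //; exact: exp_moment_seq_cont.
rewrite (@cint_FTC _ 0 1 (fun u => cexp (u%:C * z)))//.
- by rewrite mul0r cexp0 mul1r.
- move=> x _; apply: cder_eq; first exact: (cder_cexp (cderM (cderR (is_derive_id x 1))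
  (cder_cst z x))).
  by rewrite /= expr0; ring.
- move=> u x uD xD ux; apply: ccvgM; first exact: ccvg_cst.
  exact: (@exp_moment_seq_cont 0 z _ u x uD xD ux).
Qed.

Lemma exp_moment00 : exp_moment 0 0 = 1.
Proof.
rewrite /exp_moment (@cint_FTC _ 0 1 (fun u => u%:C)) ?subr0//.
- move=> x _; rewrite expr0 mulr0 cexp0 mulr1; exact: cderR (is_derive_id x 1).
- exact: exp_moment_seq_cont.
Qed.

Lemma exp_moment10 : exp_moment 1 0 = 2^-1.
Proof.
rewrite /exp_moment (@cint_FTC _ 0 1 (fun u => 2^-1 * (u%:C * u%:C))).
- by rewrite mul0r mulr0 subr0 !mulr1.
- exact: ltr01.
- move=> x _; have d := cderR (is_derive_id x (1 : R)).
  apply: cder_eq; first exact: (cderM (cder_cst 2^-1 x) (cderM d d)).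
  by rewrite expr1 mulr0 cexp0 /=; field.
- exact: exp_moment_seq_cont.
Qed.

(** (exp x - 1) / x at a real point; it compares all the moments. *)
Definition exp_mass (x : R) : R := \int[mu]_(u in `[0, 1]) expR (u * x).
Lemma exp_mass_int (x : R) : rintble `[0, 1] (fun u => expR (u * x)).
Proof.
apply: continuous_compact_integrable; first exact: segment_compact.
apply: continuous_subspaceT => u; apply: continuous_comp; last exact: continuous_expR.
by apply: cvgM; [exact: cvg_id|exact: cvg_cst].
Qed.

(** Jensen's inequality for the exponential on [0, 1]: integrate the tangent line
    at u = 1/2. *)
Lemma exp_mass_ge (x : R) : expR (x / 2) <= exp_mass x.
Proof.
pose F u : R := expR (x / 2) * (u + (u * u / 2 - u / 2) * x).
pose f u : R := expR (x / 2) * (1 + (u * x - x / 2)).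
have cf : continuous f.
  move=> u; apply: cvgM; first exact: cvg_cst.
  apply: cvgD; first exact: cvg_cst.
  by apply: cvgB; [apply: cvgM; [exact: cvg_id|exact: cvg_cst]|exact: cvg_cst].
have E : \int[mu]_(u in `[0, 1]) f u = F 1 - F 0.
  apply: (@rint_FTC R 0 1 F f ltr01).
  - move=> u _; rewrite /F /f.
    have i := is_derive_id u (1 : R); have c k := is_derive_cst (k : R) u 1.
    have d := is_deriveM_fun (f := fun=> expR (x / 2)) (c _) (is_deriveD_fun
      (f := fun t : R => t) i
      (is_deriveM_fun (f := fun t : R => t * t / 2 - t / 2) (g := fun=> x) (is_deriveB_fun
        (f := fun t : R => t * t / 2) (g := fun t : R => t / 2)
       (is_deriveM_fun (f := fun t : R => t * t) (g := fun=> 2^-1) (is_deriveM_fun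
         (f := fun t : R => t) (g := fun t : R => t) i i) (c _))
       (is_deriveM_fun (f := fun t : R => t) (g := fun=> 2^-1) i (c _))) (c _))).
    by apply: (is_derive_eq d); field.
  - exact: continuous_subspaceT.
have -> : expR (x / 2) = \int[mu]_(u in `[0, 1]) f u by rewrite E /F; field.
apply: le_Rintegral => //.
- apply: continuous_compact_integrable; first exact: segment_compact.
  exact: continuous_subspaceT.
- exact: exp_mass_int.
- move=> u _; rewrite /f; have -> : u * x = x / 2 + (u * x - x / 2) by ring.
  rewrite expRD [X in _ * (1 + X)](_ : _ = u * x - x / 2); last by ring.
  by rewrite ler_wpM2l ?expR_ge0// expR_ge1Dx.
Qed.

Lemma exp_moment_le n z : normc (exp_moment n z) <= 2 * exp_mass (Re z).
Proof.
apply: cint_norm => //.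
- by apply: seq_cont_intble => //; exact: exp_moment_seq_cont.
- exact: exp_mass_int.
- by move=> u; rewrite /= in_itv /= => u01; exact: normc_moment_le.
Qed.

Lemma cos_ge1 (t : R) : `|t| <= 1 -> cos 1 <= cos t.
Proof.
move=> t1; have -> : cos t = cos `|t| by case: (ger0P t) => // _; rewrite cosN.
rewrite le_eqVlt; case: (eqVneq `|t| 1) => [->|tn]; first by rewrite eqxx.
apply/orP; right; rewrite ltr_cos ?in_itv /= ?normr_ge0 ?lt_neqAle ?tn//.
- by rewrite (le_trans t1)// (le_trans _ (@pi_ge2 R))// ler1n.
- by rewrite ler01 (le_trans _ (@pi_ge2 R))// ler1n.
Qed.

(** On the strip |Im z| <= 1 the factor cos (u Im z) of the real part of the
    integrand is at least cos 1 > 0. *)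
Lemma exp_moment0_ge z : `|Im z| <= 1 -> cos 1 * exp_mass (Re z) <= normc (exp_moment 0 z).
Proof.
move=> z1; apply: le_trans (le_trans _ (ler_norm _)) (abs_Re _).
rewrite /exp_moment /cintegral /= -RintegralZl//; last exact: exp_mass_int.
have [it _] := seq_cont_intble ler01 (@exp_moment_seq_cont 0 z `[0, 1]).
apply: le_Rintegral => //.
  exact: (integrableZl _ _ (exp_mass_int _)).
move=> u; rewrite /= in_itv /= => /andP[u0 u1].
rewrite expr0 mul1r /cexp !(ReM, ImM) /= !mul0r !subr0 addr0 mulrC ler_wpM2l ?expR_ge0//.
by apply: cos_ge1; rewrite normrM ger0_norm// mulr_ile1.
Qed.

Lemma exp_mass_gt0 (x : R) : 0 < exp_mass x.
Proof. by apply: lt_le_trans (exp_mass_ge x); exact: expR_gt0. Qed.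

Lemma exp_moment0_gt0 z : `|Im z| <= 1 -> 0 < normc (exp_moment 0 z).
Proof. by move=> z1; apply: lt_le_trans (exp_moment0_ge z1);
  rewrite mulr_gt0 ?cos1_gt0 ?exp_mass_gt0. Qed.

Lemma exp_moment0_neq0 z : `|Im z| <= 1 -> exp_moment 0 z != 0.
Proof. by move=> /exp_moment0_gt0; apply: contraTneq => ->; rewrite normc_0 ltxx. Qed.

Lemma exp_moment0V_le z : `|Im z| <= 1 -> normc (exp_moment 0 z)^-1 <= (cos 1 * exp_mass
  (Re z))^-1.
Proof.
move=> z1; rewrite normcV lef_pV2 ?posrE ?exp_moment0_gt0 ?mulr_gt0 ?cos1_gt0 ?exp_mass_gt0//.
exact: exp_moment0_ge.
Qed.
End Efun.

(** * The kernel of the integrand and its limit as c tends to 1 *)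

Section Gfun.
Variable R : realType.
Local Notation C := R[i].
Local Notation Re := (@complex.Re R).
Local Notation Im := (@complex.Im R).
Local Notation exp_moment := (@exp_moment R).
Implicit Types (z w y : C) (c v x : R).

(** z / (exp z - 1). *)
Definition bern z := (exp_moment 0 z)^-1.

(** Derivative of z / (exp z - 1). *)
Definition dbern z := - exp_moment 1 z * (bern z * bern z).

Lemma bern_le z : `|Im z| <= 1 -> normc (bern z) <= (cos 1)^-1 * expR (- (Re z / 2)).
Proof.
move=> z1; apply: le_trans (exp_moment0V_le z1) _.
rewrite invfM ler_wpM2l ?invr_ge0 ?(ltW (cos1_gt0 _))// expRN.
by rewrite lef_pV2 ?posrE ?expR_gt0 ?exp_mass_gt0// exp_mass_ge.
Qed.

Definition dbern_bd : R := 2 * (cos 1)^-1 * (cos 1)^-1.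
Lemma dbern_bd_ge0 : 0 <= dbern_bd.
Proof. by rewrite /dbern_bd !mulr_ge0// invr_ge0 ltW ?cos1_gt0. Qed.

(** Both moments are comparable to [exp_mass] at Re z, and one more factor 1 / E_0
    than factors E_1 remains; it gives the decay. *)
Lemma dbern_le z : `|Im z| <= 1 -> normc (dbern z) <= dbern_bd * expR (- (Re z / 2)).
Proof.
move=> z1; rewrite /dbern /dbern_bd !normcM normcN mulrA -[leRHS]mulrA.
apply: ler_pM; rewrite ?mulr_ge0 ?normc_ge0//; last exact: bern_le.
apply: le_trans (ler_pM _ _ (exp_moment_le 1 z) (exp_moment0V_le z1)) _; rewrite ?normc_ge0//.
have I0 : exp_mass (Re z) != 0 by rewrite gt_eqF ?exp_mass_gt0.
have c0 : cos (1 : R) != 0 by rewrite gt_eqF ?cos1_gt0.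
by rewrite le_eqVlt; apply/orP; left; apply/eqP; field; rewrite I0 c0.
Qed.

Lemma bern_hol : hol 1 bern dbern.
Proof.
apply: hol_inv; last exact: exp_moment_hol.
- by move=> z /ltW; exact: exp_moment0_neq0.
- move=> M; exists ((cos 1)^-1 * expR (M / 2)) => z /ltW z1 zM.
  apply: le_trans (bern_le z1) _; rewrite ler_wpM2l ?invr_ge0 ?(ltW (cos1_gt0 _))// ler_expR.
  by rewrite -mulNr ler_wpM2r// (le_trans (ler_norm _))// normrN (le_trans (abs_Re _)).
Qed.

Lemma dbern_hol : exists g', hol 1 dbern g'.
Proof.
exists (fun z => (0 * exp_moment 1 z + -1 * exp_moment 2 z) * (bern z * bern z) +
  (-1 * exp_moment 1 z) * (dbern z * bern z + bern z * dbern z)).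
apply: hol_eq (hol_mul (hol_mul (hol_cst _ (-1)) (@exp_moment_hol R 1 1))
  (hol_mul bern_hol bern_hol)) => z //.
by rewrite /dbern mulN1r.
Qed.

Lemma dbern0 : dbern 0 = - 2^-1.
Proof. by rewrite /dbern /bern exp_moment00 exp_moment10 invr1 !mulr1. Qed.

(** Contains the partial sums t_j + ... + t_n on the contour, for small radius. *)
Definition region z := `|Im z| <= 4^-1 /\ -1 <= Re z.
Definition region_cont (q : C -> C) := forall (u : nat -> C) z,
  (forall n, region (u n)) -> region z -> ccvg u z -> ccvg (fun n => q (u n)) (q z).

(** The factor 2 allows the same bound for means over a segment; exp (1/4) absorbs
    the passage from Re z / 2 to Re z / 4 on scaled points of the region. *)
Definition kernel_bd : R := 2 * (dbern_bd * expR 4^-1).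
Lemma kernel_bd_ge0 : 0 <= kernel_bd. Proof. by rewrite /kernel_bd mulr_ge0// mulr_ge0
  ?dbern_bd_ge0 ?expR_ge0. Qed.

Definition kernel_ok (q : C -> C) :=
  (forall z, region z -> normc (q z) <= kernel_bd * expR (- (Re z / 4))) /\ region_cont q.

Definition seg c v : R := c + (1 - c) * v.
Lemma seg_bd c v : 2^-1 <= c <= 1 -> 0 <= v <= 1 -> 2^-1 <= seg c v <= 1.
Proof. by move=> /andP[h1 h2] /andP[h3 h4]; rewrite /seg; apply/andP; split; nra. Qed.

Lemma ImR x z : Im (x%:C * z) = x * Im z.
Proof. by rewrite ImM /= mul0r addr0. Qed.

Lemma ReR x z : Re (x%:C * z) = x * Re z.
Proof. by rewrite ReM /= mul0r subr0. Qed.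

Lemma region_seg (s : R) z : 2^-1 <= s <= 1 -> region z -> region (s%:C * z).
Proof.
move=> /andP[s0 s1] [i r]; split; rewrite ?ImR ?ReR.
  by rewrite normrM (le_trans _ i)// ler_piMl// ger0_norm// (le_trans _ s0).
nra.
Qed.

Lemma region_Im1 z : region z -> `|Im z| <= 1.
Proof. by case=> h _; rewrite (le_trans h)// invf_le1// ler1n. Qed.

Lemma dbern_seg_le (s : R) z : 2^-1 <= s <= 1 -> region z ->
  normc (dbern (s%:C * z)) <= dbern_bd * expR 4^-1 * expR (- (Re z / 4)).
Proof.
move=> hs hz; apply: le_trans (dbern_le (region_Im1 (region_seg hs hz))) _.
rewrite -mulrA ler_wpM2l ?dbern_bd_ge0// -expRD ler_expR ReR.
case: hz => _ r; case/andP: hs => s0 s1; case: (lerP 0 (Re z)) => ?; nra.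
Qed.

Lemma region_strip z : region z -> strip 1 z.
Proof. by case=> h _; rewrite /strip (le_lt_trans h)// invf_lt1// ltr1n. Qed.

Lemma dbern_rcont : region_cont dbern.
Proof.
have [g' H] := dbern_hol; move=> u z hu hz uz; apply: (hol_cont H) => //.
  by move=> n; exact: region_strip.
exact: region_strip.
Qed.

Lemma one_bd : 2^-1 <= (1 : R) <= 1.
Proof. by rewrite lexx andbT invf_le1// ler1n. Qed.

Lemma dbern_qok : kernel_ok dbern.
Proof.
split; last exact: dbern_rcont.
move=> z hz; have := dbern_seg_le one_bd hz; rewrite mul1r => /le_trans; apply.
rewrite ler_wpM2r ?expR_ge0// /kernel_bd.
by have := mulr_ge0 dbern_bd_ge0 (expR_ge0 (4^-1 : R)); lra.
Qed.

(** Mean of the derivative of z / (exp z - 1) over the segment from c z to z. *)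
Definition hdes_quot c z := cintegral `[0, 1] (fun v => dbern ((seg c v)%:C * z)).
Lemma ccvg_seg c z (u : nat -> R) v : u n @[n --> \oo] --> v ->
  ccvg (fun n => (seg c (u n))%:C * z) ((seg c v)%:C * z).
Proof.
move=> uv; apply: ccvgM; last exact: ccvg_cst.
apply: ccvgR; apply: cvgD; first exact: cvg_cst.
by apply: cvgM => //; exact: cvg_cst.
Qed.

Lemma hdes_quot_seq_cont c z : 2^-1 <= c <= 1 -> region z -> seq_cont `[0, 1] (fun v => dbern
  ((seg c v)%:C * z)).
Proof.
move=> hc hz u v uD vD uv; move: vD; rewrite /= in_itv /= => vD.
have {}uD n : 0 <= u n <= 1 by have := uD n; rewrite /= in_itv.
apply: dbern_rcont; [|by apply: region_seg => //; exact: seg_bd|exact: ccvg_seg].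
by move=> n; apply: region_seg => //; exact: seg_bd.
Qed.

Lemma hdes_quot_qok c : 2^-1 <= c <= 1 -> kernel_ok (hdes_quot c).
Proof.
move=> hc; split.
- move=> z hz; have -> : kernel_bd * expR (- (Re z / 4)) = 2 * (dbern_bd * expR 4^-1 * expR (-
  (Re z / 4)) * (1 - 0)).
    by rewrite /kernel_bd; ring.
  apply: cint_bound => //; first exact: hdes_quot_seq_cont.
  by move=> v v01; apply: dbern_seg_le => //; exact: seg_bd.
- move=> u z hu hz uz.
  apply: (@cint_dct_itv _ 0 1 (dbern_bd * expR 4^-1 * expR 4^-1)) => //.
  + by move=> n; exact: hdes_quot_seq_cont.
  + exact: hdes_quot_seq_cont.
  + move=> n v v01; apply: le_trans (dbern_seg_le (seg_bd hc v01) (hu n)) _.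
    apply: ler_wpM2l; first by rewrite mulr_ge0 ?dbern_bd_ge0 ?expR_ge0.
    by rewrite ler_expR; have [_ r] := hu n; lra.
  + move=> v v01; apply: dbern_rcont.
    * by move=> n; apply: region_seg => //; exact: seg_bd.
    * by apply: region_seg => //; exact: seg_bd.
    * by apply: ccvgM => //; exact: ccvg_cst.
Qed.

Lemma hdes_quot_cvg (c : nat -> R) z : (forall n, 2^-1 <= c n <= 1) -> c n @[n --> \oo] -->
  (1 : R) ->
  region z -> ccvg (fun n => hdes_quot (c n) z) (dbern z).
Proof.
move=> hc c1 hz.
have -> : dbern z = cintegral `[0, 1] (fun v => dbern ((seg 1 v)%:C * z)).
  rewrite (@cint_FTC _ 0 1 (fun v => v%:C * dbern z))//.
  - by rewrite mul0r subr0 mul1r.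
  - move=> x _; rewrite /seg subrr mul0r addr0 mul1r.
    apply: cder_eq; first exact: (cderM (cderR (is_derive_id x 1)) (cder_cst (dbern z) x)).
    by rewrite mulr0 addr0 mul1r.
  - exact: (hdes_quot_seq_cont one_bd).
apply: (@cint_dct_itv _ 0 1 (dbern_bd * expR 4^-1 * expR (- (Re z / 4)))) => //.
- by move=> n; exact: hdes_quot_seq_cont.
- exact: (hdes_quot_seq_cont one_bd).
- by move=> n v v01; apply: dbern_seg_le => //; exact: seg_bd.
- move=> v v01; apply: dbern_rcont.
  + by move=> n; apply: region_seg => //; exact: seg_bd.
  + by apply: region_seg => //; apply: seg_bd => //; exact: one_bd.
  + apply: ccvgM; last exact: ccvg_cst.
    apply: ccvgR; apply: cvgD => //; apply: cvgM; last exact: cvg_cst.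
    by apply: cvgB => //; exact: cvg_cst.
Qed.

(** Fundamental theorem of calculus along the segment from c z to z. *)
Lemma hdes_quotE c z : 2^-1 <= c < 1 -> region z -> hdes c z = (1 - c)%:C * hdes_quot c z.
Proof.
move=> /andP[c2 c1] hz; have hc : 2^-1 <= c <= 1 by rewrite c2 ltW.
have c0 : 0 < c by exact: lt_le_trans c2.
rewrite /hdes; case: eqVneq => [->|z0].
  rewrite /hdes_quot (@cint_FTC _ 0 1 (fun v => v%:C * dbern 0)) => [||x _|].
  - rewrite mul0r subr0 mul1r dbern0;
    have -> : (2^-1 : C) = (2^-1 : R)%:C by rewrite fmorphV rmorph_nat.
    by apply: complexP; rewrite ?ReM ?ImM ?ReN ?ImN /=; field.
  - exact: ltr01.
  - rewrite mulr0; apply: cder_eq;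
    first exact: (cderM (cderR (is_derive_id x 1)) (cder_cst (dbern 0) x)).
    by rewrite mulr0 addr0 mul1r.
  - by apply: hdes_quot_seq_cont => //; split; rewrite /= ?normr0 ?invr_ge0// lerN10.
have hcz : `|Im (c%:C * z)| <= 1 by apply/region_Im1/region_seg => //; rewrite c2 ltW.
rewrite -!exp_moment0E.
have q : (1 - c)%:C * z * hdes_quot c z = bern z - bern (c%:C * z).
  have ii := seq_cont_intble ler01 (hdes_quot_seq_cont hc hz).
  rewrite /hdes_quot -cintM// (@cint_FTC _ 0 1 (fun v => bern ((seg c v)%:C * z)))//.
  - have s1 : seg c 1 = 1 by rewrite /seg; ring.
    have s0 : seg c 0 = c by rewrite /seg; ring.
    by rewrite s1 s0 mul1r.
  - move=> v v01; rewrite mulrC.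
    apply: ((hol_phol bern_hol) (-1) 2 (2 * normc z + normc ((1 - c)%:C * z))
       (fun v => (seg c v)%:C * z) (fun=> (1 - c)%:C * z)); last first.
      by case/andP: v01 => h1 h2; rewrite (lt_le_trans _ h1)// (le_lt_trans h2)// ltr1n.
    move=> t /andP[t1 t2]; have st : `|seg c t| <= 2 by rewrite ler_norml /seg; apply/andP;
      split; nra.
    split.
    + apply: cder_eq.
        have d : is_derive t 1 (seg c) (1 - c).
          have c' k := is_derive_cst (k : R) t 1.
          have := is_deriveD_fun (c' c) (is_deriveM_fun (f := fun=> 1 - c)
            (g := fun y : R => y) (c' _) (is_derive_id t 1)).
          by move=> h; apply: (is_derive_eq h); ring.
        exact: (cderM (cderR d) (cder_cst z t)).
      by rewrite mulr0 addr0.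
    + rewrite /strip ImR normrM; have [i _] := hz.
      by apply: le_lt_trans (ler_pM _ _ st i) _ => //; lra.
    + rewrite normcM normcR ler_wpDr ?normc_ge0//.
      by rewrite ler_wpM2r ?normc_ge0.
    + by rewrite ler_wpDl// mulr_ge0 ?normc_ge0.
  - move=> u v uD vD uv; apply: ccvgM; first exact: ccvg_cst.
    exact: (hdes_quot_seq_cont hc hz uD vD uv).
apply: (mulfI z0); rewrite [RHS]mulrA [z * (1 - c)%:C]mulrC q /bern.
have n1 := exp_moment0_neq0 (region_Im1 hz); have n2 := exp_moment0_neq0 hcz.
have nc : c%:C != 0 :> C by rewrite eq_complex /= eqxx andbT gt_eqF.
by field; rewrite n1 n2 nc z0.
Qed.
End Gfun.

(** * Taylor coefficients as circle integrals *)

Section Coef.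
Variable R : realType.
Local Notation C := R[i].
Local Notation Re := (@complex.Re R).
Local Notation Im := (@complex.Im R).
Implicit Types (z w t : C) (x a : R) (F G : C -> C).
Variable e : R.
Hypothesis e0 : 0 < e.
Hypothesis e8 : e <= 8^-1.

Definition circ a : C := cexp (ln e +i* a).
Definition circ_negpow (n : nat) a : C := cexp (- n%:R * (ln e +i* a)).

(** Cauchy's formula for the n-th Taylor coefficient of F at t, on the circle of
    radius e. *)
Definition taylor_coef n F t : C :=
  ((2 * pi)^-1)%:C * cintegral `[0, 2 * pi] (fun a => F (t + circ a) * circ_negpow n a).

Lemma normc_circ a : normc (circ a) = e.
Proof. by rewrite normc_cexp /= lnK ?posrE. Qed.

Lemma normc_circ_negpow n a : normc (circ_negpow n a) = expR (- n%:R * ln e).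
Proof.
rewrite normc_cexp -[n%:R]/(n%:R : C) -(rmorph_nat (real_complex R)) -rmorphN.
by rewrite ReM /= mul0r subr0.
Qed.

Lemma circ_mul_negpow n a : circ a * circ_negpow n.+1 a = circ_negpow n a.
Proof. by rewrite /circ /circ_negpow -cexpD -natr1; congr cexp; ring. Qed.

Lemma circ_negpow0 a : circ_negpow 0 a = 1.
Proof. by rewrite /circ_negpow oppr0 mul0r cexp0. Qed.

Lemma cder_arc a : cder (fun a => ln e +i* a) a (0 +i* 1).
Proof. by split => /=; [exact: is_derive_cst|exact: is_derive_id]. Qed.

Lemma cder_circ a : cder circ a ((0 +i* 1) * circ a).
Proof. by apply: cder_eq; [exact: cder_cexp (cder_arc a)|rewrite mulrC]. Qed.

Lemma cder_circ_negpow n a : cder (circ_negpow n) a (- n%:R * (0 +i* 1) * circ_negpow n a).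
Proof.
apply: cder_eq; first exact: (cder_cexp (cderM (cder_cst (- n%:R) a) (cder_arc a))).
by rewrite mul0r add0r mulrC.
Qed.

Lemma seq_cont_circ' (D : set R) : seq_cont D circ.
Proof. by apply: cder_seq_cont => x _; exact: cder_circ. Qed.

Lemma seq_cont_circ_negpow n (D : set R) : seq_cont D (circ_negpow n).
Proof. by apply: cder_seq_cont => x _; exact: cder_circ_negpow. Qed.

Lemma circ_per : circ (2 * pi) = circ 0.
Proof.
rewrite /circ; have -> : ln e +i* (2 * pi) = (ln e +i* 0) + (0 +i* (2 * pi)).
  by apply: complexP; rewrite ?ReD ?ImD /= ?addr0 ?add0r.
by rewrite cexpD cexp_2pii mulr1.
Qed.

Lemma circ_negpowE n a : circ_negpow n a = ((circ a)^-1) ^+ n.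
Proof. by rewrite /circ_negpow /circ -cexpN -cexp_nat; congr cexp; ring. Qed.

Lemma circ_negpow_per n : circ_negpow n (2 * pi) = circ_negpow n 0.
Proof. by rewrite !circ_negpowE circ_per. Qed.

Lemma Im_circ x a : `|x| <= 2 -> `|Im (x%:C * circ a)| <= 4^-1.
Proof.
move=> x2; apply: le_trans (abs_Im _) _; rewrite normcM normcR normc_circ.
by apply: le_trans (ler_pM _ _ x2 e8) _ => //; rewrite ?(ltW e0)//; lra.
Qed.

Lemma strip_circ t x a : strip 4^-1 t -> `|x| <= 2 -> strip 2^-1 (t + x%:C * circ a).
Proof.
rewrite /strip ImD => st x2; apply: le_lt_trans (ler_normD _ _) _.
by have := Im_circ a x2; move: st; lra.
Qed.

Lemma strip_circ1 t a : strip 4^-1 t -> strip 2^-1 (t + circ a).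
Proof. by move=> st; have := @strip_circ t 1 a st; rewrite mul1r normr1 => -> //;
  rewrite ler1n. Qed.

Section OneFun.
Variables (F F' : C -> C).
Hypothesis hF : hol 2^-1 F F'.

Lemma strip_cont_circ G t x (D : set R) : strip_cont 2^-1 G -> strip 4^-1 t -> `|x| <= 2 ->
  seq_cont D (fun a => G (t + x%:C * circ a)).
Proof.
move=> cG st x2 u a uD aD ua; apply: cG; [by move=> n; exact: strip_circ|exact: strip_circ|].
apply: ccvgD; first exact: ccvg_cst.
by apply: ccvgM; [exact: ccvg_cst|exact: (seq_cont_circ' uD aD ua)].
Qed.

Lemma strip_cont_circ1 G t (D : set R) : strip_cont 2^-1 G -> strip 4^-1 t ->
  seq_cont D (fun a => G (t + circ a)).
Proof.
move=> cG st; have := @strip_cont_circ G t 1 D cG st; rewrite normr1 ler1n => /(_ isT).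
by congr seq_cont; apply/funext => a; rewrite mul1r.
Qed.

Lemma coef_seq_cont G n t (D : set R) : strip_cont 2^-1 G -> strip 4^-1 t ->
  seq_cont D (fun a => G (t + circ a) * circ_negpow n a).
Proof.
move=> cG st u a uD aD ua; apply: ccvgM; first exact: (strip_cont_circ1 cG st uD aD ua).
exact: (@seq_cont_circ_negpow n D u a uD aD ua).
Qed.

Lemma normc_circR x a : `|x| <= 2 -> normc (x%:C * circ a) <= 4^-1.
Proof.
move=> x2; rewrite normcM normcR normc_circ.
by apply: le_trans (ler_pM _ _ x2 e8) _ => //; rewrite ?(ltW e0)//; lra.
Qed.

Lemma cder_Fcirc t x a : strip 4^-1 t -> `|x| <= 2 ->
  cder (fun a => F (t + x%:C * circ a)) a (F' (t + x%:C * circ a) * (x%:C *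
    ((0 +i* 1) * circ a))).
Proof.
move=> st x2; apply: ((hol_phol hF) (a - 1) (a + 1) (normc t + 4^-1) (fun a => t + x%:C * circ a)
   (fun a => x%:C * ((0 +i* 1) * circ a))); last by rewrite gtrDl ltrDl ltr01 ltrN10.
move=> b _; split.
- apply: cder_eq; first exact: (cderD (cder_cst t b) (cderM (cder_cst x%:C b) (cder_circ b))).
  by rewrite mul0r !add0r.
- exact: strip_circ.
- by apply: le_trans (ler_normcD _ _) _; rewrite lerD2l normc_circR.
- rewrite mulrCA normcM normci normr1 mul1r.
  by apply: le_trans (normc_circR b x2) _; rewrite lerDr normc_ge0.
Qed.

(** Integrate the derivative of F (t + tau) tau^(- n - 1) around the circle. *)
Lemma taylor_coef_deriv n t : strip 4^-1 t -> taylor_coef n F' t = n.+1%:R * taylor_coef n.+1 F t.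
Proof.
move=> st; rewrite /taylor_coef [RHS]mulrCA; congr (_ * _).
have i1 : cintble `[0, 2 * pi] (fun a => F' (t + circ a) * circ_negpow n a).
  by apply: seq_cont_intble; [exact: pi2_ge0|apply: coef_seq_cont (hol_cont' hF) st].
have i2 : cintble `[0, 2 * pi] (fun a => F (t + circ a) * circ_negpow n.+1 a).
  by apply: seq_cont_intble; [exact: pi2_ge0|apply: coef_seq_cont (hol_cont hF) st].
have mD : measurable (`[0, 2 * pi] : set (measurableTypeR R)) by exact: measurable_itv.
have E : cintegral `[0, 2 * pi] (fun a => (0 +i* 1) * (F' (t + circ a) * circ_negpow n a)
     + (- n.+1%:R * (0 +i* 1)) * (F (t + circ a) * circ_negpow n.+1 a)) = 0.
  rewrite (@cint_FTC _ 0 (2 * pi) (fun a => F (t + circ a) * circ_negpow n.+1 a)).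
  - by rewrite circ_per circ_negpow_per subrr.
  - exact: pi2_gt0.
  - move=> a _; have := @cder_Fcirc t 1 a st; rewrite normr1 ler1n => /(_ isT) d.
    apply: cder_eq.
      apply: cderM (cder_circ_negpow n.+1 a); apply: cder_ext d => b; by rewrite mul1r.
    by rewrite !mul1r -(circ_mul_negpow n a); ring.
  - move=> u a uD aD ua; apply: ccvgD; apply: ccvgM; try exact: ccvg_cst.
    + exact: (@coef_seq_cont F' n t _ (hol_cont' hF) st u a uD aD ua).
    + exact: (@coef_seq_cont F n.+1 t _ (hol_cont hF) st u a uD aD ua).
move: E; rewrite cintD//; last 2 first.
- apply: seq_cont_intble; first exact: pi2_ge0.
  move=> u a uD aD ua; apply: ccvgM; first exact: ccvg_cst.
  exact: (@coef_seq_cont F' n t _ (hol_cont' hF) st u a uD aD ua).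
- apply: seq_cont_intble; first exact: pi2_ge0.
  move=> u a uD aD ua; apply: ccvgM; first exact: ccvg_cst.
  exact: (@coef_seq_cont F n.+1 t _ (hol_cont hF) st u a uD aD ua).
rewrite (cintM _ mD i1) (cintM _ mD i2).
set X := cintegral _ _; set Y := cintegral _ _ => E.
have i0 : (0 +i* 1 : C) != 0 by rewrite eq_complex /= oner_eq0 andbF.
by apply: (mulfI i0); apply/eqP; rewrite -subr_eq0 -[X in _ == X]E; apply/eqP; ring.
Qed.

(** Differentiate under the integral sign, then use [taylor_coef_deriv]. *)
Lemma taylor_coef_path_hol n : path_hol 4^-1 (taylor_coef n F)
  (fun t => n.+1%:R * taylor_coef n.+1 F t).
Proof.
move=> u v M gam gam' hp x xuv.
have [_ sx _ _] := hp x xuv; rewrite -taylor_coef_deriv// /taylor_coef.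
have mD : measurable (`[0, 2 * pi] : set (measurableTypeR R)) by exact: measurable_itv.
have [K hK] := hol_lbd' hF (M + 4^-1).
have nc1 a : normc (circ a) <= 4^-1 by rewrite normc_circ
  (le_trans e8)// lef_pV2 ?posrE// ler_nat.
have d : cder (fun x => cintegral `[0, 2 * pi] (fun a => F (gam x + circ a) * circ_negpow n a)) x
   (cintegral `[0, 2 * pi] (fun a => gam' x * (F' (gam x + circ a) * circ_negpow n a))).
  apply: (@cder_under_int _ 0 (2 * pi) u v (M * (K * expR (- n%:R * ln e))) x
     (fun x a => F (gam x + circ a) * circ_negpow n a)
     (fun x a => gam' x * (F' (gam x + circ a) * circ_negpow n a))).
  - exact: pi2_ge0.
  - exact: xuv.
  - by move=> y yuv; have [_ sy _ _] := hp y yuv; exact: coef_seq_cont (hol_cont hF) sy.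
  - move=> y a yuv _; have H : cder (fun y => F (gam y + circ a)) y (F'
    (gam y + circ a) * gam' y).
      apply: ((hol_phol hF) u v (M + 4^-1) (fun y => gam y + circ a) gam') => // b buv.
      have [d s n1 n2] := hp b buv; split.
      + by apply: cder_eq; [exact: (cderD d (cder_cst _ _))|rewrite addr0].
      + exact: strip_circ1.
      + by apply: le_trans (ler_normcD _ _) _; rewrite lerD.
      + by rewrite (le_trans n2)// lerDl.
    by apply: cder_eq; [exact: (cderM H (cder_cst _ _))|rewrite mulr0 addr0 mulrAC mulrC].
  - move=> y a yuv _; have [_ s n1 n2] := hp y yuv.
    rewrite normcM [normc (_ * circ_negpow _ _)]normcM normc_circ_negpow; apply: ler_pM;
      rewrite ?mulr_ge0 ?normc_ge0 ?expR_ge0//.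
    rewrite ler_wpM2r ?expR_ge0// hK//; first exact: strip_circ1.
    by apply: le_trans (ler_normcD _ _) _; rewrite lerD.
apply: cder_eq; first exact: (cderM (cder_cst _ x) d).
rewrite mul0r add0r (cintM _ mD); first by ring.
by apply: seq_cont_intble; [exact: pi2_ge0|apply: coef_seq_cont (hol_cont' hF) sx].
Qed.

(** Mean value property: the mean of F over the circle of radius rho e has
    derivative 0 in rho, because that derivative is itself the integral of a
    derivative around the circle. *)
Lemma taylor_coef0 t : strip 4^-1 t -> taylor_coef 0 F t = F t.
Proof.
move=> st; pose Phi x := cintegral `[0, 2 * pi] (fun a => F (t + x%:C * circ a)).
have mD : measurable (`[0, 2 * pi] : set (measurableTypeR R)) by exact: measurable_itv.
have [K hK] := hol_lbd' hF (normc t + 4^-1).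
have b2 x : -1 < x < 2 -> `|x| <= 2.
  by move=> /andP[h1 h2]; rewrite ler_norml; apply/andP; split; lra.
pose Psi x := cintegral `[0, 2 * pi] (fun a => F' (t + x%:C * circ a) * circ a).
have sPsi x (D : set R) : `|x| <= 2 -> seq_cont D (fun a => F' (t + x%:C * circ a) * circ a).
  move=> x2 u a uD aD ua; apply: ccvgM; last exact: (seq_cont_circ' uD aD ua).
  exact: (strip_cont_circ (hol_cont' hF) st x2 uD aD ua).
have d x : 0 <= x <= 1 -> cder Phi x (Psi x).
  move=> /andP[x0 x1]; apply: (@cder_under_int _ 0 (2 * pi) (-1) 2 (K * 4^-1) x
     (fun x a => F (t + x%:C * circ a)) (fun x a => F' (t + x%:C * circ a) * circ a)).
  - exact: pi2_ge0.
  - by apply/andP; split; lra.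
  - by move=> y /b2 y2; exact: strip_cont_circ (hol_cont hF) st y2.
  - move=> y a yuv _.
    apply: ((hol_phol hF) (-1) 2 (normc t + 4^-1) (fun y => t + y%:C * circ a)
      (fun=> circ a)) => // b /b2 b2'.
    split.
    + apply: cder_eq; first exact: (cderD (cder_cst t b) (cderM (cderR (is_derive_id b 1))
      (cder_cst (circ a) b))).
      by rewrite mulr0 add0r addr0 mul1r.
    + exact: strip_circ.
    + by apply: le_trans (ler_normcD _ _) _; rewrite lerD2l normc_circR.
    + by rewrite normc_circ (le_trans e8)// ler_wpDl ?normc_ge0// lef_pV2 ?posrE// ler_nat.
  - move=> y a /b2 y2 _; rewrite normcM normc_circ; apply: ler_pM; rewrite ?normc_ge0 ?(ltW e0)//.
      apply: hK; first exact: strip_circ.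
      by apply: le_trans (ler_normcD _ _) _; rewrite lerD2l normc_circR.
    by rewrite (le_trans e8)// lef_pV2 ?posrE// ler_nat.
have i0 : (0 +i* 1 : C) != 0 by rewrite eq_complex /= oner_eq0 andbF.
(* For x != 0, i x Psi x is the integral of a derivative around the circle; at
   x = 0 the first factor is the constant F' t, and the circle integrates to 0. *)
have Psi0 x : 0 <= x <= 1 -> Psi x = 0.
  move=> /andP[x0 x1]; have x2 : `|x| <= 2 by apply: b2; apply/andP; split; lra.
  have ii := seq_cont_intble (pi2_ge0 R) (@sPsi x `[0, 2 * pi] x2).
  case: (eqVneq x 0) => [xz|xn0].
    have H : (0 +i* 1) * cintegral `[0, 2 * pi] circ = 0.
      rewrite -(cintM _ mD); last by apply: seq_cont_intble;
        [exact: pi2_ge0|exact: seq_cont_circ'].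
      rewrite (@cint_FTC _ 0 (2 * pi) circ).
      - by rewrite circ_per subrr.
      - exact: pi2_gt0.
      - by move=> a _; exact: cder_circ.
      - move=> u a uD aD ua; apply: ccvgM; first exact: ccvg_cst.
        exact: (seq_cont_circ' uD aD ua).
    have {}H : cintegral `[0, 2 * pi] circ = 0.
      by apply: (mulfI i0); rewrite H mulr0.
    rewrite /Psi xz; have -> : (fun a => F' (t + (0 : R)%:C * circ a) * circ a) =
      (fun a => F' t * circ a).
      by apply/funext => a; rewrite mul0r addr0.
    rewrite (cintM _ mD) ?H ?mulr0//.
    by apply: seq_cont_intble; [exact: pi2_ge0|exact: seq_cont_circ'].
  have H : (x%:C * (0 +i* 1)) * Psi x = 0.
    rewrite /Psi -(cintM _ mD ii) (@cint_FTC _ 0 (2 * pi) (fun a => F (t + x%:C * circ a))).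
    - by rewrite circ_per subrr.
    - exact: pi2_gt0.
    - by move=> a _; apply: cder_eq; [exact: cder_Fcirc|ring].
    - move=> u a uD aD ua; apply: ccvgM; first exact: ccvg_cst.
      exact: (sPsi x _ x2 u a uD aD ua).
  have xi0 : x%:C * (0 +i* 1) != 0 :> C by rewrite mulf_neq0// eq_complex /= eqxx andbT.
  by apply: (mulfI xi0); rewrite H mulr0.
have E : Phi 1 - Phi 0 = 0.
  rewrite -(@cint_FTC _ 0 1 Phi (fun=> 0)).
  - rewrite (@cint_FTC _ 0 1 (fun=> 0) (fun=> 0)) ?subrr//.
      by move=> x _; exact: cder_cst.
    by move=> *; exact: ccvg_cst.
  - exact: ltr01.
  - by move=> x hx; rewrite -(Psi0 x hx); exact: d.
  - by move=> *; exact: ccvg_cst.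
have P0 : Phi 0 = (2 * pi)%:C * F t.
  rewrite /Phi; have -> : (fun a => F (t + (0 : R)%:C * circ a)) = (fun a => F t).
    by apply/funext => a; rewrite mul0r addr0.
  rewrite (@cint_FTC _ 0 (2 * pi) (fun a => a%:C * F t)).
  - by rewrite mul0r subr0.
  - exact: pi2_gt0.
  - move=> a _; apply: cder_eq; first exact: (cderM (cderR (is_derive_id a 1)) (cder_cst
    (F t) a)).
    by rewrite mulr0 addr0 mul1r.
  - by move=> *; exact: ccvg_cst.
have P1 : Phi 1 = cintegral `[0, 2 * pi] (fun a => F (t + circ a) * circ_negpow 0 a).
  by apply: cint_ext => a _; rewrite mul1r circ_negpow0 mulr1.
rewrite /taylor_coef -P1; move/eqP: E; rewrite subr_eq0 => /eqP ->; rewrite P0 mulrA.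
by rewrite -rmorphM /= mulVf ?mul1r// gt_eqF// pi2_gt0.
Qed.
End OneFun.
End Coef.

(** * Product rule and residue at the origin *)

Section Leibniz.
Variable R : realType.
Local Notation C := R[i].
Local Notation Re := (@complex.Re R).
Local Notation Im := (@complex.Im R).
Implicit Types (z w t : C) (x a : R) (F G : C -> C).

Lemma cder_sum (phi : nat -> R -> C) (d : nat -> C) x n :
  (forall i, cder (phi i) x (d i)) ->
  cder (fun y => \sum_(i < n) phi i y) x (\sum_(i < n) d i).
Proof.
move=> h; elim: n => [|n IH].
  by rewrite big_ord0; apply: cder_ext (cder_cst 0 x) => y; rewrite big_ord0.
rewrite big_ord_recr /=; apply: cder_ext (cderD IH (h n)) => y.
by rewrite big_ord_recr.
Qed.

Lemma cder_unique (phi psi : R -> C) (u v x : R) (d d' : C) : u < x < v ->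
  (forall y, u < y < v -> phi y = psi y) -> cder phi x d -> cder psi x d' -> d = d'.
Proof.
move=> xuv E [a b] [a' b'].
have nE : \forall y \near x, phi y = psi y.
  have xI : x \in (`]u, v[%R : interval R) by rewrite in_itv.
  by apply: filterS (near_in_itvoo xI) => y; rewrite in_itv; exact: E.
apply: complexP.
- rewrite -(@derive_val _ _ _ _ _ _ _ a') -(@derive_val _ _ _ _ _ _ _ a).
  by apply: near_eq_derive; apply: filterS nE => y ->.
- rewrite -(@derive_val _ _ _ _ _ _ _ b') -(@derive_val _ _ _ _ _ _ _ b).
  by apply: near_eq_derive; apply: filterS nE => y ->.
Qed.

Lemma sum_leibniz (A B : nat -> C) k :
  \sum_(i < k.+1) (i.+1%:R * A i.+1 * B (k - i)%N + A i * ((k - i).+1%:R * B (k - i).+1)) =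
  k.+1%:R * \sum_(i < k.+2) A i * B (k.+1 - i)%N.
Proof.
rewrite big_split /=.
have -> : \sum_(i < k.+1) i.+1%:R * A i.+1 * B (k - i)%N =
   \sum_(i < k.+2) i%:R * (A i * B (k.+1 - i)%N).
  rewrite [RHS]big_ord_recl /= mul0r add0r; apply: eq_bigr => i _.
  by rewrite /bump /= add1n subSS mulrA.
have -> : \sum_(i < k.+1) A i * ((k - i).+1%:R * B (k - i).+1) =
   \sum_(i < k.+2) (k.+1 - i)%:R * (A i * B (k.+1 - i)%N).
  rewrite [RHS]big_ord_recr /= subnn mul0r addr0; apply: eq_bigr => i _.
  have ik : (i <= k)%N by rewrite -ltnS ltn_ord.
  by rewrite subSn// mulrCA.
rewrite -big_split mulr_sumr; apply: eq_bigr => i _ /=.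
have ik : (i <= k.+1)%N by rewrite -ltnS ltn_ord.
by rewrite -mulrDl -natrD subnKC.
Qed.

Variable e : R.
Hypothesis e0 : 0 < e.
Hypothesis e8 : e <= 8^-1.
Local Notation taylor_coef := (taylor_coef e).

Lemma line_bpath x : -1 < x < 1 -> bpath 4^-1 (-1) 1 1 (fun y => y%:C : C) (fun=> 1).
Proof.
move=> _ y /andP[y1 y2]; split.
- exact: cderR (is_derive_id y 1).
- by rewrite /strip /= normr0 invr_gt0.
- by rewrite normcR ler_norml; apply/andP; split; lra.
- by rewrite normc_1.
Qed.

Lemma lin_strip x : strip 4^-1 (x%:C : C).
Proof. by rewrite /strip /= normr0 invr_gt0. Qed.

(** By induction on k on a real neighbourhood of 0: if both sides agree there for
    k, so do their derivatives, which are k + 1 times the two sides for k + 1. *)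
Lemma taylor_coefM_line F F' G G' k : hol 2^-1 F F' -> hol 2^-1 G G' -> forall x, -1 < x < 1 ->
  taylor_coef k (fun z => F z * G z) x%:C = \sum_(i < k.+1) taylor_coef i F x%:C * taylor_coef
    (k - i) G x%:C.
Proof.
move=> hF hG; have hFG := hol_mul hF hG.
elim: k => [|k IH] x hx.
  by rewrite big_ord1 subn0 (taylor_coef0 e0 e8 hFG) ?(taylor_coef0 e0 e8 hF) ?(taylor_coef0 e0
    e8 hG)//; exact: lin_strip.
have d1 := taylor_coef_path_hol e0 e8 hFG k (line_bpath hx) hx.
have d2 : cder (fun x => \sum_(i < k.+1) taylor_coef i F x%:C * taylor_coef (k - i) G x%:C) x
   (k.+1%:R * \sum_(i < k.+2) taylor_coef i F x%:C * taylor_coef (k.+1 - i) G x%:C).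
  rewrite -(sum_leibniz (fun i => taylor_coef i F x%:C) (fun i => taylor_coef i G x%:C)).
  apply: (@cder_sum (fun i x => taylor_coef i F x%:C * taylor_coef (k - i) G x%:C)
    (fun i => i.+1%:R * taylor_coef i.+1 F x%:C * taylor_coef (k - i) G x%:C +
      taylor_coef i F x%:C * ((k - i).+1%:R * taylor_coef (k - i).+1 G x%:C))) => i.
  apply: cder_eq; first exact: (cderM (taylor_coef_path_hol e0 e8 hF i (line_bpath hx) hx)
    (taylor_coef_path_hol e0 e8 hG (k - i) (line_bpath hx) hx)).
  by rewrite /= !mulr1.
have k0 : (k.+1%:R : C) != 0 by rewrite pnatr_eq0.
apply: (mulfI k0); rewrite -(cder_unique hx IH d1 d2) /= mulr1//.
Qed.

Lemma taylor_coefM F F' G G' k : hol 2^-1 F F' -> hol 2^-1 G G' ->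
  taylor_coef k (fun z => F z * G z) 0 = \sum_(i < k.+1) taylor_coef i F 0 * taylor_coef
    (k - i) G 0.
Proof. by move=> hF hG; apply: (taylor_coefM_line k hF hG); rewrite ltr01 ltrN10. Qed.

(** For the integral exponent - k - 1 the integrand takes the same values on the
    two sides of the axis, so only the circle contributes. *)
Lemma hankel_residue F k : strip_cont 2^-1 F ->
  hankel e (fun w => F (cexp w) * cexp ((- k%:R - 1) * w)) = (0 +i* (2 * pi)) * taylor_coef k F 0.
Proof.
move=> cF; rewrite hankelE /Jtop /Jbot /Jcirc.
have E x : 0 < x -> cexp ((- k%:R - 1) * (ln x +i* (2 * pi))) = cexp ((- k%:R - 1) *
  (ln x)%:C) :> C.
  move=> x0; have -> : (- k%:R - 1) * (ln x +i* (2 * pi)) =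
      (- k%:R - 1) * (ln x)%:C - (k.+1)%:R * (0 +i* (2 * pi)) :> C.
    have -> : ln x +i* (2 * pi) = (ln x)%:C + (0 +i* (2 * pi)).
      by apply: complexP; rewrite ?ReD ?ImD /= ?addr0 ?add0r.
    by rewrite -natr1; ring.
  by rewrite cexpD cexpN cexp_nat cexp_2pii expr1n invr1 mulr1.
rewrite addrAC; have -> : cintegral `[e, +oo[ (fun x => F (cexp (ln x +i* (2 * pi))) * cexp
  ((- k%:R - 1) * (ln x +i* (2 * pi))) * 1)
   = cintegral `[e, +oo[ (fun x => F (cexp (ln x)%:C) * cexp ((- k%:R - 1) * (ln x)%:C) * 1).
  apply: cint_ext => x; rewrite /= in_itv /= andbT => ex.
  have x0 : 0 < x by exact: lt_le_trans ex.
  by rewrite E// cexp_ln2pi// cexp_ln.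
rewrite addNr add0r /taylor_coef mulrA.
have -> : (0 +i* (2 * pi)) * ((2 * pi)^-1)%:C = (0 +i* 1) :> C.
  apply: complexP; rewrite ?ReM ?ImM /= ?mul0r ?mulr0 ?subr0 ?addr0 ?add0r//.
  by rewrite divff// gt_eqF// pi2_gt0.
have st0 : strip 4^-1 (0 : C) by exact: (lin_strip 0).
rewrite -cintM; last 2 first.
- exact: measurable_itv.
- apply: seq_cont_intble; [exact: pi2_ge0|exact: (coef_seq_cont e0 e8 _ cF st0)].
apply: cint_ext => a _; rewrite add0r /circ /circ_negpow.
have -> : (- k%:R - 1) * (ln e +i* a) = - k%:R * (ln e +i* a) - (ln e +i* a) :> C by ring.
rewrite cexpD cexpN; have := cexp_neq0 (ln e +i* a : C).
set X := cexp (ln e +i* a) => X0; field.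
exact: X0.
Qed.
End Leibniz.

(** * Integration by parts along the Hankel contour *)

Section ContourParts.
Variable R : realType.
Local Notation C := R[i].
Local Notation Re := (@complex.Re R).
Local Notation Im := (@complex.Im R).
Implicit Types (z w t s : C) (x a : R).
Variable e : R.
Hypothesis e0 : 0 < e.
Hypothesis e8 : e <= 8^-1.
Local Notation taylor_coef := (taylor_coef e).
Variables (F F' : C -> C).
Hypothesis hF : hol 2^-1 F F'.
Hypothesis aF : forall i s, exists2 M, 0 <= M &
  adm1 e M (fun w => taylor_coef i F (cexp w) * cexp (s * w)).

Lemma contour_strip w : contour e w -> strip 4^-1 (cexp w).
Proof. by case=> h _ _ _; rewrite /strip (le_lt_trans h)//
  (le_lt_trans e8)// ltf_pV2 ?posrE// ltr_nat. Qed.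

Lemma cexp_axis x y : 0 < x -> (y = 0 \/ y = 2 * pi) -> cexp (ln x +i* y) = x%:C.
Proof. by move=> x0 [->|->]; [exact: cexp_ln|exact: cexp_ln2pi]. Qed.

Lemma cder_axis x y : 0 < x -> cder (fun x => ln x +i* y) x (x^-1)%:C.
Proof. by move=> x0; split => /=; [exact: is_derive1_ln|exact: is_derive_cst]. Qed.

(** Apply [hankel_exact] to the i-th coefficient of F at t times t^s. *)
Lemma parts i s :
  i.+1%:R * hankel e (fun w => taylor_coef i.+1 F (cexp w) * cexp (s * w)) =
  - s * hankel e (fun w => taylor_coef i F (cexp w) * cexp ((s - 1) * w)).
Proof.
have [M0 m0 a0] := aF i s; have [M1 m1 a1] := aF i.+1 s; have [M2 m2 a2] := aF i (s - 1).
have z0 : adm1 e 0 (fun=> 0).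
  by split; [move=> w _; rewrite normc_0 mul0r|move=> *; exact: ccvg_cst].
have a2s := adm1_lin s a2 z0.
have a12 := adm1_lin i.+1%:R a1 a2s.
have pos2 : 0 <= normc s * M2 + 0 by rewrite addr0 mulr_ge0 ?normc_ge0.
have pos12 : 0 <= normc (i.+1%:R : C) * M1 + (normc s * M2 + 0).
  by rewrite addr_ge0// mulr_ge0 ?normc_ge0.
have L1 := hankel_lin e0 i.+1%:R m1 pos2 a1 a2s.
have L2 := hankel_lin e0 s m2 (lexx 0) a2 z0.
have L3 : hankel e (fun=> 0) = 0.
  have := hankel_lin e0 (-1) (lexx 0) (lexx 0) z0 z0.
  have E0 (z : C) : -1 * z + z = 0 by rewrite mulN1r addNr.
  rewrite [RHS]E0 => hE; rewrite -[RHS]hE; congr hankel; apply/funext => l;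
    by rewrite mulr0 addr0.
have cder_s (W : R -> C) x (d : C) : cder W x d ->
   cder (fun x => cexp (s * W x)) x (s * cexp ((s - 1) * W x) * (cexp (W x) * d)).
  move=> dW; apply: cder_eq; first exact: (cder_cexp (cderM (cder_cst s x) dW)).
  rewrite mul0r add0r (_ : (s - 1) * W x = s * W x - W x); last by ring.
  rewrite cexpD cexpN; have := cexp_neq0 (W x); set X := cexp (W x) => X0; field.
  exact: X0.
have H : hankel e (fun w => i.+1%:R * (taylor_coef i.+1 F (cexp w) * cexp (s * w)) +
     (s * (taylor_coef i F (cexp w) * cexp ((s - 1) * w)) + 0)) = 0.
  apply: (@hankel_exact _ e e0 (M0 + (normc (i.+1%:R : C) * M1 + (normc s * M2 + 0)))
    (fun w => taylor_coef i F (cexp w) * cexp (s * w))).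
  - exact: addr_ge0.
  - case: a12 => b c; split => // w cw; apply: le_trans (b w cw) _.
    by rewrite ler_wpM2r ?weight_ge0// lerDr.
  - move=> w cw; case: a0 => b _; apply: le_trans (b w cw) _.
    by rewrite ler_wpM2r ?weight_ge0// lerDl.
  - move=> x y ex hy; have x0 : 0 < x by exact: lt_le_trans ex.
    have e2 : 0 < e / 2 by rewrite divr_gt0.
    have p : cder (fun x => taylor_coef i F (cexp (ln x +i* y))) x
       (i.+1%:R * taylor_coef i.+1 F (cexp (ln x +i* y)) * (cexp (ln x +i* y) * (x^-1)%:C)).
      apply: (taylor_coef_path_hol e0 e8 hF i (u := e / 2) (v := x + 1) (M := x + 2)
        (gam := fun x => cexp (ln x +i* y)) (gam' := fun x => cexp (ln x +i* y) * (x^-1)%:C)).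
        move=> t /andP[t1 t2]; have t0 : 0 < t by exact: lt_trans t1.
        split.
        + exact: cder_cexp (cder_axis y t0).
        + by rewrite cexp_axis// /strip /= normr0 invr_gt0.
        + by rewrite cexp_axis// normcR gtr0_norm//; lra.
        + rewrite cexp_axis// -rmorphM /= divff ?gt_eqF// normc_1; lra.
      by apply/andP; split; lra.
    apply: cder_eq; first exact: (cderM p (cder_s _ _ _ (cder_axis y x0))).
    have X1 : cexp (ln x +i* y) * (x^-1)%:C = 1 :> C.
      by rewrite cexp_axis// -rmorphM /= divff ?gt_eqF.
    by rewrite X1; ring.
  - move=> x hx; have p : cder (fun x => taylor_coef i F (cexp (ln e +i* x))) x
       (i.+1%:R * taylor_coef i.+1 F (cexp (ln e +i* x)) * (cexp (ln e +i* x) * (0 +i* 1))).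
      apply: (taylor_coef_path_hol e0 e8 hF i (u := x - 1) (v := x + 1) (M := 1)
        (gam := fun x => cexp (ln e +i* x)) (gam' := fun x => cexp (ln e +i* x) * (0 +i* 1))).
        move=> t _; have nt := normc_circ e0 t; have e1 : e <= 1 by move: e8; lra.
        split.
        + exact: cder_cexp (cder_arc e t).
        + rewrite /strip (le_lt_trans (abs_Im _))// nt (le_lt_trans e8)//.
          by rewrite ltf_pV2 ?posrE// ltr_nat.
        + by rewrite nt.
        + by rewrite normcM normci normr1 mulr1 nt.
      by apply/andP; split; lra.
    apply: cder_eq; first exact: (cderM p (cder_s _ _ _ (cder_arc e x))).
    by cbv beta; ring.
move: H; rewrite L1 L2 L3 addr0 => /eqP; rewrite addr_eq0 => /eqP ->.
by rewrite mulNr.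
Qed.

Lemma parts_iter i s :
  i`!%:R * hankel e (fun w => taylor_coef i F (cexp w) * cexp (s * w)) =
  (-1) ^+ i * (\prod_(q < i) (s - q%:R)) * hankel e (fun w => F (cexp w) * cexp ((s - i%:R) * w)).
Proof.
elim: i s => [|i IH] s.
  rewrite big_ord0 fact0 expr0 !mul1r; apply: (hankel_ext e0) => w cw.
  by rewrite (taylor_coef0 e0 e8 hF) ?subr0//; exact: contour_strip.
rewrite factS natrM -[LHS]mulrA [LHS]mulrCA parts [LHS]mulrCA IH big_ord_recl subr0.
have -> : \prod_(i0 < i) (s - (lift ord0 i0)%:R) = \prod_(q < i) (s - 1 - q%:R) :> C.
  by apply: eq_bigr => q _; rewrite /= /bump /= add1n -natr1; ring.
rewrite exprS (_ : s - 1 - i%:R = s - i.+1%:R); last by rewrite -natr1; ring.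
by ring.
Qed.
End ContourParts.

(** * Bounds and continuity of the integrand *)

Section Integrand.
Variable R : realType.
Local Notation C := R[i].
Local Notation Re := (@complex.Re R).
Local Notation Im := (@complex.Im R).
Implicit Types (z w t : C) (x a : R) (l : seq C) (q : C -> C).
Variable e : R.
Hypothesis e0 : 0 < e.
Hypothesis e8 : e <= 8^-1.
Local Notation contour := (contour e).
Local Notation pts := (pts e).
Local Notation adm := (adm e).

Definition exp_sum l : C := \sum_(w <- l) cexp w.

(** The product of q (t + t_j + ... + t_n) over j. The shift t is the slot into
    which the next variable goes, see [kernel_prod_rcons]. *)
Fixpoint kernel_prod q t l : C := if l is w :: l' then q
  (t + exp_sum l) * kernel_prod q t l' else 1.
Definition power_prod (s : nat -> C) n l : C := \prod_(k < n) cexp ((s k - 1) * nth 0 l k).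

Lemma exp_sum_cons w l : exp_sum (w :: l) = cexp w + exp_sum l.
Proof. by rewrite /exp_sum big_cons. Qed.

Lemma exp_sum_rcons w l : exp_sum (rcons l w) = exp_sum l + cexp w.
Proof. by rewrite /exp_sum -cats1 big_cat /= big_seq1. Qed.

Lemma kernel_prod_rcons q t l w : kernel_prod q t (rcons l w) = kernel_prod q
  (t + cexp w) l * q (t + cexp w).
Proof.
elim: l => [|v l IH]; first by rewrite /= exp_sum_cons /exp_sum big_nil addr0 mul1r mulr1.
rewrite [LHS]/= IH /= !exp_sum_cons exp_sum_rcons mulrA; congr (q _ * _ * _); ring.
Qed.

Lemma power_prod_rcons s n l w : size l = n -> power_prod s n.+1
  (rcons l w) = power_prod s n l * cexp ((s n - 1) * w).
Proof.
move=> sl; rewrite /power_prod big_ord_recr /= nth_rcons sl ltnn eqxx; congr (_ * _).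
by apply: eq_bigr => k _; rewrite nth_rcons sl ltn_ord.
Qed.

Lemma pts_behead n l : pts n.+1 l -> [/\ l = nth 0 l 0 :: behead l, contour
  (nth 0 l 0) & pts n (behead l)].
Proof.
case: l => [[]//|w l [sl cl]]; split => //; first exact: (cl 0).
by split; [case: sl|move=> k kn; exact: (cl k.+1)].
Qed.

Lemma contour_Re w : contour w -> - e <= Re (cexp w).
Proof.
case=> _ h _ h'; apply: le_trans h.
by rewrite -lerBlDr opprK; move: h'; rewrite -ler_expR lnK ?posrE//; lra.
Qed.

Lemma exp_sum_bd n l : pts n l -> `|Im (exp_sum l)| <= n%:R * e /\ - (n%:R * e) <= Re (exp_sum l).
Proof.
elim: n l => [|n IH] l; first by case=> /size0nil -> _;
  rewrite /exp_sum big_nil /= normr0 mul0r oppr0.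
move=> /pts_behead[-> cw /IH[i r]]; rewrite exp_sum_cons ImD ReD -natr1 mulrDl mul1r; split.
  by apply: le_trans (ler_normD _ _) _; rewrite addrC lerD//; case: cw.
by have := contour_Re cw; lra.
Qed.

Lemma region_tsum n l t : n.+1%:R * e <= 4^-1 -> normc t <= e -> pts n l -> region
  (t + exp_sum l).
Proof.
move=> ne te /exp_sum_bd[i r]; move: ne; rewrite -natr1 mulrDl mul1r => ne.
have := abs_Im t; have := abs_Re t; rewrite /region ImD ReD => h1 h2; split.
  by apply: le_trans (ler_normD _ _) _; lra.
by have := ler_norm (- Re t); rewrite normrN; lra.
Qed.

Definition expR1 : R := expR 1.
Lemma expR1_ge0 : 0 <= expR1. Proof. exact: expR_ge0. Qed.

(** The factor with all the variables provides the decay; the others are bounded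
    since the partial sums have real part at least - n e. *)
Lemma kernel_prod_le n q l t : kernel_ok q -> n.+1%:R * e <= 4^-1 -> normc t <= e -> pts n l ->
  normc (kernel_prod q t l) <= (kernel_bd R * expR1) ^+ n * expR (- (Re (exp_sum l) / 4)).
Proof.
move=> [bq cq]; elim: n l => [|n IH] l ne te.
  by case=> /size0nil -> _; rewrite /= /exp_sum big_nil /= mul0r oppr0 expR0 mulr1 expr0 normc_1.
have ne' : n.+1%:R * e <= 4^-1 by apply: le_trans ne; rewrite ler_wpM2r ?(ltW e0)// ler_nat.
move=> hl; have hr := region_tsum ne te hl; have [El cw hb] := pts_behead hl.
have := IH _ ne' te hb; have [_ r] := exp_sum_bd hb; move: hr.
rewrite El; set w := nth _ _ _; set l' := behead _ => hr H.
rewrite [kernel_prod _ _ _]/= normcM exprS.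
apply: le_trans (ler_pM _ _ (bq _ hr) H) _; rewrite ?normc_ge0//.
set X := expR _; set Y := expR _; set Z := expR _; set B := _ ^+ n.
have XY : X * Y <= expR1 * Z.
  rewrite -!expRD ler_expR ReD; have := abs_Re t.
  have := ler_norm (- Re t); rewrite normrN.
  move: ne'; rewrite -natr1 mulrDl mul1r; move: (Re (exp_sum (w :: l'))) => T; move: e8; lra.
have -> : kernel_bd R * X * (B * Y) = kernel_bd R * B * (X * Y) by ring.
have -> : kernel_bd R * expR1 * B * Z = kernel_bd R * B * (expR1 * Z) by ring.
by rewrite ler_wpM2l// mulr_ge0 ?kernel_bd_ge0// exprn_ge0// mulr_ge0 ?kernel_bd_ge0 ?expR1_ge0.
Qed.

Definition decay l : R := \prod_(w <- l) expR (- (expR (Re w) / 4)).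
Lemma expo_le n l : pts n l -> expR (- (Re (exp_sum l) / 4)) <= expR1 ^+ n * decay l.
Proof.
elim: n l => [|n IH] l.
  by case=> /size0nil -> _; rewrite /decay /exp_sum !big_nil /= mul0r oppr0 expR0 mulr1.
move=> /pts_behead[-> cw /IH]; set w := nth _ _ _; set l' := behead _ => H.
rewrite /decay big_cons -/(decay l') exp_sum_cons ReD mulrDl opprD expRD exprS mulrACA.
apply: ler_pM; rewrite ?expR_ge0// -expRD ler_expR.
by case: cw => _ h _ _; move: e8 h; rewrite -/w; lra.
Qed.

Definition abs_lne : R := `|ln e|.
Definition power_bd (N : R) : R := expR (N * (2 * abs_lne + 2 * pi) + N * ln (8 * N)).

(** The power of t is absorbed by half of the exponential: with X = exp (Re w),
    the inequality 1 + u <= exp u at u = Re w - log (8 N) bounds N Re w - X / 8. *)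
Lemma power_weight_le (N : R) (s w : C) : 1 <= N -> `|Re s - 1| <= N -> `|Im s| <= N -> contour
  w ->
  normc (cexp ((s - 1) * w)) * expR (- (expR (Re w) / 4)) <= power_bd N * weight w.
Proof.
move=> N1 hr hi [_ _ /andP[i0 i1] le]; rewrite normc_cexp ReM ReD ImD ReN ImN /= oppr0 addr0.
rewrite /power_bd /weight -!expRD ler_expR.
have N0 : 0 < N by exact: lt_le_trans N1.
have h1 := expR_ge1Dx (Re w - ln (8 * N)).
rewrite expRD expRN lnK ?posrE ?mulr_gt0// in h1.
have {h1} h1 : (8 * N) * (1 + (Re w - ln (8 * N))) <= expR (Re w).
  by rewrite mulrC -ler_pdivlMr ?mulr_gt0.
have lamE : - abs_lne <= ln e by rewrite lerNl /abs_lne -normrN ler_norm.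
have l0 : 0 <= abs_lne by exact: normr_ge0.
have absw : `|Re w| <= Re w + 2 * abs_lne.
  by rewrite ler_norml; apply/andP; split; lra.
have t1 : (Re s - 1) * Re w <= N * (Re w + 2 * abs_lne).
  apply: le_trans (ler_norm _) _; rewrite normrM; exact: ler_pM.
have t2 : - (Im s * Im w) <= N * (2 * pi).
  apply: le_trans (ler_norm _) _; rewrite normrN normrM; apply: ler_pM => //.
  by rewrite ger0_norm.
move: (ln (8 * N)) h1 => LN h1; move: (expR (Re w)) h1 => X h1.
have : N * (1 + (Re w - LN)) <= X / 8 by move: h1; lra.
lra.
Qed.

Definition exponents_bd (N : R) n (s : nat -> C) := forall k, (k < n)%N -> `|Re
  (s k) - 1| <= N /\ `|Im (s k)| <= N.
Lemma prod_nth n l (f : C -> R) : size l = n -> \prod_(w <- l) f w = \prod_(k < n) f (nth 0 l k).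
Proof. by move=> <-; rewrite (big_nth 0) big_mkord. Qed.

Lemma normc_prod n (f : nat -> C) : normc (\prod_(k < n) f k) = \prod_(k < n) normc (f k).
Proof.
by elim: n => [|n IH]; rewrite ?big_ord0 ?normc_1// !big_ord_recr /= normcM IH.
Qed.

Lemma power_prod_le (N : R) n s l : 1 <= N -> exponents_bd N n s -> pts n l ->
  normc (power_prod s n l) * decay l <= power_bd N ^+ n * weights l.
Proof.
move=> N1 hs [sl cl]; rewrite /power_prod (normc_prod n (fun k => cexp ((s k - 1) * nth 0 l k))).
rewrite /decay (prod_nth _ sl) /weights (prod_nth _ sl) -big_split /=.
have -> : power_bd N ^+ n = \prod_(k < n) power_bd N by rewrite prodr_const card_ord.
rewrite -big_split /=; apply: ler_prod => k _; rewrite mulr_ge0 ?normc_ge0 ?expR_ge0//=.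
have [h1 h2] := hs k (ltn_ord k); apply: power_weight_le => //; exact: cl.
Qed.

Definition int_bd (N : R) : R := kernel_bd R * expR1 * expR1 * power_bd N.
Lemma int_bd_ge0 N : 0 <= int_bd N.
Proof. by rewrite /int_bd mulr_ge0 ?expR_ge0// mulr_ge0 ?expR1_ge0// mulr_ge0 ?kernel_bd_ge0
  ?expR1_ge0. Qed.

Lemma integrand_le (N : R) n q s l t : 1 <= N -> kernel_ok q -> n.+1%:R * e <= 4^-1 -> normc t
  <= e ->
  exponents_bd N n s -> pts n l -> normc (kernel_prod q t l) * normc
    (power_prod s n l) <= int_bd N ^+ n * weights l.
Proof.
move=> N1 hq ne te hs hl.
apply: le_trans (ler_wpM2r (normc_ge0 _) (kernel_prod_le hq ne te hl)) _.
have H := power_prod_le N1 hs hl; have E := expo_le hl.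
have q0 : 0 <= (kernel_bd R * expR1) ^+ n by rewrite exprn_ge0// mulr_ge0 ?kernel_bd_ge0
  ?expR1_ge0.
rewrite -mulrA; apply: le_trans (ler_wpM2l q0 (ler_wpM2r (normc_ge0 _) E)) _.
have -> : (kernel_bd R * expR1) ^+ n * (expR1 ^+ n * decay l * normc (power_prod s n l)) =
   (kernel_bd R * expR1 * expR1) ^+ n * (normc
     (power_prod s n l) * decay l) by rewrite !exprMn; ring.
rewrite /int_bd [X in X * weights l]exprMn -[leRHS]mulrA.
by apply: ler_wpM2l H; rewrite exprn_ge0// mulr_ge0 ?expR1_ge0// mulr_ge0 ?kernel_bd_ge0
  ?expR1_ge0.
Qed.

Lemma exp_sum_cvg n (u : nat -> seq C) l : (forall m, pts n (u m)) -> pts n l ->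
  (forall k, (k < n)%N -> ccvg (fun m => nth 0 (u m) k) (nth 0 l k)) ->
  ccvg (fun m => exp_sum (u m)) (exp_sum l).
Proof.
move=> hu [sl _] ul; rewrite /exp_sum (big_nth 0) big_mkord sl.
apply: (@ccvg_ext _ (fun m => \sum_(k < n) cexp (nth 0 (u m) k))).
  by move=> m; rewrite [RHS](big_nth 0) big_mkord; have [-> _] := hu m.
by apply: ccvg_sum => k _; apply: ccvg_cexp; exact: ul.
Qed.

Lemma kernel_prod_cvg n q (t_ : nat -> C) t
  (u : nat -> seq C) l : kernel_ok q -> n.+1%:R * e <= 4^-1 ->
  (forall m, normc (t_ m) <= e) -> normc t <= e -> ccvg t_ t ->
  (forall m, pts n (u m)) -> pts n l ->
  (forall k, (k < n)%N -> ccvg (fun m => nth 0 (u m) k) (nth 0 l k)) ->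
  ccvg (fun m => kernel_prod q (t_ m) (u m)) (kernel_prod q t l).
Proof.
move=> hq + hte te tt; elim: n u l => [|n IH] u l ne hu hl ul.
  apply: ccvg_ext (ccvg_cst _) => m; case: hl => /size0nil -> _.
  by case: (hu m) => /size0nil -> _.
have ne' : n.+1%:R * e <= 4^-1 by apply: le_trans ne; rewrite ler_wpM2r ?(ltW e0)// ler_nat.
have E m : kernel_prod q (t_ m) (u m) = q (t_ m + exp_sum (u m)) * kernel_prod q (t_ m)
  (behead (u m)).
  by have [-> _ _] := pts_behead (hu m).
have El : kernel_prod q t l = q (t + exp_sum l) * kernel_prod q t (behead l).
  by have [-> _ _] := pts_behead hl.
rewrite El; apply: (@ccvg_ext _ (fun m => q (t_ m + exp_sum (u m)) * kernel_prod q (t_ m)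
  (behead (u m)))).
  by move=> m; rewrite E.
apply: ccvgM.
  case: hq => _ cq; apply: cq.
  - by move=> m; apply: region_tsum ne (hte m) (hu m).
  - exact: region_tsum ne te hl.
  - by apply: ccvgD => //; exact: exp_sum_cvg hu hl ul.
apply: IH => //.
- by move=> m; have [] := pts_behead (hu m).
- by have [] := pts_behead hl.
- move=> k kn; rewrite nth_behead; apply: ccvg_ext (ul k.+1 kn) => m.
  by rewrite nth_behead.
Qed.

Lemma power_prod_cvg n s (u : nat -> seq C) l :
  (forall k, (k < n)%N -> ccvg (fun m => nth 0 (u m) k) (nth 0 l k)) ->
  ccvg (fun m => power_prod s n (u m)) (power_prod s n l).
Proof.
move=> ul; apply: ccvg_prod => k _; apply: ccvg_cexp; apply: ccvgM; first exact: ccvg_cst.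
exact: ul.
Qed.

Lemma integrand_adm (N : R) n q s t : 1 <= N -> kernel_ok q -> n.+1%:R * e <= 4^-1 -> normc t
  <= e ->
  exponents_bd N n s -> adm n (int_bd N ^+ n) (fun l => kernel_prod q t l * power_prod s n l).
Proof.
move=> N1 hq ne te hs; split.
- by move=> l hl; rewrite normcM; exact: integrand_le.
- move=> u l hu hl ul; apply: ccvgM; last exact: power_prod_cvg.
  by apply: (kernel_prod_cvg hq ne) => //; exact: ccvg_cst.
Qed.

Lemma kernel_prod_hol n l : n%:R * e <= 2^-1 -> pts n l -> exists F', hol 2^-1
  (fun t => kernel_prod (@dbern R) t l) F'.
Proof.
elim: n l => [|n IH] l ne hl.
  by case: hl => /size0nil -> _; exists (fun=> 0); exact: hol_cst.
have ne' : n%:R * e <= 2^-1 by apply: le_trans ne; rewrite ler_wpM2r ?(ltW e0)// ler_nat.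
have [El cw hb] := pts_behead hl; have [F' hF] := IH _ ne' hb.
have [g' hg] := dbern_hol R.
have hI : `|Im (exp_sum l)| <= 2^-1 by have [i _] := exp_sum_bd hl; exact: le_trans ne.
have hg2 : hol (2^-1 + 2^-1) (@dbern R) g' by rewrite (_ : 2^-1 + 2^-1 = 1 :> R)//; field.
have hs := hol_shift hI hg2.
eexists; apply: hol_eq (hol_mul hs hF) => z; last by reflexivity.
by rewrite [X in _ = kernel_prod _ _ X]El /= -El [exp_sum l + z]addrC.
Qed.

(** The i-th Taylor coefficient of [kernel_prod] with respect to its shift, that is
    1/i! times the i-th derivative in the last variable. *)
Definition kernel_coef i l : C := taylor_coef e i (fun t => kernel_prod (@dbern R) t l) 0.
Lemma kernel_circ_seq_cont n l i (D : set R) : n.+1%:R * e <= 4^-1 -> pts n l ->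
  seq_cont D (fun a => kernel_prod (@dbern R) (0 + circ e a) l * circ_negpow e i a).
Proof.
move=> ne hl u a uD aD ua; apply: ccvgM; last exact: (@seq_cont_circ_negpow _ e i D u a uD aD ua).
apply: (kernel_prod_cvg (dbern_qok R) ne (u := fun=> l) (l := l)) => //.
- by move=> m; rewrite add0r normc_circ.
- by rewrite add0r normc_circ.
- by apply: ccvgD; [exact: ccvg_cst|exact: (@seq_cont_circ' _ e D u a uD aD ua)].
- by move=> k kn; exact: ccvg_cst.
Qed.

Lemma kernel_coef_adm (N : R) n s i : 1 <= N -> n.+1%:R * e <= 4^-1 ->
  exponents_bd N n s -> adm n (2 * expR (- i%:R * ln e) * int_bd N ^+ n)
    (fun l => kernel_coef i l * power_prod s n l).
Proof.
move=> N1 ne hs.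
have B l a : pts n l -> normc (kernel_prod (@dbern R) (0 + circ e a) l * circ_negpow e i a) <=
    (kernel_bd R * expR1) ^+ n * expR (- (Re (exp_sum l) / 4)) * expR (- i%:R * ln e).
  move=> hl; rewrite normcM normc_circ_negpow ler_wpM2r ?expR_ge0//.
  by apply: (kernel_prod_le (dbern_qok R) ne) => //; rewrite add0r normc_circ.
split.
- move=> l hl; rewrite normcM /kernel_coef /taylor_coef normcM normcR ger0_norm ?invr_ge0
  ?pi2_ge0//.
  have K a : 0 <= a <= 2 * pi -> normc (kernel_prod (@dbern R)
    (0 + circ e a) l * circ_negpow e i a * power_prod s n l) <=
      int_bd N ^+ n * weights l * expR (- i%:R * ln e).
    move=> _; rewrite normcM [normc
      (_ * circ_negpow _ _ _)]normcM normc_circ_negpow mulrAC ler_wpM2r ?expR_ge0//.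
    by apply: integrand_le => //; [exact: dbern_qok|rewrite add0r normc_circ].
  have c : seq_cont `[0, 2 * pi] (fun a => power_prod s n l * (kernel_prod (@dbern R)
    (0 + circ e a) l * circ_negpow e i a)).
    move=> u a uD aD ua; apply: ccvgM; first exact: ccvg_cst.
    exact: (kernel_circ_seq_cont i ne hl uD aD ua).
  have := cint_bound (pi2_ge0 R) c.
  move=> /(_ (int_bd N ^+ n * weights l * expR (- i%:R * ln e))) H.
  have {}H : normc (power_prod s n l * cintegral `[0, 2 * pi] (fun a => kernel_prod (@dbern R)
    (0 + circ e a) l * circ_negpow e i a))
     <= 2 * (int_bd N ^+ n * weights l * expR (- i%:R * ln e) * (2 * pi - 0)).
    rewrite -cintM; last 2 first.
    + exact: measurable_itv.
    + by apply: seq_cont_intble; [exact: pi2_ge0|exact: kernel_circ_seq_cont ne hl].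
    by apply: H => x hx; rewrite [power_prod _ _ _ * _]mulrC; exact: K.
  rewrite -[leLHS]mulrA -normcM [X in normc X]mulrC.
  rewrite [leLHS]mulrC ler_pdivrMr ?pi2_gt0//; apply: le_trans H _.
  by rewrite subr0 le_eqVlt; apply/orP; left; apply/eqP; ring.
- move=> u l hu hl ul; apply: ccvgM; last exact: power_prod_cvg.
  apply: ccvgM; first exact: ccvg_cst.
  apply: (@cint_dct_itv _ 0 (2 * pi) ((kernel_bd R * expR1) ^+ n * expR 1 * expR
    (- i%:R * ln e))).
  + exact: pi2_ge0.
  + by move=> m; exact: kernel_circ_seq_cont ne (hu m).
  + exact: kernel_circ_seq_cont ne hl.
  + move=> m a _; apply: le_trans (B _ a (hu m)) _.
    rewrite ler_wpM2r ?expR_ge0//; apply: ler_wpM2l;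
      first by rewrite exprn_ge0// mulr_ge0 ?kernel_bd_ge0 ?expR1_ge0.
    by rewrite ler_expR; have [_ r] := exp_sum_bd (hu m); move: ne r;
      rewrite -natr1 mulrDl mul1r; move: e0; lra.
  + move=> a _; apply: ccvgM; last exact: ccvg_cst.
    apply: (kernel_prod_cvg (dbern_qok R) ne) => //.
    * by move=> m; rewrite add0r normc_circ.
    * by rewrite add0r normc_circ.
    * exact: ccvg_cst.
Qed.
End Integrand.

(** * Lowering the depth at a non-positive last argument *)

Section Reduction.
Variable R : realType.
Local Notation C := R[i].
Local Notation Re := (@complex.Re R).
Local Notation Im := (@complex.Im R).
Local Notation dbern := (@dbern R).
Implicit Types (z w t : C) (x a : R) (l : seq C).
Variable e : R.
Hypothesis e0 : 0 < e.
Hypothesis e8 : e <= 8^-1.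
Local Notation contour := (contour e).
Local Notation pts := (pts e).
Local Notation adm := (adm e).
Local Notation taylor_coef := (taylor_coef e).
Local Notation kernel_coef := (kernel_coef e).

Lemma exponents_bd_ex n (s : nat -> C) : exists2 N, 1 <= N & exponents_bd N n s.
Proof.
exists (1 + \sum_(k < n) (`|Re (s k) - 1| + `|Im (s k)|)).
  by rewrite lerDl; apply: sumr_ge0 => k _; rewrite addr_ge0.
move=> k kn.
have : `|Re (s k) - 1| + `|Im (s k)| <= \sum_(k < n) (`|Re (s k) - 1| + `|Im (s k)|).
  rewrite (bigD1 (Ordinal kn))//= lerDl; apply: sumr_ge0 => j _; exact: addr_ge0.
by move=> H; have h1 := normr_ge0 (Re (s k) - 1); have h2 := normr_ge0 (Im (s k)); split; lra.
Qed.

Lemma hankel_scale M (f : C -> C) (a : C) : 0 <= M -> adm1 e M f ->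
  hankel e (fun w => a * f w) = a * hankel e f.
Proof.
move=> M0 af; have z0 : adm1 e 0 (fun=> 0 : C).
  by split; [move=> w _; rewrite normc_0 mul0r|move=> *; exact: ccvg_cst].
have hz : hankel e (fun=> 0) = 0.
  have := hankel_lin e0 (-1) (lexx 0) (lexx 0) z0 z0.
  have E0 (z : C) : -1 * z + z = 0 by rewrite mulN1r addNr.
  rewrite [RHS]E0 => hE; rewrite -[RHS]hE; congr hankel; apply/funext => l;
    by rewrite mulr0 addr0.
have := hankel_lin e0 a M0 (lexx 0) af z0; rewrite hz addr0 => <-.
by congr hankel; apply/funext => w; rewrite addr0.
Qed.

(** The factors of [kernel_prod] on l followed by one more variable u, as a
    function of u. *)
Definition last_kernel l u : C := kernel_prod dbern u l * dbern u.

(** The shift and the last variable occur through their sum only. *)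
Lemma kernel_coef_rcons i l w : kernel_coef i (rcons l w) = taylor_coef i (last_kernel l)
  (cexp w).
Proof.
rewrite /kernel_coef /taylor_coef; congr (_ * _); apply: cint_ext => a _.
by rewrite kernel_prod_rcons add0r /last_kernel [circ e a + _]addrC.
Qed.

Lemma dbern_hol2 : exists g', hol 2^-1 dbern g'.
Proof.
have [g' hg] := dbern_hol R; exists g'.
have h0 : `|Im (0 : C)| <= 2^-1 by rewrite /= normr0 invr_ge0.
have hg2 : hol (2^-1 + 2^-1) dbern g' by rewrite (_ : 2^-1 + 2^-1 = 1 :> R)//; field.
by apply: hol_eq (hol_shift h0 hg2) => z; rewrite add0r.
Qed.

Lemma last_kernel_hol n l : n.+1%:R * e <= 4^-1 -> pts n l -> exists F', hol 2^-1
  (last_kernel l) F'.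
Proof.
move=> ne hl; have ne' : n%:R * e <= 2^-1.
  by move: ne; rewrite -natr1 mulrDl mul1r; move: e0; lra.
have [F' hF] := kernel_prod_hol e0 ne' hl; have [g' hg] := dbern_hol2.
by eexists; exact: hol_mul hF hg.
Qed.

Definition upd (s : nat -> C) n z k := if k == n then z else s k.
Lemma power_prod_one n s l : (forall k, (k < n)%N -> s k = 1) -> power_prod s n l = 1.
Proof. by move=> h; rewrite /power_prod big1// => k _; rewrite h// subrr mul0r cexp0. Qed.

Lemma power_prod_ext n s s' l : (forall k,
  (k < n)%N -> s k = s' k) -> power_prod s n l = power_prod s' n l.
Proof. by move=> h; apply: eq_bigr => k _; rewrite h. Qed.

Lemma adm_rcons n M (f : seq C -> C) l : pts n l -> adm n.+1 M f ->
  adm1 e (M * weights l) (fun w => f (rcons l w)).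
Proof.
move=> hl [b c]; split.
- by move=> w cw; rewrite -mulrA -weights_rcons; apply: b; exact: pts_rcons.
- move=> u w cu cw uw; apply: c.
  + by move=> m; exact: pts_rcons.
  + exact: pts_rcons.
  + move=> k kn; case: hl => sl _; rewrite nth_rcons sl.
    case: ltnP => kn'; first by apply: ccvg_ext (ccvg_cst _) => m; rewrite nth_rcons sl kn'.
    have -> : k = n by apply/eqP; rewrite eqn_leq kn' -ltnS kn.
    by rewrite eqxx; apply: ccvg_ext uw => m; rewrite nth_rcons sl ltnn eqxx.
Qed.

Section Level.
Variables (n : nat).
Hypothesis ne : n.+2%:R * e <= 4^-1.
Let ne' : n.+1%:R * e <= 4^-1.
Proof. by apply: le_trans ne; rewrite ler_wpM2r ?(ltW e0)// ler_nat. Qed.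

Lemma last_kernel_adm l : pts n l -> forall i s, exists2 M, 0 <= M &
  adm1 e M (fun w => taylor_coef i (last_kernel l) (cexp w) * cexp (s * w)).
Proof.
move=> hl i s; pose s' := upd (fun=> 1) n (s + 1).
have [N N1 hs] := exponents_bd_ex n.+1 s'.
have H := adm_rcons hl (kernel_coef_adm e0 e8 i N1 ne hs).
eexists; last first.
  have -> : (fun w => taylor_coef i (last_kernel l) (cexp w) * cexp (s * w)) =
     (fun w => kernel_coef i (rcons l w) * power_prod s' n.+1 (rcons l w)).
    apply/funext => w; rewrite kernel_coef_rcons power_prod_rcons; last by case: hl.
    rewrite power_prod_one; last by move=> k kn; rewrite /s' /upd ltn_eqF.
    by rewrite mul1r /s' /upd eqxx addrK.
  exact: H.
by rewrite mulr_ge0 ?weights_ge0// mulr_ge0 ?exprn_ge0 ?int_bd_ge0// mulr_ge0// expR_ge0.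
Qed.

Definition zeta_int m s : C := hankel_seq e m (fun l => kernel_prod dbern 0 l * power_prod s m l).
Definition coef_int m i s : C := hankel_seq e m (fun l => kernel_coef i l * power_prod s m l).

Lemma normc0_le_radius : normc (0 : C) <= e. Proof. by rewrite normc_0 ltW. Qed.

(** Integrate over the last variable first, by residues. *)
Lemma zeta_int_residue k s : s n = - k%:R ->
  zeta_int n.+1 s = \sum_(i < k.+1) ((0 +i* (2 * pi)) * taylor_coef
    (k - i) dbern 0) * coef_int n i s.
Proof.
move=> sn; have [N N1 hs] := exponents_bd_ex n s.
have [S _] := hankel_seq_sum e0 (index_enum 'I_k.+1)
  (fun i : 'I_k.+1 => (0 +i* (2 * pi)) * taylor_coef (k - i) dbern 0)
  (M := fun i : 'I_k.+1 => 2 * expR (- i%:R * ln e) * int_bd e N ^+ n)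
  (fun i => mulr_ge0 (mulr_ge0 (ler0n _ 2) (expR_ge0 _)) (exprn_ge0 n (int_bd_ge0 e N)))
  (fun i : 'I_k.+1 => kernel_coef_adm e0 e8 i N1 ne' hs).
rewrite /coef_int -S /zeta_int hankel_seq_rcons; apply: (hankel_seq_ext e0) => l hl.
have [F' hF] := last_kernel_hol ne' hl.
have [M M0 aM] := last_kernel_adm hl 0 (- k%:R - 1).
transitivity (power_prod s n l * hankel e (fun w => last_kernel l (cexp w) * cexp
  ((- k%:R - 1) * w))).
  rewrite -(hankel_scale _ M0); last first.
    case: aM => b c; split.
    - move=> w cw; have := b w cw; rewrite (taylor_coef0 e0 e8 hF)//;
      exact: (contour_strip e8 cw).
    - move=> u w cu cw uw; have := c u w cu cw uw.
      rewrite (taylor_coef0 e0 e8 hF); last exact: (contour_strip e8 cw).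
      by apply: ccvg_ext => m; rewrite (taylor_coef0 e0 e8 hF)//;
        exact: (contour_strip e8 (cu m)).
  apply: (hankel_ext e0) => w cw; rewrite kernel_prod_rcons power_prod_rcons; last by case: hl.
  by rewrite add0r sn /last_kernel; ring.
rewrite (hankel_residue e0 e8 _ (hol_cont hF)).
have ne2 : n%:R * e <= 2^-1 by move: ne'; rewrite -natr1 mulrDl mul1r; move: e0; lra.
have [G' hG] := kernel_prod_hol e0 ne2 hl; have [g' hg] := dbern_hol2.
rewrite (taylor_coefM e0 e8 k hG hg) !mulr_sumr; apply: eq_bigr => i _.
by rewrite /kernel_coef; ring.
Qed.

(** Integrate by parts i times in the last variable. *)
Lemma coef_int_parts i s : i`!%:R * coef_int n.+1 i s =
  (-1) ^+ i * (\prod_(q < i) (s n - 1 - q%:R)) * zeta_int n.+1 (upd s n (s n - i%:R)).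
Proof.
have [N N1 hs] := exponents_bd_ex n.+1 s.
have [N' N1' hs'] := exponents_bd_ex n.+1 (upd s n (s n - i%:R)).
have a1 := kernel_coef_adm e0 e8 i N1 ne hs.
have a2 := integrand_adm e0 e8 N1' (dbern_qok R) ne normc0_le_radius hs'.
have p1 : 0 <= 2 * expR (- i%:R * ln e) * int_bd e N ^+ n.+1.
  by rewrite mulr_ge0 ?exprn_ge0 ?int_bd_ge0// mulr_ge0// expR_ge0.
have p2 : 0 <= int_bd e N' ^+ n.+1 by rewrite exprn_ge0 ?int_bd_ge0.
rewrite /coef_int /zeta_int -(hankel_seq_scale e0 _ p1 a1) -(hankel_seq_scale e0 _ p2 a2)
  !hankel_seq_rcons.
apply: (hankel_seq_ext e0) => l hl.
have sl : size l = n by case: hl.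
have [F' hF] := last_kernel_hol ne' hl.
have aF := last_kernel_adm hl.
have [M M0 aM] := aF i (s n - 1).
have [M' M0' aM'] := aF 0 (s n - 1 - i%:R).
have aM'' : adm1 e M' (fun w => last_kernel l (cexp w) * cexp ((s n - 1 - i%:R) * w)).
  case: aM' => b c; split.
  - move=> w cw; have := b w cw; rewrite (taylor_coef0 e0 e8 hF)//; exact: (contour_strip e8 cw).
  - move=> u w cu cw uw; have := c u w cu cw uw.
    rewrite (taylor_coef0 e0 e8 hF); last exact: (contour_strip e8 cw).
    by apply: ccvg_ext => m; rewrite (taylor_coef0 e0 e8 hF)//; exact: (contour_strip e8 (cu m)).
have P := parts_iter e0 e8 hF aF i (s n - 1).
transitivity (power_prod s n l * (i`!%:R * hankel e (fun w => taylor_coef i (last_kernel l)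
  (cexp w) * cexp ((s n - 1) * w)))).
  rewrite mulrA -(hankel_scale _ M0 aM); apply: (hankel_ext e0) => w cw.
  by rewrite kernel_coef_rcons power_prod_rcons//; ring.
rewrite P mulrA -(hankel_scale _ M0' aM''); apply: (hankel_ext e0) => w cw.
rewrite kernel_prod_rcons power_prod_rcons// add0r /upd eqxx.
rewrite (@power_prod_ext n (fun k => if k == n then s n - i%:R else s k) s); last first.
  by move=> k kn; rewrite ltn_eqF.
rewrite (_ : s n - i%:R - 1 = s n - 1 - i%:R); last by ring.
by rewrite /last_kernel; ring.
Qed.
End Level.
End Reduction.

(** * The Gamma factor *)

Section Topo.
Variable R : realType.
Local Notation C := R[i].
Local Notation Re := (@complex.Re R).
Local Notation Im := (@complex.Im R).
Implicit Types (z w t s : C) (x a : R).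

Lemma normCE z : `|z| = (normc z)%:C.
Proof. by case: z => a b; rewrite normc_def. Qed.

Lemma cvgC_ccvg (u : nat -> C^o) (l : C^o) : u n @[n --> \oo] --> l -> ccvg u l.
Proof.
move=> /cvgrPdist_lt h.
have K eps : 0 < eps -> \forall n \near \oo, normc (l - u n) < eps.
  move=> e0; have e0' : 0 < eps%:C :> C^o by rewrite ltcR.
  by have := h _ e0'; apply: filterS => n; rewrite normCE ltcR.
by split; apply/cvgrPdist_lt => eps /K; apply: filterS => n; apply: le_lt_trans;
  rewrite -?ReN -?ImN -?ReD -?ImD ?abs_Re ?abs_Im.
Qed.

Lemma ccvg_cvgC (u : nat -> C^o) (l : C^o) : ccvg u l -> u n @[n --> \oo] --> l.
Proof.
move=> [a b]; apply/cvgrPdist_lt => eps e0.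
have [er ei] : 0 < Re eps /\ eps = (Re eps)%:C.
  by move: e0; case: eps => er ei; rewrite ltcE /= => /andP[/eqP -> ->].
have e2 : 0 < Re eps / 2 by rewrite divr_gt0.
have /cvgrPdist_lt/(_ _ e2) a' := a; have /cvgrPdist_lt/(_ _ e2) b' := b.
near=> n; rewrite normCE ei ltcR; apply: le_lt_trans (normc_le _) _.
rewrite ReD ImD ReN ImN [X in _ < X]splitr ltrD//.
- by near: n.
- by near: n.
Unshelve. all: by end_near. Qed.

Lemma diff_ray (K : numFieldType) r (Z : 'rV[K]_r -> K^o) (s d : 'rV[K]_r) (x : nat -> K^o) :
  differentiable Z s -> x n @[n --> \oo] --> (0 : K^o) -> Z (s + x n *: d) @[n --> \oo] --> Z s.
Proof.
move=> /differentiable_continuous cZ x0.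
have h : (s + x n *: d) @[n --> \oo] --> s.
  rewrite -[X in _ --> X]addr0; apply: cvgD; first exact: cvg_cst.
  by rewrite -(scale0r d); apply: cvgZr_tmp.
exact: (cvg_comp _ _ h cZ).
Qed.

Lemma zeta_ray r (Z : 'rV[C]_r -> C^o) (s d : 'rV[C]_r) (x : nat -> R) :
  is_zeta_des Z -> x n @[n --> \oo] --> 0 ->
  ccvg (fun n => Z (s + (x n)%:C *: d)) (Z s).
Proof.
move=> [dZ _] x0; apply: cvgC_ccvg; apply: (@diff_ray C r Z s d (fun n => (x n)%:C));
  first exact: dZ.
exact: (@ccvg_cvgC (fun n => (x n)%:C) 0 (ccvgR x0)).
Qed.

Definition hankel_pref z : C := ((cexp ((0 +i* (2 * pi)) * z) - 1) * cGamma z)^-1.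
Definition gauss z (n : nat) : C := n`!%:R * cexp (z * (ln n%:R)%:C) / \prod_(k < n.+1)
  (z + k%:R).
Lemma inv_nat0 : (n.+1%:R : R)^-1 @[n --> \oo] --> 0.
Proof. exact: cvg_harmonic. Qed.

Lemma gauss_step z n : (forall k : nat, z + k%:R != 0) ->
  gauss (z + 1) n.+1 = gauss z n.+1 * (z / ((z + 1) * (n.+1%:R^-1)%:C + 1)).
Proof.
move=> z0; rewrite /gauss mulrDl mul1r cexpD cexp_ln// rmorph_nat.
have -> : \prod_(k < n.+2) (z + 1 + k%:R) = (\prod_(k < n.+2) (z + k%:R)) * (z + n.+2%:R) / z.
  have <- : \prod_(k < n.+3) (z + k%:R) = (\prod_(k < n.+2) (z + k%:R)) *
    (z + n.+2%:R) by rewrite big_ord_recr.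
  rewrite [in RHS]big_ord_recl /= addr0 [RHS]mulrAC divff ?mul1r; last by have := z0 0%N;
    rewrite addr0.
  by apply: eq_bigr => k _; rewrite /bump /= natrD addrA.
have P0 : \prod_(k < n.+2) (z + k%:R) != 0 by apply/prodf_neq0 => k _; exact: z0.
have zz : z != 0 by have := z0 0%N; rewrite addr0.
have zn := z0 n.+2.
have n0 : (n.+1%:R : C) != 0 by rewrite pnatr_eq0.
rewrite fmorphV rmorph_nat.
have zn' : z + 1 + n.+1%:R != 0 by rewrite -addrA [1 + _]addrC natr1.
have q0 : (z + 1) / n.+1%:R + 1 != 0.
  have -> : (z + 1) / n.+1%:R + 1 = (z + 1 + n.+1%:R) / n.+1%:R by field.
  by rewrite mulf_neq0 ?invr_neq0.
have E : (z + 1) / n.+1%:R + 1 = (z + n.+2%:R) / n.+1%:R by rewrite -[n.+2%:R]natr1; field.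
rewrite E; move: P0; move: (\prod_(k < _) _) => P P0.
move: (cexp _) (n.+1`!%:R) (n.+2%:R) (n.+1%:R) n0 zn => A B D F F0 D0.
by field; rewrite F0 D0 zz P0.
Qed.

(** The Gauss sequences at z + 1 and at z differ by a factor tending to z != 0,
    so they converge or diverge together. In the divergent case both limits are
    the default value 0, and the equation still holds. *)
Lemma cGammaS z : (forall k : nat, z + k%:R != 0) -> cGamma (z + 1) = z * cGamma z.
Proof.
move=> z0; have zz : z != 0 by have := z0 0%N; rewrite addr0.
pose rr n : C := z / ((z + 1) * (n.+1%:R^-1)%:C + 1).
have rc : ccvg rr z.
  rewrite -[X in ccvg _ X]divr1; apply: ccvgM; first exact: ccvg_cst.
  apply: ccvgV; first exact: oner_neq0.
  rewrite -[X in ccvg _ X]add0r; apply: ccvgD; last exact: ccvg_cst.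
  rewrite -(mulr0 (z + 1)); apply: ccvgM; first exact: ccvg_cst.
  exact: ccvgR inv_nat0.
have r0 n : rr n != 0.
  rewrite mulf_neq0// invr_neq0// fmorphV rmorph_nat.
  have n0 : (n.+1%:R : C) != 0 by rewrite pnatr_eq0.
  have -> : (z + 1) / n.+1%:R + 1 = (z + n.+2%:R) / n.+1%:R by rewrite -[n.+2%:R]natr1; field.
  by rewrite mulf_neq0 ?invr_neq0.
have E n : gauss (z + 1) n.+1 = gauss z n.+1 * rr n by exact: gauss_step.
have H l : ccvg (gauss z) l -> ccvg (gauss (z + 1)) (z * l).
  move=> /(ccvg_shift 1) h; have := ccvgM rc h => h'.
  have {}h' : ccvg (fun n => gauss (z + 1) n.+1) (z * l).
    by apply: ccvg_ext h' => n; rewrite E addn1 mulrC.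
  apply: cvgC_ccvg; rewrite -(cvg_shiftS (gauss (z + 1) : nat -> C^o)); exact: ccvg_cvgC.
have H' l : ccvg (gauss (z + 1)) l -> ccvg (gauss z) (z^-1 * l).
  move=> /(ccvg_shift 1) h; have := ccvgM (ccvgV zz rc) h => h'.
  have {}h' : ccvg (fun n => gauss z n.+1) (z^-1 * l).
    apply: ccvg_ext h' => n; rewrite addn1 E mulrC -mulrA divff ?mulr1//.
  apply: cvgC_ccvg; rewrite -(cvg_shiftS (gauss z : nat -> C^o)); exact: ccvg_cvgC.
have gE y : cGamma y = lim ((gauss y : nat -> C^o) @ \oo) by [].
have [[l hl]|nl] := pselect (exists l, ccvg (gauss z) l).
  have L (y b : C) : ccvg (gauss y) b -> cGamma y = b.
    by move=> h; rewrite gE; have := @ccvg_cvgC (gauss y) b h => /cvg_lim; apply;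
      exact: norm_hausdorff.
  by rewrite (L _ _ hl) (L _ _ (H _ hl)).
have D y : (forall l, ~ ccvg (gauss y) l) -> cGamma y = 0.
  move=> h; rewrite gE dvgP //.
  by move=> /cvg_ex [l /cvgC_ccvg hl]; exact: h hl.
rewrite !D ?mulr0// => l hl; apply: nl; first by exists l.
by exists (z^-1 * l); exact: H'.
Qed.

Definition nonint z := forall m : int, z != m%:~R.
Lemma nonint_sub z (k : int) : nonint z -> nonint (z - k%:~R).
Proof.
by move=> h m; rewrite subr_eq -rmorphD /=; exact: h.
Qed.

Lemma hankel_prefS z : nonint z -> hankel_pref z * (z - 1) = hankel_pref (z - 1).
Proof.
move=> hz; have h1 := nonint_sub 1 hz; rewrite /hankel_pref.
have -> : cGamma z = (z - 1) * cGamma (z - 1).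
  rewrite -cGammaS ?subrK// => k; have := h1 (- (k : int)).
  by rewrite rmorphN /= -subr_eq0 opprK.
have -> : cexp ((0 +i* (2 * pi)) * z) = cexp ((0 +i* (2 * pi)) * (z - 1)) :> C.
  by rewrite -{1}(subrK 1 z) mulrDr mulr1 cexpD cexp_2pii mulr1.
have z1 : z - 1 != 0 by have := h1 0; rewrite rmorph0.
by rewrite mulrCA invfM mulrAC mulVf// mul1r.
Qed.

Lemma hankel_pref_sub z (i : nat) : nonint z -> hankel_pref
  (z - i%:R) = hankel_pref z * \prod_(q < i) (z - 1 - q%:R).
Proof.
move=> hz; elim: i => [|i IH]; first by rewrite big_ord0 subr0 mulr1.
rewrite big_ord_recr /= mulrA -IH -[i.+1%:R]natr1 opprD addrA.
rewrite -hankel_prefS; last exact: (nonint_sub (i : int) hz).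
by rewrite addrAC.
Qed.
End Topo.

(** * Contour integral for the values at non-integral points *)

Section Values.
Variable R : realType.
Local Notation C := R[i].
Local Notation Re := (@complex.Re R).
Local Notation Im := (@complex.Im R).
Implicit Types (z w t : C) (x a c : R) (l : seq C) (s : nat -> C).
Local Notation dbern := (@dbern R).
Local Notation hdes_quot := (@hdes_quot R).

Lemma kernel_prodE (q : C -> C) l :
  \prod_(j < size l) q (\sum_(k < size l | (j <= k)%N) cexp (nth 0 l k)) = kernel_prod q 0 l.
Proof.
elim: l => [|w l IH]; first by rewrite big_ord0.
rewrite /= big_ord_recl; congr (q _ * _).
  by rewrite add0r /exp_sum [RHS](big_nth 0) big_mkord; apply: eq_bigl => k.
rewrite -IH; apply: eq_bigr => j _; congr q.
rewrite big_mkcond big_ord_recl /= add0r [RHS]big_mkcond.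
by apply: eq_bigr => k _; rewrite /bump /= !add1n ltnS.
Qed.

Definition pref_prod n s : C := \prod_(k < n) hankel_pref (s k).

Variable e : R.
Hypothesis e0 : 0 < e.
Hypothesis e8 : e <= 8^-1.
Local Notation pts := (pts e).

Lemma kernel_prod_hdes n c l : 2^-1 <= c < 1 -> n.+1%:R * e <= 4^-1 -> pts n l ->
  kernel_prod (hdes c) 0 l = (((1 - c) ^+ n)%:C) * kernel_prod (hdes_quot c) 0 l.
Proof.
move=> hc; elim: n l => [|n IH] l ne hl.
  by case: hl => /size0nil -> _ /=; rewrite expr0 mulr1.
have ne' : n.+1%:R * e <= 4^-1 by apply: le_trans ne; rewrite ler_wpM2r ?(ltW e0)// ler_nat.
have hr := region_tsum e0 ne (normc0_le_radius e0) hl; have [El cw hb] := pts_behead hl.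
move: hr; rewrite El; set w := nth _ _ _; set l' := behead _ => hr /=.
by rewrite hdes_quotE// IH// exprS rmorphM /=; ring.
Qed.

Lemma approxE n c s : 2^-1 <= c < 1 -> n.+1%:R * e <= 4^-1 ->
  zeta_des_approx e c (\row_(k < n) s k) =
  pref_prod n s * hankel_seq e n (fun l => kernel_prod (hdes_quot c) 0 l * power_prod s n l).
Proof.
move=> hc ne; have hc' : 2^-1 <= c <= 1 by case/andP: hc => -> /ltW ->.
rewrite /zeta_des_approx hankel_iterE.
have [N N1 hs] := exponents_bd_ex n s.
have ad := integrand_adm e0 e8 N1 (hdes_quot_qok hc') ne (normc0_le_radius e0) hs.
have p0 : 0 <= int_bd e N ^+ n by rewrite exprn_ge0 ?int_bd_ge0.
have -> : hankel_seq e n (fun l => Hdes (map_mx (@cexp R) (\row_(k < n) nth 0 l k)) c *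
     \prod_(k < n) cexp (((\row_(k0 < n) s k0) 0 k - 1) * (\row_(k0 < n) nth 0 l k0) 0 k)) =
   ((1 - c) ^+ n)%:C * hankel_seq e n (fun l => kernel_prod (hdes_quot c) 0 l * power_prod s n l).
  rewrite -(hankel_seq_scale e0 _ p0 ad). apply: (hankel_seq_ext e0) => l hl.
  rewrite mulrA -(kernel_prod_hdes hc ne hl) -kernel_prodE; have sl : size l = n by case: hl.
  rewrite sl /Hdes /power_prod; congr (_ * _); apply: eq_bigr => j _; last by rewrite !mxE.
  by congr hdes; apply: eq_bigr => k _; rewrite !mxE.
have -> : \prod_(k < n) ((cexp ((0 +i* (2 * pi)) * (\row_(k0 < n) s k0) 0 k) - 1) * cGamma
  ((\row_(k0 < n) s k0) 0 k))^-1 = pref_prod n s.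
  by apply: eq_bigr => k _; rewrite mxE.
have c1 : ((1 - c) ^+ n)%:C != 0 :> C.
  rewrite eq_complex /= eqxx andbT expf_neq0// subr_eq0 eq_sym lt_eqF//.
  by case/andP: hc.
have -> : (((1 - c) ^+ n)^-1)%:C = (((1 - c) ^+ n)%:C)^-1 :> C by exact: fmorphV.
by rewrite mulrA [X in X * _]mulrAC mulVf// mul1r.
Qed.

Lemma zeta_int_ext n s s' : (forall k,
  (k < n)%N -> s k = s' k) -> zeta_int e n s = zeta_int e n s'.
Proof. by move=> h; congr hankel_seq; apply/funext => l; rewrite (power_prod_ext l h). Qed.

Lemma zeta_int_cvg (N : R) n (s_ : nat -> nat -> C) s : 1 <= N -> n.+1%:R * e <= 4^-1 ->
  (forall m, exponents_bd N n (s_ m)) -> exponents_bd N n s ->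
  (forall k, (k < n)%N -> ccvg (fun m => s_ m k) (s k)) ->
  ccvg (fun m => zeta_int e n (s_ m)) (zeta_int e n s).
Proof.
move=> N1 ne hs_ hs c.
have p0 : 0 <= int_bd e N ^+ n by rewrite exprn_ge0 ?int_bd_ge0.
apply: (hankel_seq_cvg e0 p0).
- by move=> m; exact: (integrand_adm e0 e8 N1 (dbern_qok R) ne (normc0_le_radius e0)).
- exact: (integrand_adm e0 e8 N1 (dbern_qok R) ne (normc0_le_radius e0)).
- move=> l hl; apply: ccvgM; first exact: ccvg_cst.
  apply: ccvg_prod => k _; apply: ccvg_cexp; apply: ccvgM; last exact: ccvg_cst.
  by apply: ccvgD; [exact: c|exact: ccvg_cst].
Qed.

Definition good n (Z : 'rV[C]_n -> C^o) := forall s : 'rV[C]_n, non_integral s ->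
    zeta_des_approx e c s @[c --> (1 : R)^'] --> Z s.

(** Dominated convergence along c = 1 - 1 / (m + 2). *)
Lemma zeta_val n (Z : 'rV[C]_n -> C^o) s : n.+1%:R * e <= 4^-1 -> good Z ->
  (forall k, (k < n)%N -> nonint (s k)) -> Z (\row_(k < n) s k) = pref_prod n s * zeta_int e n s.
Proof.
move=> ne gZ hs; have ns : non_integral (\row_(k < n) s k).
  by move=> k m; rewrite mxE; exact: hs.
pose c (m : nat) : R := 1 - m.+2%:R^-1.
have cb m : 2^-1 <= c m < 1.
  rewrite /c gtrBl invr_gt0 ltr0n andbT lerBrDr addrC -lerBrDr.
  rewrite (_ : 1 - 2^-1 = 2^-1 :> R); last by field.
  by rewrite lef_pV2 ?posrE// ler_nat.
have cb' m : 2^-1 <= c m <= 1 by case/andP: (cb m) => -> /ltW ->.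
have c1 : c m @[m --> \oo] --> (1 : R).
  rewrite -[X in _ --> X]subr0; apply: cvgB; first exact: cvg_cst.
  have h : (fun m : nat => m.+1%:R^-1 : R) @ \oo --> (0 : R) by exact: inv_nat0.
  by rewrite -(cvg_shiftS (fun m : nat => m.+1%:R^-1 : R)) in h.
have c1' : c m @[m --> \oo] --> (1 : R)^'.
  move=> A hA; have H : \forall m \near \oo, c m != 1 -> A (c m) := c1 _ hA.
  change (\forall m \near \oo, A (c m)); apply: filterS H => m; apply.
  by rewrite lt_eqF//; case/andP: (cb m).
have lim1 : ccvg (fun m => zeta_des_approx e (c m) (\row_(k < n) s k)) (Z (\row_(k < n) s k)).
  apply: cvgC_ccvg; exact: (cvg_comp _ _ c1' (gZ _ ns)).
apply: ccvg_unique lim1 _.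
apply: (@ccvg_ext _ (fun m => pref_prod n s * hankel_seq e n (fun l => kernel_prod (hdes_quot
  (c m)) 0 l * power_prod s n l))).
  by move=> m; rewrite approxE.
apply: ccvgM; first exact: ccvg_cst.
have [N N1 hsb] := exponents_bd_ex n s.
have p0 : 0 <= int_bd e N ^+ n by rewrite exprn_ge0 ?int_bd_ge0.
apply: (hankel_seq_cvg e0 p0).
- by move=> m; exact: (integrand_adm e0 e8 N1 (hdes_quot_qok (cb' m)) ne (normc0_le_radius e0)).
- exact: (integrand_adm e0 e8 N1 (dbern_qok R) ne (normc0_le_radius e0)).
- move=> l hl; apply: ccvgM; last exact: ccvg_cst.
  move: ne l hl; clear -c1 cb' e0; elim: n => [|n IH] ne l hl.
    case: hl => /size0nil -> _; exact: ccvg_cst.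
  have ne' : n.+1%:R * e <= 4^-1 by apply: le_trans ne; rewrite ler_wpM2r ?(ltW e0)// ler_nat.
  have hr := region_tsum e0 ne (normc0_le_radius e0) hl; have [El cw hb] := pts_behead hl.
  move: hr; rewrite El; set w := nth _ _ _; set l' := behead _ => hr /=.
  by apply: ccvgM; [exact: hdes_quot_cvg|exact: IH].
Qed.
End Values.

(** * Limits at integral points *)

Section Assembly.
Variable R : realType.
Local Notation C := R[i].
Local Notation Re := (@complex.Re R).
Local Notation Im := (@complex.Im R).
Implicit Types (z w t : C) (x a c : R) (l : seq C) (s : nat -> C).
Local Notation dbern := (@dbern R).

Definition tiny (N m : nat) : R := (m + N).+2%:R^-1.
Lemma tiny_bd N m : 0 < tiny N m < 1.
Proof. by rewrite /tiny invr_gt0 ltr0n invf_lt1 ?ltr0n// ltr1n. Qed.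

Lemma tiny_cvg N : tiny N m @[m --> \oo] --> (0 : R).
Proof.
have h : (fun m : nat => m.+1%:R^-1 : R) @ \oo --> (0 : R) by exact: inv_nat0.
have -> : tiny N = (fun m => (m + (N + 1)).+1%:R^-1).
  by apply/funext => m; rewrite /tiny addnA addn1.
by rewrite (cvg_shiftn (N + 1) (fun m : nat => m.+1%:R^-1 : R)).
Qed.

Lemma nonint_real x : (forall j : int, x != j%:~R) -> nonint (x%:C : C).
Proof.
move=> h j; apply: contra (h j); rewrite -(rmorph_int (real_complex R)) => /eqP/(congr1 Re) /= ->.
by [].
Qed.

Lemma unit_nonint x : 0 < x < 1 -> nonint (x%:C : C).
Proof.
move=> /andP[x0 x1]; apply: nonint_real => j; apply/eqP => xj.
move: x1; rewrite xj -[1]/(1%:~R) ltr_int ltNge => /negP; apply.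
by rewrite -gtz0_ge1 -(ltr0z R) -xj.
Qed.

Lemma nonint_delta N m (k : nat) : nonint ((tiny N m)%:C - k%:R : C).
Proof. exact: (nonint_sub (k : int) (unit_nonint (tiny_bd N m))). Qed.

Lemma tiny_shift N m : tiny N m = tiny 0 (m + N).
Proof. by rewrite /tiny addn0. Qed.

Lemma tiny_lt m m' : (m < m')%N -> tiny 0 m' < tiny 0 m.
Proof. by move=> h; rewrite /tiny !addn0 ltf_pV2 ?posrE ?ltr0n// ltr_nat !ltnS. Qed.

(** At most one of the numbers z + 1 / (m + 2) is an integer, as their differences
    lie strictly between 0 and 1. *)
Lemma nonint_shift1 z : exists N, forall m, nonint (z + (tiny N m)%:C).
Proof.
have [[m0 [j hj]]|h] := pselect (exists m0, exists j : int, z + (tiny 0 m0)%:C = j%:~R);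
  last first.
  by exists 0%N => m j; apply/eqP => hj; apply: h; exists m, j.
exists m0.+1 => m j'; apply/eqP => hj'.
have lt : tiny 0 (m + m0.+1) < tiny 0 m0 by apply: tiny_lt; rewrite addnS ltnS leq_addl.
have b : 0 < tiny 0 m0 - tiny 0 (m + m0.+1) < 1.
  have /andP[? ?] := tiny_bd 0 m0; have /andP[? ?] := tiny_bd 0 (m + m0.+1).
  by rewrite subr_gt0 lt /=; lra.
have /negP := unit_nonint b (j - j'); apply; apply/eqP.
have dE : (tiny 0 m0 - tiny 0 (m + m0.+1))%:C = (tiny 0 m0)%:C - (tiny 0 (m + m0.+1))%:C :> C.
  exact: (rmorphB (real_complex R)).
by rewrite tiny_shift in hj'; rewrite dE [RHS]rmorphB /= -hj -hj'; ring.
Qed.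

Lemma nonint_shift n s : exists N, forall m k, (k < n)%N -> nonint (s k + (tiny N m)%:C).
Proof.
elim: n => [|n [N hN]]; first by exists 0%N.
have [N' hN'] := nonint_shift1 (s n).
exists (N + N')%N => m k; rewrite ltnS leq_eqVlt => /predU1P[->|kn].
  by rewrite tiny_shift addnA -tiny_shift; exact: hN'.
by rewrite tiny_shift (addnC N) addnA -tiny_shift; exact: hN.
Qed.

Section FixedRadius.
Variable e : R.
Hypothesis e0 : 0 < e.
Hypothesis e8 : e <= 8^-1.
Variable zd : forall r : nat, 'rV[C]_r -> C^o.
Hypothesis zdP : forall r, (1 <= r)%N -> is_zeta_des (@zd r).

Let zval n s := zd (\row_(k < n) s k) : C.
Lemma zval_ext n s s' : (forall k, (k < n)%N -> s k = s' k) -> zval n s = zval n s'.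
Proof. by move=> h; congr zd; apply/rowP => k; rewrite !mxE h. Qed.

Lemma zval_ray n s (d : nat -> R) (x : nat -> R) : x m @[m --> \oo] --> (0 : R) ->
  ccvg (fun m => zval n.+1 (fun k => s k + (x m * d k)%:C)) (zval n.+1 s).
Proof.
move=> x0; have := zeta_ray (\row_(k < n.+1) s k) (\row_(k < n.+1) (d k)%:C) (zdP (ltn0Sn n)) x0.
apply: ccvg_ext => m; congr zd; apply/rowP => k; rewrite !mxE.
by rewrite rmorphM.
Qed.

Lemma pref_prod_supd n s z : pref_prod n.+1 (upd s n z) = pref_prod n s * hankel_pref z.
Proof.
rewrite /pref_prod big_ord_recr /= /upd eqxx; congr (_ * _).
by apply: eq_bigr => k _; rewrite ltn_eqF.
Qed.

Lemma zval_supd_ray n s z N :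
  ccvg (fun m => zval n.+1 (upd s n ((tiny N m)%:C + z))) (zval n.+1 (upd s n z)).
Proof.
apply: ccvg_ext (zval_ray n (upd s n z) (fun k => if k == n then 1 else 0) (tiny_cvg N)) => m.
apply: zval_ext => k _; rewrite /upd; case: ifP => _; first by rewrite mulr1 addrC.
by rewrite mulr0 addr0.
Qed.

Lemma zeta_int_supd_ray n s z N : n.+2%:R * e <= 4^-1 ->
  ccvg (fun m => zeta_int e n.+1 (upd s n ((tiny N m)%:C + z))) (zeta_int e n.+1 (upd s n z)).
Proof.
move=> ne; have [M M1 hM] := exponents_bd_ex n.+1 (upd s n z).
apply: (zeta_int_cvg e0 e8 (N := M + 1)) => //.
- by rewrite lerDr (le_trans _ M1).
- move=> m k kn; have [h1 h2] := hM k kn; move: h1 h2; rewrite /upd.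
  case: ifP => _ h1 h2; last by split; lra.
  rewrite ReD ImD /= add0r; split; last by lra.
  have /andP[d0 d1] := tiny_bd N m.
  rewrite -addrA addrC; apply: le_trans (ler_normD _ _) _; apply: lerD => //.
  by rewrite gtr0_norm// ltW.
- by move=> k kn; have [h1 h2] := hM k kn; split; lra.
- move=> k kn; rewrite /upd; case: ifP => _; last exact: ccvg_cst.
  rewrite -[X in ccvg _ X]add0r; apply: ccvgD; last exact: ccvg_cst.
  exact: ccvgR (tiny_cvg N).
Qed.

Lemma taylor_coef_cst i : taylor_coef e i (fun=> 1) 0 = (i == 0%N)%:R :> C.
Proof.
have st : strip 4^-1 (0 : C) by rewrite /strip /= normr0 invr_gt0.
have h1 := hol_cst (2^-1 : R) (1 : C).
case: i => [|i]; first by rewrite (taylor_coef0 e0 e8 h1).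
have := taylor_coef_deriv e0 e8 h1 i st.
have -> : taylor_coef e i (fun=> 0) 0 = 0 :> C.
  rewrite /taylor_coef (@cint_FTC _ 0 (2 * pi) (fun=> 0)) ?subrr ?mulr0//.
  - exact: pi2_gt0.
  - by move=> a _; rewrite mul0r; exact: cder_cst.
  - by move=> u a _ _ _; rewrite mul0r; apply: ccvg_ext (ccvg_cst 0) => m; rewrite mul0r.
move/eqP; rewrite eq_sym mulf_eq0 pnatr_eq0 /= => /eqP ->.
by [].
Qed.

Lemma zeta_int_one k : 2%:R * e <= 4^-1 -> zeta_int e 1 (fun=> - k%:R) = (0 +i*
  (2 * pi)) * taylor_coef e k dbern 0.
Proof.
move=> ne; rewrite (zeta_int_residue e0 e8 ne (k := k))//.
have E i s : coef_int e 0 i s = (i == 0%N)%:R.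
  by rewrite /coef_int /= /power_prod big_ord0 mulr1 -taylor_coef_cst.
rewrite big_ord_recl /= E subn0 mulr1 big1 ?addr0// => i _.
by rewrite E mulr0.
Qed.

Section Limit.
Hypothesis g1 : good e (@zd 1).
Hypothesis e2 : 2%:R * e <= 4^-1.

Lemma zval1 N m (k : nat) : zval 1 (fun=> (tiny N m)%:C - k%:R) =
  hankel_pref ((tiny N m)%:C - k%:R) * zeta_int e 1 (fun=> (tiny N m)%:C - k%:R).
Proof.
have := zeta_val (s := fun=> (tiny N m)%:C - k%:R) e0 e8 e2 g1 (fun j _ => @nonint_delta N m k).
by rewrite /pref_prod big_ord1.
Qed.

(** On non-integral points the factor is the quotient of the continuous functions
    zeta_1 and [zeta_int], and the latter does not vanish at 0. *)
Lemma hankel_pref_lim : exists N, exists L : C, ccvg (fun m => hankel_pref (tiny N m)%:C) L.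
Proof.
have e0z : (fun=> - 0%:R) = (fun=> 0) :> (nat -> C) by apply/funext => ?; rewrite oppr0.
have I0 : zeta_int e 1 (fun=> 0) != 0.
  have := zeta_int_one 0 e2; rewrite e0z => ->.
  have st : strip 4^-1 (0 : C) by rewrite /strip /= normr0 invr_gt0.
  have [g' hg] := dbern_hol2 R; rewrite (taylor_coef0 e0 e8 hg)// dbern0.
  apply: mulf_neq0; last by rewrite oppr_eq0 invr_eq0 pnatr_eq0.
  by rewrite eq_complex /= eqxx /= gt_eqF// pi2_gt0.
have IE N : ccvg (fun m => zeta_int e 1 (fun=> (tiny N m)%:C)) (zeta_int e 1 (fun=> 0)).
  have := @zeta_int_supd_ray 0 (fun=> 0) 0 N e2.
  rewrite (@zeta_int_ext _ _ 1 (upd (fun=> 0) 0 0) (fun=> 0)); last by case.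
  apply: ccvg_ext => m; apply: zeta_int_ext; case=> // _; by rewrite /upd /= addr0.
have VE N : ccvg (fun m => zval 1 (fun=> (tiny N m)%:C)) (zval 1 (fun=> 0)).
  have := @zval_supd_ray 0 (fun=> 0) 0 N.
  rewrite (@zval_ext 1 (upd (fun=> 0) 0 0) (fun=> 0)); last by case.
  apply: ccvg_ext => m; apply: zval_ext; case=> // _; by rewrite /upd /= addr0.
(* Skip the finitely many indices at which the integral may vanish. *)
have [N hN] : exists N, forall m, zeta_int e 1 (fun=> (tiny N m)%:C) != 0.
  have n0 : 0 < normc (zeta_int e 1 (fun=> 0)).
    by rewrite lt_neqAle normc_ge0 andbT eq_sym; apply: contra I0 => /eqP/eq0_normc ->.
  have [N _ hN] := cvgr_gt _ (ccvg_normc (IE 0%N)) _ n0.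
  exists N => m; have := hN (m + N)%N (leq_addl _ _).
  by rewrite /= -tiny_shift; apply: contraTneq => ->; rewrite normc_0 ltxx.
exists N, (zval 1 (fun=> 0) * (zeta_int e 1 (fun=> 0))^-1).
apply: ccvg_ext (ccvgM (VE N) (ccvgV I0 (IE N))) => m.
have := zval1 N m 0; rewrite subr0 => ->.
by rewrite mulfK.
Qed.

Variables (N : nat) (L : C).
Hypothesis hL : ccvg (fun m => hankel_pref (tiny N m)%:C) L.

Lemma prod_fact (j : nat) : \prod_(q < j) ((0 : C) - 1 - q%:R) = (-1) ^+ j * j`!%:R.
Proof.
elim: j => [|j IH]; first by rewrite big_ord0 expr0 mul1r.
by rewrite big_ord_recr /= IH factS natrM exprS -natr1; ring.
Qed.

Lemma hankel_pref_lim_sub (j : nat) :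
  ccvg (fun m => hankel_pref ((tiny N m)%:C - j%:R)) (L * ((-1) ^+ j * j`!%:R)).
Proof.
rewrite -prod_fact.
apply: (@ccvg_ext _ (fun m => hankel_pref (tiny N m)%:C * \prod_(q < j)
  ((tiny N m)%:C - 1 - q%:R))).
  by move=> m; rewrite hankel_pref_sub//; exact: unit_nonint (tiny_bd N m).
apply: ccvgM => //; apply: ccvg_prod => q _.
apply: ccvgD; last exact: ccvg_cst.
apply: ccvgD; last exact: ccvg_cst.
exact: ccvgR (tiny_cvg N).
Qed.

(** Let the last argument tend to - j along non-integral values. *)
Lemma zval_neg n s (j : nat) : good e (@zd n.+1) -> n.+2%:R * e <= 4^-1 ->
  (forall k, (k < n)%N -> nonint (s k)) ->
  zval n.+1 (upd s n (- j%:R)) = pref_prod n s * (L * ((-1) ^+ j * j`!%:R)) * zeta_int e n.+1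
    (upd s n (- j%:R)).
Proof.
move=> gz ne hs; apply: ccvg_unique (zval_supd_ray n s (- j%:R) N) _.
apply: (@ccvg_ext _ (fun m => pref_prod n s * hankel_pref ((tiny N m)%:C - j%:R) *
   zeta_int e n.+1 (upd s n ((tiny N m)%:C - j%:R)))).
  move=> m; rewrite /zval (zeta_val e0 e8 ne gz) ?pref_prod_supd// => k.
  rewrite /upd; case: eqVneq => [_ _|kn]; first exact: nonint_delta.
  by rewrite ltnS leq_eqVlt (negbTE kn) /=; exact: hs.
apply: ccvgM; last exact: zeta_int_supd_ray.
by apply: ccvgM; [exact: ccvg_cst|exact: hankel_pref_lim_sub].
Qed.

Lemma nonint_case n s (k : nat) : good e (@zd n.+1) -> good e (@zd n.+2) ->
  n.+3%:R * e <= 4^-1 -> (forall j, (j < n.+1)%N -> nonint (s j)) ->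
  zval n.+2 (upd s n.+1 (- k%:R)) =
  \sum_(i < k.+1) 'C(k, i)%:R * zval n.+1 (upd s n (s n - i%:R)) * zval 1 (fun=> - (k - i)%:R).
Proof.
move=> gn gn1 ne hs.
have ne' : n.+2%:R * e <= 4^-1 by apply: le_trans ne; rewrite ler_wpM2r ?(ltW e0)// ler_nat.
rewrite (zval_neg k gn1 ne hs) (zeta_int_residue e0 e8 ne (k := k)); last by rewrite /upd eqxx.
rewrite mulr_sumr; apply: eq_bigr => i _.
have ik : (i <= k)%N by rewrite -ltnS ltn_ord.
have PE : coef_int e n.+1 i (upd s n.+1 (- k%:R)) = coef_int e n.+1 i s.
  rewrite /coef_int; congr hankel_seq; apply/funext => l; congr (_ * _).
  by apply: power_prod_ext => j jn; rewrite /upd ltn_eqF.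
have zval1E : zval 1 (fun=> - (k - i)%:R) =
    L * ((-1) ^+ (k - i) * (k - i)`!%:R) * ((0 +i* (2 * pi)) * taylor_coef e (k - i) dbern 0).
  rewrite -zeta_int_one//.
  have := @zval_neg 0 (fun=> 0) (k - i) g1 e2 (fun j h => False_ind _ (Bool.diff_false_true h)).
  rewrite (@zval_ext 1 _ (fun=> - (k - i)%:R)); last by case.
  rewrite (@zeta_int_ext _ _ 1 _ (fun=> - (k - i)%:R)); last by case.
  by rewrite /pref_prod big_ord0 mul1r.
have zvalnE : zval n.+1 (upd s n (s n - i%:R)) =
    pref_prod n.+1 s * \prod_(q < i) (s n - 1 - q%:R) * zeta_int e n.+1 (upd s n (s n - i%:R)).
  rewrite /zval (zeta_val e0 e8 ne' gn); last first.
    move=> j jn; rewrite /upd; case: eqP => _; last exact: hs.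
    by apply: (nonint_sub (i : int)); exact: hs.
  rewrite pref_prod_supd hankel_pref_sub; last exact: hs.
  by rewrite mulrA; congr (_ * _ * _); rewrite /pref_prod big_ord_recr.
have PP := coef_int_parts e0 e8 ne' i s.
have kf : k`!%:R = 'C(k, i)%:R * i`!%:R * (k - i)`!%:R :> C.
  by rewrite -!natrM -mulnA bin_fact.
have sg : (-1) ^+ k = (-1) ^+ (k - i) * (-1) ^+ i :> C by rewrite -exprD subnK.
have s2 : (-1) ^+ i * (-1) ^+ i = 1 :> C by rewrite -expr2 sqrr_sign.
rewrite PE zval1E zvalnE kf sg.
move: (taylor_coef _ _ _ _) (0 +i* _) (zeta_int _ _ _)
  (coef_int _ _ _ _) PP s2 => c0 tp I0 ph PP s2.
move: (\prod_(q < i) _) PP => pr PP.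
have -> : pref_prod n.+1 s * (L * ((-1) ^+ (k - i) * (-1) ^+ i * ('C(k, i)%:R * i`!%:R *
  (k - i)`!%:R))) * (tp * c0 * ph) =
  pref_prod n.+1 s * L * (-1) ^+ (k - i) * 'C(k, i)%:R * (k - i)`!%:R * tp * c0 * (-1) ^+ i *
    (i`!%:R * ph) by ring.
rewrite PP.
have -> : pref_prod n.+1 s * L * (-1) ^+ (k - i) * 'C(k, i)%:R * (k - i)`!%:R * tp * c0 *
  (-1) ^+ i * ((-1) ^+ i * pr * I0) =
  pref_prod n.+1 s * L * (-1) ^+ (k - i) * 'C(k, i)%:R * (k - i)`!%:R * tp * c0 * pr * I0 *
    ((-1) ^+ i * (-1) ^+ i) by ring.
by rewrite s2; ring.
Qed.

Lemma general_case n s (k : nat) : good e (@zd n.+1) -> good e (@zd n.+2) ->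
  n.+3%:R * e <= 4^-1 ->
  zval n.+2 (upd s n.+1 (- k%:R)) =
  \sum_(i < k.+1) 'C(k, i)%:R * zval n.+1 (upd s n (s n - i%:R)) * zval 1 (fun=> - (k - i)%:R).
Proof.
move=> gn gn1 ne; have [M hM] := nonint_shift n.+1 s.
pose t m j : C := s j + (tiny M m)%:C.
have l1 : ccvg (fun m => zval n.+2 (upd (t m) n.+1 (- k%:R))) (zval n.+2 (upd s n.+1 (- k%:R))).
  apply: ccvg_ext (zval_ray n.+1 (upd s n.+1 (- k%:R)) (fun j => if j == n.+1 then 0 else 1)
    (tiny_cvg M)) => m.
  apply: zval_ext => j _; rewrite /upd; case: ifP => _; first by rewrite mulr0 addr0.
  by rewrite mulr1.
apply: ccvg_unique l1 _.
apply: (@ccvg_ext _ (fun m => \sum_(i < k.+1) 'C(k, i)%:R * zval n.+1 (upd (t m) n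
  (t m n - i%:R)) * zval 1 (fun=> - (k - i)%:R))).
  by move=> m; rewrite nonint_case// => j jn; exact: hM.
apply: ccvg_sum => i _; apply: ccvgM; last exact: ccvg_cst.
apply: ccvgM; first exact: ccvg_cst.
apply: ccvg_ext (zval_ray n (upd s n (s n - i%:R)) (fun=> 1) (tiny_cvg M)) => m.
apply: zval_ext => j _; rewrite /upd mulr1 /t; case: ifP => _ //.
by rewrite addrAC.
Qed.
End Limit.
End FixedRadius.
Lemma good_radius (zd : forall r : nat, 'rV[C]_r -> C^o) n :
  (forall r, (1 <= r)%N -> is_zeta_des (@zd r)) ->
  exists e : R, [/\ 0 < e, e <= 8^-1, n.+3%:R * e <= 4^-1 &
   [/\ good e (zd 1%N), good e (zd n.+1) & good e (zd n.+2)]].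
Proof.
move=> zdP.
have [_ h1] := zdP 1%N isT; have [_ hn] := zdP n.+1 isT.
have [_ hn1] := zdP n.+2 isT.
have n3 : 0 < n.+3%:R :> R by [].
(* A radius below 1 / (8 (n + 3)) satisfies both numerical conditions. *)
have b0 : 0 < (8 * n.+3%:R)^-1 :> R by rewrite invr_gt0 mulr_gt0.
have p0 : \forall e \near (0 : R)^'+, 0 < e by exact: nbhs_right_gt.
have p1 : \forall e \near (0 : R)^'+, e < (8 * n.+3%:R)^-1 by exact: nbhs_right_lt.
have [e [[[[? ?] ?] ?] ?]] := filter_ex (filterI (filterI (filterI (filterI p0 p1) h1) hn) hn1).
have eb : e * (8 * n.+3%:R) < 1 by rewrite -ltr_pdivlMr ?mulr_gt0// div1r.
have x1 : 1 <= n.+3%:R :> R by rewrite ler1n.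
have ex : 0 <= e * (n.+3%:R - 1) by rewrite mulr_ge0 ?subr_ge0// ltW.
by exists e; split => //; move: eb ex; move: (n.+3%:R : R) => x; lra.
Qed.
End Assembly.

Local Close Scope classical_set_scope.

Theorem proposition4p8 (R : realType)
  (zeta_des : forall r : nat, 'rV[R[i]]_r -> R[i]^o)
  (zeta_desP : forall r : nat, (1 <= r)%N -> is_zeta_des (zeta_des r))
  (r : nat) (hr : (2 <= r)%N) (s : nat -> R[i]) (k : nat) :
  zeta_des r (\row_(l < r) if l.+1 == r then - k%:R else s l) =
  \sum_(i < k.+1)
    'C(k, i)%:R
    * zeta_des r.-1 (\row_(l < r.-1) if l.+1 == r.-1 then s l - i%:R else s l)
    * zeta_des 1%N (\row_(l < 1) - (k - i)%N%:R).
Proof.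
case: r hr => [//|[//|n]] _ /=.
have [e [e0 e8 ne [g1 gn gn1]]] := good_radius n zeta_desP.
have e2 : 2%:R * e <= 4^-1 by apply: le_trans ne; rewrite ler_wpM2r ?(ltW e0)// ler_nat.
have [N [L hL]] := hankel_pref_lim e0 e8 zeta_desP g1 e2.
have H := general_case e0 e8 zeta_desP g1 e2 hL s k gn gn1 ne.
have row1 (m : nat) (z : R[i]) : \row_(l < m.+1) (if l.+1 == m.+1 then z else s l) =
    \row_(l < m.+1) upd s m z l.
  by apply/rowP => l; rewrite !mxE /upd eqSS.
rewrite row1 H; apply: eq_bigr => i _; congr (_ * zeta_des _ _ * _).
by apply/rowP => l; rewrite !mxE /upd eqSS; case: eqP => [->|].
Qed.
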